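(* Let $k\ge0$ be an integer, $0<R_1<R_2<R$, $A=\{z:R_1<|z|<R_2\}\subset\Delta_R=\{|z|<R\}$, and $\omega=z^kdz$ on $\Delta_R$. Let $U\subset\mathbb C^n$ be a neighborhood of $\mathbf 0$ and $\alpha:\Delta_R\times U\to\mathbb C$, $(z,\mathbf u)\mapsto\alpha_{\mathbf u}(z)$, a holomorphic map with $\alpha_{\mathbf 0}\equiv0$, and let $\omega_{\mathbf u}=\left(z^k+\frac{\alpha_{\mathbf u}(z)}{z}\right)dz$. Let $\theta_j=e^{2\pi ij/(k+1)}$ be a $(k+1)$st root of unity, $p\in A$, and $\sigma:U\to\Delta_R$ holomorphic with $\sigma(\mathbf 0)=\theta_jp$. Then there exist a neighborhood $U_{\mathbf 0}\subset U$ of $\mathbf 0$ and a holomorphic map $\phi:A\times U_{\mathbf 0}\to\Delta_R$, $(z,\mathbf u)\mapsto\phi_{\mathbf u}(z)$, such that $\phi_{\mathbf u}^*(\omega_{\mathbf u})=\left(z^k+\frac{\alpha_{\mathbf u}(0)}{z}\right)dz$ for all $\mathbf u\in U_{\mathbf 0}$, $\phi_{\mathbf 0}(z)=\theta_jz$ for all $z\in A$, and $\phi_{\mathbf u}(p)=\sigma(\mathbf u)$ for all $\mathbf u\in U_{\mathbf 0}$. *)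

(* Defs.v *)
From Stdlib Require Import Reals.
From Coquelicot Require Import Coquelicot.
From mathcomp Require Import ssreflect ssrfun ssrbool eqtype ssrnat fintype bigop.

Local Open Scope R_scope.

Definition Cn (n : nat) := 'I_n -> C.

Definition Cn_zero {n : nat} : Cn n := fun _ => RtoC 0.
Definition Cn_add {n : nat} (u h : Cn n) : Cn n := fun i => Cplus (u i) (h i).
Definition Cn_sub {n : nat} (u h : Cn n) : Cn n := fun i => Cminus (u i) (h i).

Definition Cn_norm {n : nat} (h : Cn n) : R :=
  \big[Rmax/0]_(i < n) Cmod (h i).

Definition Cn_lin {n : nat} (c h : Cn n) : C :=
  \big[Cplus/RtoC 0]_(i < n) Cmult (c i) (h i).

Definition Cn_open {n : nat} (U : Cn n -> Prop) : Prop :=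
  forall u, U u -> exists r, 0 < r /\ forall v, Cn_norm (Cn_sub v u) < r -> U v.

Definition holoN {n : nat} (U : Cn n -> Prop) (f : Cn n -> C) : Prop :=
  forall u, U u -> exists c : Cn n,
    forall eps, 0 < eps -> exists delta, 0 < delta /\
      forall h, Cn_norm h < delta ->
        Cmod (Cminus (Cminus (f (Cn_add u h)) (f u)) (Cn_lin c h))
          <= eps * Cn_norm h.

Definition holo2 {n : nat} (D : C -> Prop) (U : Cn n -> Prop)
    (f : C -> Cn n -> C) : Prop :=
  forall z u, D z -> U u -> exists (a : C) (c : Cn n),
    forall eps, 0 < eps -> exists delta, 0 < delta /\
      forall (w : C) (h : Cn n), Cmod w < delta -> Cn_norm h < delta ->
        Cmod (Cminus (Cminus (Cminus (f (Cplus z w) (Cn_add u h)) (f z u))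
                             (Cmult a w)) (Cn_lin c h))
          <= eps * Rmax (Cmod w) (Cn_norm h).

Definition cdisc (R0 : R) (z : C) : Prop := Cmod z < R0.
Definition annulus (R1 R2 : R) (z : C) : Prop := R1 < Cmod z /\ Cmod z < R2.

Definition root_unity (k j : nat) : C :=
  (cos (2 * PI * INR j / INR (S k)), sin (2 * PI * INR j / INR (S k))).

(* Main.v *)
(** Write [phi = theta z (1 + s)] with [theta] the root of unity. Since
    [alpha_u(w) / w = alpha_u(0) / w + (alpha_u(w) - alpha_u(0)) / w], the form [omega_u] has
    the multivalued primitive [w^(k+1) / (k+1) + alpha_u(0) log w + B_u(w)], with [B_u]
    single-valued, so the pullback condition integrates to
    [z^(k+1) ((1+s)^(k+1) - 1) / (k+1) + alpha_u(0) log (1+s) + B_u(theta z (1+s)) = c(u)],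
    in which the monodromy of the two logarithms has cancelled. The constant [c(u)] is
    prescribed by [phi_u(p) = sigma(u)]. For small [u] this is a perturbation of
    [z^(k+1) s = 0], so it has a unique small solution [s] by the contraction principle,
    uniformly over the annulus, and [s] is holomorphic by the implicit function theorem.

    Holomorphy is only pointwise complex differentiability, so the smoothness of [B] rests on
    Goursat's lemma, Cauchy's formula, and the second-order Taylor bound they imply, which
    allows differentiation under the integral defining [B]. *)

Require Import Defs.
From Stdlib Require Import Reals ZArith Lra Lia FunctionalExtensionality ClassicalEpsilon.
From Coquelicot Require Import Coquelicot.
From mathcomp Require Import ssreflect ssrfun ssrbool eqtype ssrnat seq fintype bigop.

Local Open Scope R_scope.

(** * Complex differentiability *)

(** Pointwise differentiability supplies no continuous derivative, so neither the usual implicit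
    function theorem nor differentiation under the integral applies as it stands. Two estimates
    replace them. A function holomorphic and bounded by [M] on a ball has a quadratic Taylor
    remainder whose constant depends only on [M] and the radius, and such a bound can be integrated.
    The smallness that drives the contraction also bounds increments of the equation in [s] from
    below, proportionally to [R1 ^ k.+1]; uniqueness, continuity and invertibility of the
    [s]-derivative all come from this bound.

    The annulus is not compact. Uniformity over it comes from one circle of radius [r] between [R2]
    and the outer radius: the Lipschitz constant of [B] on a smaller disc is controlled by the
    supremum of [alpha] on that circle, which compactness makes small. The root of unity leaves the
    leading term because its power [k + 1] is 1, and the conditions at [u = 0] and at [z = p] are
    two instances of uniqueness. *)

(* [nlin] singles out the admissible differentials, so that one notion of
   differentiability covers functions of real, complex and mixed variables. *)
Record nspace := Nspace {
  ncar :> Type;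
  nzero : ncar;
  nadd : ncar -> ncar -> ncar;
  nnorm : ncar -> R;
  nlin : (ncar -> C) -> Prop;
  naddx0 : forall x, nadd x nzero = x;
  nnorm0 : nnorm nzero = 0;
  nnorm_ge0 : forall h, 0 <= nnorm h;
  nlin_bound : forall l, nlin l ->
    exists K, 0 < K /\ forall h, Cmod (l h) <= K * nnorm h;
  nlin_zero : nlin (fun _ => RtoC 0);
  nlin_add : forall l m, nlin l -> nlin m -> nlin (fun h => Cplus (l h) (m h));
  nlin_scal : forall c l, nlin l -> nlin (fun h => Cmult c (l h)) }.

Arguments nzero {_}.
Arguments nadd {_}.
Arguments nnorm {_}.
Arguments nlin {_}.

Lemma Cmod_RtoC (x : R) : Cmod (RtoC x) = Rabs x.
Proof. exact: Cmod_R. Qed.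

Lemma Cmod_sub_sym (a b : C) : Cmod (Cminus a b) = Cmod (Cminus b a).
Proof. by rewrite -Cmod_opp; congr Cmod; ring. Qed.

Lemma Cmod_sub_le (a b : C) : Cmod (Cminus a b) <= Cmod a + Cmod b.
Proof. by rewrite -(Cmod_opp b); apply: Cmod_triangle. Qed.

Lemma Cmod_le_add_sub (a b : C) : Cmod a <= Cmod b + Cmod (Cminus a b).
Proof.
have -> : a = Cplus b (Cminus a b) by ring.
by have := Cmod_triangle b (Cminus a b); rewrite (_ : Cplus b (Cminus a b) = a) //; ring.
Qed.

Section RealLine.

Let rlin (l : R -> C) := exists c, forall h, l h = Cmult c (RtoC h).

Let rlin_bound l : rlin l -> exists K, 0 < K /\ forall h, Cmod (l h) <= K * Rabs h.
Proof.
move=> [c Hc]; exists (Cmod c + 1); split; first by have := Cmod_ge_0 c; lra.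
move=> h; rewrite Hc Cmod_mult Cmod_RtoC.
by have := Cmod_ge_0 c; have := Rabs_pos h; nra.
Qed.

Let rlin_zero : rlin (fun _ => RtoC 0).
Proof. by exists (RtoC 0) => h; ring. Qed.

Let rlin_add l m : rlin l -> rlin m -> rlin (fun h => Cplus (l h) (m h)).
Proof. by move=> [c Hc] [d Hd]; exists (Cplus c d) => h; rewrite Hc Hd; ring. Qed.

Let rlin_scal a l : rlin l -> rlin (fun h => Cmult a (l h)).
Proof. by move=> [c Hc]; exists (Cmult a c) => h; rewrite Hc; ring. Qed.

Definition NR : nspace :=
  @Nspace R 0 Rplus Rabs rlin Rplus_0_r Rabs_R0 Rabs_pos
    rlin_bound rlin_zero rlin_add rlin_scal.

End RealLine.

Section ComplexLine.

Let clin (l : C -> C) := exists c, forall h, l h = Cmult c h.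

Let clin_bound l : clin l -> exists K, 0 < K /\ forall h, Cmod (l h) <= K * Cmod h.
Proof.
move=> [c Hc]; exists (Cmod c + 1); split; first by have := Cmod_ge_0 c; lra.
move=> h; rewrite Hc Cmod_mult.
by have := Cmod_ge_0 c; have := Cmod_ge_0 h; nra.
Qed.

Let clin_zero : clin (fun _ => RtoC 0).
Proof. by exists (RtoC 0) => h; ring. Qed.

Let clin_add l m : clin l -> clin m -> clin (fun h => Cplus (l h) (m h)).
Proof. by move=> [c Hc] [d Hd]; exists (Cplus c d) => h; rewrite Hc Hd; ring. Qed.

Let clin_scal a l : clin l -> clin (fun h => Cmult a (l h)).
Proof. by move=> [c Hc]; exists (Cmult a c) => h; rewrite Hc; ring. Qed.

Definition NC : nspace :=
  @Nspace C (RtoC 0) Cplus Cmod clin Cplus_0_r Cmod_0 Cmod_ge_0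
    clin_bound clin_zero clin_add clin_scal.

End ComplexLine.

Section CoordinateSpace.

Variable n : nat.

Definition Cn_scal (t : C) (h : Cn n) : Cn n := fun i => Cmult t (h i).

Lemma Cn_norm_ge0 (h : Cn n) : 0 <= Cn_norm h.
Proof.
rewrite /Cn_norm; elim: (index_enum _) => [|i s IH].
  by rewrite big_nil; lra.
by rewrite big_cons; apply: Rle_trans IH (Rmax_r _ _).
Qed.

Lemma Cn_norm_coord (h : Cn n) i : Cmod (h i) <= Cn_norm h.
Proof.
have: i \in index_enum 'I_n by rewrite mem_index_enum.
rewrite /Cn_norm; elim: (index_enum _) => [|i' s IH] //.
rewrite in_cons big_cons => /orP [/eqP <-|/IH Hi]; first exact: Rmax_l.
exact: Rle_trans Hi (Rmax_r _ _).
Qed.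

Lemma Cn_norm_le (h : Cn n) M : 0 <= M -> (forall i, Cmod (h i) <= M) -> Cn_norm h <= M.
Proof.
move=> HM H; rewrite /Cn_norm; elim: (index_enum _) => [|i s IH].
  by rewrite big_nil.
by rewrite big_cons; apply: Rmax_lub.
Qed.

Lemma Cn_norm_zero : Cn_norm (@Cn_zero n) = 0.
Proof.
apply: Rle_antisym; last exact: Cn_norm_ge0.
by apply: Cn_norm_le => [|i]; rewrite ?Cmod_0; lra.
Qed.

Lemma Cn_norm_add (u v : Cn n) : Cn_norm (Cn_add u v) <= Cn_norm u + Cn_norm v.
Proof.
apply: Cn_norm_le => [|i].
  by have := Cn_norm_ge0 u; have := Cn_norm_ge0 v; lra.
apply: Rle_trans (Cmod_triangle _ _) _.
by apply: Rplus_le_compat; apply: Cn_norm_coord.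
Qed.

Lemma Cn_norm_scal t (h : Cn n) : Cn_norm (Cn_scal t h) <= Cmod t * Cn_norm h.
Proof.
apply: Cn_norm_le => [|i].
  by apply: Rmult_le_pos; [apply: Cmod_ge_0 | apply: Cn_norm_ge0].
rewrite Cmod_mult; apply: Rmult_le_compat_l; first exact: Cmod_ge_0.
exact: Cn_norm_coord.
Qed.

Lemma Cn_add_zero (u : Cn n) : Cn_add u Cn_zero = u.
Proof. by apply: functional_extensionality => i; rewrite /Cn_add /Cn_zero; ring. Qed.

Lemma Cn_zero_add (u : Cn n) : Cn_add Cn_zero u = u.
Proof. by apply: functional_extensionality => i; rewrite /Cn_add /Cn_zero; ring. Qed.

Lemma Cn_addK (u v : Cn n) : Cn_add u (Cn_sub v u) = v.
Proof. by apply: functional_extensionality => i; rewrite /Cn_add /Cn_sub; ring. Qed.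

Lemma Cn_lin_bound (c : Cn n) :
  exists K, 0 < K /\ forall h, Cmod (Cn_lin c h) <= K * Cn_norm h.
Proof.
suff [K [HK H]]: exists K, 0 < K /\ forall h : Cn n,
    Cmod (\big[Cplus/RtoC 0]_(i <- index_enum 'I_n) Cmult (c i) (h i)) <= K * Cn_norm h.
  by exists K.
elim: (index_enum _) => [|i s [K [HK IH]]].
  exists 1; split; first lra.
  by move=> h; rewrite big_nil Cmod_0; have := Cn_norm_ge0 h; lra.
exists (Cmod (c i) + K); split; first by have := Cmod_ge_0 (c i); lra.
move=> h; rewrite big_cons; apply: Rle_trans (Cmod_triangle _ _) _.
rewrite Rmult_plus_distr_r; apply: Rplus_le_compat (IH h); rewrite Cmod_mult.
by apply: Rmult_le_compat_l; [apply: Cmod_ge_0 | apply: Cn_norm_coord].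
Qed.

Lemma Cn_lin_addl (c d h : Cn n) :
  Cn_lin (Cn_add c d) h = Cplus (Cn_lin c h) (Cn_lin d h).
Proof.
rewrite /Cn_lin /Cn_add; elim: (index_enum _) => [|i s IH].
  by rewrite !big_nil; ring.
by rewrite !big_cons IH /=; ring.
Qed.

Lemma Cn_lin_scall t (c h : Cn n) : Cn_lin (Cn_scal t c) h = Cmult t (Cn_lin c h).
Proof.
rewrite /Cn_lin /Cn_scal; elim: (index_enum _) => [|i s IH].
  by rewrite !big_nil; ring.
by rewrite !big_cons IH /=; ring.
Qed.

Lemma Cn_lin_scalr t (c h : Cn n) : Cn_lin c (Cn_scal t h) = Cmult t (Cn_lin c h).
Proof.
rewrite /Cn_lin /Cn_scal; elim: (index_enum _) => [|i s IH].
  by rewrite !big_nil; ring.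
by rewrite !big_cons IH /=; ring.
Qed.

Lemma Cn_lin_zerol (h : Cn n) : Cn_lin Cn_zero h = RtoC 0.
Proof.
rewrite /Cn_lin /Cn_zero; elim: (index_enum _) => [|i s IH].
  by rewrite !big_nil.
by rewrite !big_cons IH /=; ring.
Qed.

Lemma Cn_lin_zeror (c : Cn n) : Cn_lin c Cn_zero = RtoC 0.
Proof.
rewrite /Cn_lin /Cn_zero; elim: (index_enum _) => [|i s IH].
  by rewrite !big_nil.
by rewrite !big_cons IH /=; ring.
Qed.

Definition Cn_unit (i : 'I_n) : Cn n := fun j => if j == i then RtoC 1 else RtoC 0.

Lemma Cn_lin_unit (c : Cn n) i : Cn_lin c (Cn_unit i) = c i.
Proof.
have Hi: i \in index_enum 'I_n by rewrite mem_index_enum.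
have Hu: uniq (index_enum 'I_n) by rewrite index_enum_uniq.
rewrite /Cn_lin /Cn_unit.
have H0 : forall s : seq 'I_n, i \notin s ->
    \big[Cplus/RtoC 0]_(j <- s) Cmult (c j) (if j == i then RtoC 1 else RtoC 0) = RtoC 0.
  elim=> [|j s IH]; first by rewrite big_nil.
  rewrite in_cons negb_or => /andP [Hj Hs]; rewrite big_cons IH //.
  by rewrite eq_sym (negbTE Hj); ring.
move: Hi Hu; elim: (index_enum _) => [|j s IH] //.
rewrite in_cons big_cons cons_uniq => /orP [/eqP <-|Hi] /andP [Hj Hu].
  by rewrite eqxx H0 //; ring.
rewrite IH //; case: eqP => [Hji|_]; last by ring.
by move: Hj; rewrite Hji Hi.
Qed.

Let cnlin (l : Cn n -> C) := exists c, forall h, l h = Cn_lin c h.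

Let cnlin_bound l : cnlin l -> exists K, 0 < K /\ forall h, Cmod (l h) <= K * Cn_norm h.
Proof.
move=> [c Hc]; have [K [HK H]] := Cn_lin_bound c.
by exists K; split=> // h; rewrite Hc.
Qed.

Let cnlin_zero : cnlin (fun _ => RtoC 0).
Proof. by exists Cn_zero => h; rewrite Cn_lin_zerol. Qed.

Let cnlin_add l m : cnlin l -> cnlin m -> cnlin (fun h => Cplus (l h) (m h)).
Proof. by move=> [c Hc] [d Hd]; exists (Cn_add c d) => h; rewrite Hc Hd Cn_lin_addl. Qed.

Let cnlin_scal a l : cnlin l -> cnlin (fun h => Cmult a (l h)).
Proof. by move=> [c Hc]; exists (Cn_scal a c) => h; rewrite Hc Cn_lin_scall. Qed.

Definition NCn : nspace :=
  @Nspace (Cn n) Cn_zero Cn_add Cn_norm cnlin Cn_add_zero Cn_norm_zero Cn_norm_ge0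
    cnlin_bound cnlin_zero cnlin_add cnlin_scal.

End CoordinateSpace.

Section Product.

Variables E F : nspace.

Let padd (x y : E * F) := (nadd x.1 y.1, nadd x.2 y.2).
Let pnorm (x : E * F) := Rmax (nnorm x.1) (nnorm x.2).
Let plin (l : E * F -> C) :=
  exists l1 l2, nlin l1 /\ nlin l2 /\ forall h, l h = Cplus (l1 h.1) (l2 h.2).

Let paddx0 x : padd x (nzero, nzero) = x.
Proof. by case: x => x y; rewrite /padd /= !naddx0. Qed.

Let pnorm0 : pnorm (nzero, nzero) = 0.
Proof. by rewrite /pnorm /= !nnorm0 Rmax_left; lra. Qed.

Let pnorm_ge0 h : 0 <= pnorm h.
Proof. exact: Rle_trans (nnorm_ge0 _ h.1) (Rmax_l _ _). Qed.

Let plin_bound l : plin l -> exists K, 0 < K /\ forall h, Cmod (l h) <= K * pnorm h.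
Proof.
move=> [l1 [l2 [H1 [H2 H]]]].
have [K1 [K1p HK1]] := nlin_bound _ _ H1; have [K2 [K2p HK2]] := nlin_bound _ _ H2.
exists (K1 + K2); split; first lra.
move=> h; rewrite H; apply: Rle_trans (Cmod_triangle _ _) _.
rewrite Rmult_plus_distr_r; apply: Rplus_le_compat.
  apply: Rle_trans (HK1 _) _; apply: Rmult_le_compat_l; [lra | exact: Rmax_l].
apply: Rle_trans (HK2 _) _; apply: Rmult_le_compat_l; [lra | exact: Rmax_r].
Qed.

Let plin_zero : plin (fun _ => RtoC 0).
Proof.
exists (fun _ => RtoC 0), (fun _ => RtoC 0).
split; [exact: nlin_zero | split; [exact: nlin_zero | by move=> h; ring]].
Qed.

Let plin_add l m : plin l -> plin m -> plin (fun h => Cplus (l h) (m h)).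
Proof.
move=> [l1 [l2 [H1 [H2 H]]]] [m1 [m2 [I1 [I2 I]]]].
exists (fun h => Cplus (l1 h) (m1 h)), (fun h => Cplus (l2 h) (m2 h)).
split; [exact: nlin_add | split; [exact: nlin_add | by move=> h; rewrite H I; ring]].
Qed.

Let plin_scal a l : plin l -> plin (fun h => Cmult a (l h)).
Proof.
move=> [l1 [l2 [H1 [H2 H]]]].
exists (fun h => Cmult a (l1 h)), (fun h => Cmult a (l2 h)).
split; [exact: nlin_scal | split; [exact: nlin_scal | by move=> h; rewrite H; ring]].
Qed.

Definition Nprod : nspace :=
  @Nspace (E * F) (nzero, nzero) padd pnorm plin paddx0 pnorm0 pnorm_ge0
    plin_bound plin_zero plin_add plin_scal.

End Product.

Definition FD (E : nspace) (f : E -> C) (x : E) (l : E -> C) : Prop :=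
  nlin l /\ forall eps, 0 < eps -> exists delta, 0 < delta /\
    forall h, nnorm h < delta ->
      Cmod (Cminus (Cminus (f (nadd x h)) (f x)) (l h)) <= eps * nnorm h.

Arguments FD {E}.

Definition cont_at (E : nspace) (f : E -> C) (x : E) : Prop :=
  forall eps, 0 < eps -> exists delta, 0 < delta /\
    forall h, nnorm h < delta -> Cmod (Cminus (f (nadd x h)) (f x)) < eps.

Arguments cont_at {E}.

Section Calculus.

Variable E : nspace.
Implicit Types (f g : E -> C) (x : E) (l m : E -> C).

Lemma nlin_ext l m : (forall h, l h = m h) -> nlin l -> nlin m.
Proof. by move=> H Hl; rewrite -(functional_extensionality _ _ H). Qed.

Lemma FD_ext_lin f x l m : (forall h, l h = m h) -> FD f x l -> FD f x m.
Proof. by move=> H Hl; rewrite -(functional_extensionality _ _ H). Qed.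

Lemma FD_ext f g x l : (forall y, f y = g y) -> FD f x l -> FD g x l.
Proof. by move=> H Hl; rewrite -(functional_extensionality _ _ H). Qed.

Lemma FD_ext_near f g x l r : 0 < r ->
  (forall h, nnorm h < r -> f (nadd x h) = g (nadd x h)) -> FD f x l -> FD g x l.
Proof.
move=> Hr H [Hl Hf]; split=> // eps He; have [d [Hd Hfd]] := Hf eps He.
exists (Rmin d r); split; first exact: Rmin_pos.
move=> h Hh.
have E0 : f x = g x by rewrite -(naddx0 _ x); apply: H; rewrite nnorm0.
rewrite -E0 -H; last exact: Rlt_le_trans Hh (Rmin_r _ _).
apply: Hfd; exact: Rlt_le_trans Hh (Rmin_l _ _).
Qed.

Lemma FD_lip f x l : FD f x l -> exists K d, 0 < K /\ 0 < d /\
  forall h, nnorm h < d -> Cmod (Cminus (f (nadd x h)) (f x)) <= K * nnorm h.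
Proof.
move=> [Hl Hf]; have [K [HK Hb]] := nlin_bound _ _ Hl.
have [d [Hd Hfd]] := Hf 1 Rlt_0_1.
exists (K + 1), d; split; first lra; split=> // h Hh.
have := Hfd h Hh; have := Hb h.
have := Cmod_le_add_sub (Cminus (f (nadd x h)) (f x)) (l h); lra.
Qed.

Lemma FD_cont f x l : FD f x l -> cont_at f x.
Proof.
move=> /FD_lip [K [d [HK [Hd H]]]] eps He.
exists (Rmin d (eps / K)); split.
  by apply: Rmin_pos => //; apply: Rdiv_lt_0_compat.
move=> h Hh.
have H1 : nnorm h < d by apply: Rlt_le_trans Hh (Rmin_l _ _).
have H2 : nnorm h < eps / K by apply: Rlt_le_trans Hh (Rmin_r _ _).
apply: Rle_lt_trans (H h H1) _.
have -> : eps = K * (eps / K) by field; lra.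
exact: Rmult_lt_compat_l.
Qed.

Lemma FD_const c x : FD (fun _ => c) x (fun _ => RtoC 0).
Proof.
split; first exact: nlin_zero.
move=> eps He; exists 1; split; first lra.
move=> h _; have -> : Cminus (Cminus c c) (RtoC 0) = RtoC 0 by ring.
by rewrite Cmod_0; apply: Rmult_le_pos; [lra | apply: nnorm_ge0].
Qed.

Lemma FD_plus f g x l m : FD f x l -> FD g x m ->
  FD (fun y => Cplus (f y) (g y)) x (fun h => Cplus (l h) (m h)).
Proof.
move=> [Hl Hf] [Hm Hg]; split; first exact: nlin_add.
move=> eps He.
have [d1 [Hd1 H1]] := Hf (eps / 2) ltac:(lra).
have [d2 [Hd2 H2]] := Hg (eps / 2) ltac:(lra).
exists (Rmin d1 d2); split; first exact: Rmin_pos.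
move=> h Hh.
have := H1 h (Rlt_le_trans _ _ _ Hh (Rmin_l _ _)).
have := H2 h (Rlt_le_trans _ _ _ Hh (Rmin_r _ _)).
set a := Cminus _ (m h); set b := Cminus _ (l h).
have -> : Cminus (Cminus (Cplus (f (nadd x h)) (g (nadd x h))) (Cplus (f x) (g x)))
    (Cplus (l h) (m h)) = Cplus a b by rewrite /a /b; ring.
by have := Cmod_triangle a b; lra.
Qed.

Lemma FD_mult f g x l m : FD f x l -> FD g x m ->
  FD (fun y => Cmult (f y) (g y)) x
     (fun h => Cplus (Cmult (f x) (m h)) (Cmult (g x) (l h))).
Proof.
move=> Ff Fg; have [K1 [d1 [K1p [d1p L1]]]] := FD_lip _ _ _ Ff.
have [K2 [d2 [K2p [d2p L2]]]] := FD_lip _ _ _ Fg.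
case: Ff => [Hl Hf]; case: Fg => [Hm Hg].
split; first by apply: nlin_add; apply: nlin_scal.
move=> eps He.
set A := Cmod (f x) + Cmod (g x) + 1.
have HA : 0 < A by rewrite /A; have := Cmod_ge_0 (f x); have := Cmod_ge_0 (g x); lra.
have He3 : 0 < eps / (3 * A) by apply: Rdiv_lt_0_compat; lra.
have [d3 [Hd3 H3]] := Hf _ He3; have [d4 [Hd4 H4]] := Hg _ He3.
have HKp : 0 < 3 * (K1 * K2) by have := Rmult_lt_0_compat _ _ K1p K2p; lra.
exists (Rmin (Rmin d1 d2) (Rmin (Rmin d3 d4) (eps / (3 * (K1 * K2))))); split.
  by repeat apply: Rmin_pos => //; apply: Rdiv_lt_0_compat.
move=> h Hh.
have [G1 G2] := Rmin_Rgt_l _ _ _ Hh.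
have [G3 G4] := Rmin_Rgt_l _ _ _ G1.
have [G5 G6] := Rmin_Rgt_l _ _ _ G2.
have [G7 G8] := Rmin_Rgt_l _ _ _ G5.
have {}L1 := L1 h G3; have {}L2 := L2 h G4; have {}H3 := H3 h G7; have {}H4 := H4 h G8.
set df := Cminus (f (nadd x h)) (f x) in L1 H3 *.
set dg := Cminus (g (nadd x h)) (g x) in L2 H4 *.
have -> : Cminus (Cminus (Cmult (f (nadd x h)) (g (nadd x h))) (Cmult (f x) (g x)))
    (Cplus (Cmult (f x) (m h)) (Cmult (g x) (l h))) =
  Cplus (Cmult df dg) (Cplus (Cmult (f x) (Cminus dg (m h))) (Cmult (g x) (Cminus df (l h)))).
  by rewrite /df /dg; ring.
apply: Rle_trans (Cmod_triangle _ _) _.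
have N := nnorm_ge0 _ h.
have B1 : Cmod (Cmult df dg) <= eps / 3 * nnorm h.
  rewrite Cmod_mult; apply: Rle_trans (Rmult_le_compat _ _ _ _ _ _ L1 L2) _;
    try exact: Cmod_ge_0.
  have -> : K1 * nnorm h * (K2 * nnorm h) = (K1 * K2 * nnorm h) * nnorm h by ring.
  apply: Rmult_le_compat_r => //.
  have -> : eps / 3 = (K1 * K2) * (eps / (3 * (K1 * K2))) by field; lra.
  by apply: Rmult_le_compat_l; [apply: Rlt_le; apply: Rmult_lt_0_compat | lra].
have B2 : forall (a b : C), Cmod a <= A -> Cmod b <= eps / (3 * A) * nnorm h ->
    Cmod (Cmult a b) <= eps / 3 * nnorm h.
  move=> a b Ha Hb; rewrite Cmod_mult.
  apply: Rle_trans (Rmult_le_compat _ _ _ _ _ _ Ha Hb) _; try exact: Cmod_ge_0.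
  by apply: Req_le; field; lra.
have B3 := B2 (f x) _ ltac:(rewrite /A; have := Cmod_ge_0 (g x); lra) H4.
have B4 := B2 (g x) _ ltac:(rewrite /A; have := Cmod_ge_0 (f x); lra) H3.
have := Cmod_triangle (Cmult (f x) (Cminus dg (m h))) (Cmult (g x) (Cminus df (l h))).
lra.
Qed.

Lemma FD_scal c f x l : FD f x l -> FD (fun y => Cmult c (f y)) x (fun h => Cmult c (l h)).
Proof.
move=> H; apply: FD_ext_lin (FD_mult _ _ _ _ _ (FD_const c x) H) => h; ring.
Qed.

Lemma FD_opp f x l : FD f x l -> FD (fun y => Copp (f y)) x (fun h => Copp (l h)).
Proof.
move=> H; have := FD_scal (RtoC (-1)) _ _ _ H.
have E1 : forall a, Cmult (RtoC (-1)) a = Copp a by move=> a; apply: injective_projections => /=; ring.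
move=> H1; apply: FD_ext_lin (FD_ext _ _ _ _ _ H1) => ? /=; exact: E1.
Qed.

Lemma FD_minus f g x l m : FD f x l -> FD g x m ->
  FD (fun y => Cminus (f y) (g y)) x (fun h => Cminus (l h) (m h)).
Proof. move=> H1 H2; exact: FD_plus H1 (FD_opp _ _ _ H2). Qed.

End Calculus.

(** [FD] only covers maps into [C], so an inner map into another [nspace] enters through its exact
    increment [D]. The bound on [D] turns the error of [g] into an error in [h], and [l] has to
    agree with [lg] after [D] only up to small order, which lets [D] be nonlinear. *)
Lemma FD_comp (E F : nspace) (g : F -> C) (m : E -> F) (x : E) (lg : F -> C)
    (l : E -> C) (D : E -> F) (r K : R) :
  0 < r -> 0 < K ->
  FD g (m x) lg -> nlin l ->
  (forall h, nnorm h < r -> m (nadd x h) = nadd (m x) (D h)) ->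
  (forall h, nnorm h < r -> nnorm (D h) <= K * nnorm h) ->
  (forall eps, 0 < eps -> exists delta, 0 < delta /\ forall h, nnorm h < delta ->
     Cmod (Cminus (lg (D h)) (l h)) <= eps * nnorm h) ->
  FD (fun y => g (m y)) x l.
Proof.
move=> Hr HK [Hlg Hg] Hl Hm HD HlD; split=> // eps He.
have He' : 0 < eps / 2 / K by apply: Rdiv_lt_0_compat; lra.
have [d1 [Hd1 H1]] := Hg _ He'.
have [d2 [Hd2 H2]] := HlD (eps / 2) ltac:(lra).
exists (Rmin r (Rmin d2 (d1 / K))); split.
  by repeat apply: Rmin_pos => //; apply: Rdiv_lt_0_compat.
move=> h Hh; have [G1 G2] := Rmin_Rgt_l _ _ _ Hh; have [G3 G4] := Rmin_Rgt_l _ _ _ G2.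
rewrite Hm //.
have G5 : nnorm (D h) < d1.
  apply: Rle_lt_trans (HD _ G1) _.
  have -> : d1 = K * (d1 / K) by field; lra.
  exact: Rmult_lt_compat_l.
have A1 := H1 _ G5; have A2 := H2 _ G3.
have A3 : eps / 2 / K * nnorm (D h) <= eps / 2 * nnorm h.
  apply: Rle_trans (Rmult_le_compat_l _ _ _ _ (HD _ G1)) _; first lra.
  by apply: Req_le; field; lra.
set a := Cminus (Cminus _ _) _ in A1.
have -> : Cminus (Cminus (g (nadd (m x) (D h))) (g (m x))) (l h) =
   Cplus a (Cminus (lg (D h)) (l h)) by rewrite /a; ring.
by have := Cmod_triangle a (Cminus (lg (D h)) (l h)); lra.
Qed.

(** The case where [lg] after [D] is itself admissible, so that the second error vanishes; it serves
    projections, slices and frozen parameters. *)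
Lemma FD_proj (E F : nspace) (g : F -> C) (m D : E -> F) (x : E) (lg : F -> C) :
  (forall h, m (nadd x h) = nadd (m x) (D h)) ->
  (forall h, nnorm (D h) <= nnorm h) ->
  nlin (fun h => lg (D h)) ->
  FD g (m x) lg -> FD (fun y => g (m y)) x (fun h => lg (D h)).
Proof.
move=> H1 H2 H3 Hg; apply: (@FD_comp E F g m x lg _ D 1 1) => //; try lra.
  by move=> h _; have := H2 h; lra.
move=> eps He; exists 1; split; first lra.
move=> h _; have -> : Cminus (lg (D h)) (lg (D h)) = RtoC 0 by ring.
by rewrite Cmod_0; apply: Rmult_le_pos; [lra | apply: nnorm_ge0].
Qed.

(** * Derivatives in one complex variable and chain rules *)

Definition CD (f : C -> C) (z d : C) : Prop := FD (E := NC) f z (fun h => Cmult d h).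

Lemma CDP (f : C -> C) z d :
  (forall eps, 0 < eps -> exists delta, 0 < delta /\ forall h, Cmod h < delta ->
     Cmod (Cminus (Cminus (f (Cplus z h)) (f z)) (Cmult d h)) <= eps * Cmod h) ->
  CD f z d.
Proof. by move=> H; split=> //; exists d. Qed.

Lemma FD_CD (f : C -> C) z l : FD (E := NC) f z l -> CD f z (l (RtoC 1)).
Proof.
move=> H; case: (H) => [[c Hc] _]; apply: FD_ext_lin H => h; rewrite !Hc; ring.
Qed.

Lemma FD_comp1 (E : nspace) (g : C -> C) (f : E -> C) (x : E) d l :
  CD g (f x) d -> FD f x l -> FD (fun y => g (f y)) x (fun h => Cmult d (l h)).
Proof.
move=> Hg Hf; have [K [r [HK [Hr HL]]]] := FD_lip _ _ _ _ Hf.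
case: Hf => Hl Hf.
apply: (@FD_comp E NC g f x (fun h => Cmult d h) _
          (fun h => Cminus (f (nadd x h)) (f x)) r K) => //.
- exact: nlin_scal.
- by move=> h _ /=; ring.
move=> eps He.
have Hd : 0 < Cmod d + 1 by have := Cmod_ge_0 d; lra.
have [dl [Hdl H]] := Hf (eps / (Cmod d + 1)) (Rdiv_lt_0_compat _ _ He Hd).
exists dl; split=> // h Hh.
set a := Cminus (f _) _.
have -> : Cminus (Cmult d a) (Cmult d (l h)) = Cmult d (Cminus a (l h)) by ring.
rewrite Cmod_mult.
have {}H := H h Hh.
apply: Rle_trans (Rmult_le_compat _ (Cmod d + 1) _ _ _ _ _ H) _; try exact: Cmod_ge_0.
  lra.
by apply: Req_le; field; lra.
Qed.

(** This is the chain rule for a potential taken at a moving point and a moving parameter. The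
    parameter has the exact increment [D], so only the first slot contributes an error to the
    differential. *)
Lemma FD_comp_pair (E F : nspace) (g : C -> F -> C) (f : E -> C) (m D : E -> F) (x : E) lg l :
  FD (E := Nprod NC F) (fun w => g w.1 w.2) (f x, m x) lg -> FD f x l ->
  (forall h, m (nadd x h) = nadd (m x) (D h)) ->
  (forall h, nnorm (D h) <= nnorm h) ->
  (forall lf, nlin lf -> nlin (fun h => lf (D h))) ->
  FD (fun y => g (f y) (m y)) x (fun h => lg (l h, D h)).
Proof.
move=> Hg Hf Hm HD HlD; have [K [r [HK [Hr HL]]]] := FD_lip _ _ _ _ Hf.
case: Hf => Hl Hf; case: (Hg) => [[l1 [l2 [[c Hc] [Hl2 Hlg]]]] _].
have Kp : 0 < K + 1 by lra.
apply: (@FD_comp E (Nprod NC F) (fun w => g w.1 w.2) (fun y => (f y, m y)) x lg _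
          (fun h => (Cminus (f (nadd x h)) (f x), D h)) r (K + 1) Hr Kp Hg).
- apply: (nlin_ext _ (fun h => Cplus (Cmult c (l h)) (l2 (D h)))).
    by move=> h; rewrite Hlg /= Hc.
  by apply: nlin_add; [apply: nlin_scal | apply: HlD].
- by move=> h _; rewrite Hm /=; congr pair; ring.
- move=> h Hh /=; have := HL h Hh; have := HD h; have := nnorm_ge0 _ h => N H1 H2.
  by apply: Rmax_lub; nra.
move=> eps He.
have Hd : 0 < Cmod c + 1 by have := Cmod_ge_0 c; lra.
have [dl [Hdl H]] := Hf (eps / (Cmod c + 1)) (Rdiv_lt_0_compat _ _ He Hd).
exists dl; split=> // h Hh; rewrite !Hlg /= !Hc.
set a := Cminus (f _) _.
have -> : Cminus (Cplus (Cmult c a) (l2 (D h))) (Cplus (Cmult c (l h)) (l2 (D h)))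
  = Cmult c (Cminus a (l h)) by ring.
rewrite Cmod_mult.
have {}H := H h Hh.
apply: Rle_trans (Rmult_le_compat _ (Cmod c + 1) _ _ _ _ _ H) _; try exact: Cmod_ge_0.
  lra.
by apply: Req_le; field; lra.
Qed.

Lemma nlin_at0 (E : nspace) l : nlin (n := E) l -> l nzero = RtoC 0.
Proof.
move=> Hl; have [K [_ HK]] := nlin_bound _ _ Hl.
apply: Cmod_eq_0; apply: Rle_antisym; last exact: Cmod_ge_0.
by have := HK nzero; rewrite nnorm0 Rmult_0_r.
Qed.

Section Projections.

Variables E F : nspace.

Lemma nlin_fst l : nlin l -> nlin (n := Nprod E F) (fun h => l h.1).
Proof.
move=> H; exists l, (fun _ => RtoC 0); split=> //; split; first exact: nlin_zero.
by move=> h; ring.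
Qed.

Lemma nlin_snd l : nlin l -> nlin (n := Nprod E F) (fun h => l h.2).
Proof.
move=> H; exists (fun _ => RtoC 0), l; split; first exact: nlin_zero.
by split=> // h; ring.
Qed.

Lemma FD_fst (f : E -> C) (x : Nprod E F) l : FD f x.1 l ->
  FD (E := Nprod E F) (fun y => f y.1) x (fun h => l h.1).
Proof.
move=> H; apply: (@FD_proj (Nprod E F) E f fst fst x l) => //.
  by move=> h; apply: Rmax_l.
by apply: nlin_fst; case: H.
Qed.

Lemma FD_snd (f : F -> C) (x : Nprod E F) l : FD f x.2 l ->
  FD (E := Nprod E F) (fun y => f y.2) x (fun h => l h.2).
Proof.
move=> H; apply: (@FD_proj (Nprod E F) F f snd snd x l) => //.
  by move=> h; apply: Rmax_r.
by apply: nlin_snd; case: H.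
Qed.

Lemma nlin_pairr l : nlin (n := Nprod E F) l -> nlin (fun h => l (nzero, h)).
Proof.
move=> [l1 [l2 [H1 [H2 H]]]].
apply: (nlin_ext _ l2) => // h; rewrite H /=.
rewrite (nlin_at0 _ _ H1); ring.
Qed.

End Projections.

Lemma CD_id z : CD (fun w => w) z (RtoC 1).
Proof.
apply: CDP => eps He; exists 1; split; first lra.
move=> h _; have -> : Cminus (Cminus (Cplus z h) z) (Cmult (RtoC 1) h) = RtoC 0 by ring.
by rewrite Cmod_0; apply: Rmult_le_pos; [lra | apply: Cmod_ge_0].
Qed.

Lemma CD_pow n z :
  CD (fun w => Cpow w n) z (Cmult (RtoC (INR n)) (Cpow z n.-1)).
Proof.
elim: n => [|n IH].
  by apply: FD_ext_lin (FD_const NC (RtoC 1) z) => h /=; ring.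
apply: FD_ext_lin (FD_mult _ _ _ _ _ _ (CD_id z) IH) => h; rewrite S_INR RtoC_plus.
case: n {IH} => [|n]; rewrite /=; ring.
Qed.

Lemma CD_inv z : z <> RtoC 0 -> CD Cinv z (Copp (Cinv (Cmult z z))).
Proof.
move=> Hz; have Hm := proj1 (Cmod_gt_0 z) Hz.
apply: CDP => eps He.
exists (Rmin (Cmod z / 2) (eps * (Cmod z * Cmod z * Cmod z) / 2)); split.
  apply: Rmin_pos; first lra.
  by have := Rmult_lt_0_compat _ _ He (Rmult_lt_0_compat _ _ (Rmult_lt_0_compat _ _ Hm Hm) Hm); lra.
move=> h Hh; have [G1 G2] := Rmin_Rgt_l _ _ _ Hh.
have Hzh : Cmod z / 2 < Cmod (Cplus z h).
  have := Cmod_le_add_sub z (Cplus z h).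
  by rewrite (_ : Cminus z (Cplus z h) = Copp h) ?Cmod_opp; [lra | ring].
have Hn : Cplus z h <> RtoC 0.
  by move=> E0; move: Hzh; rewrite E0 Cmod_0; lra.
have -> : Cminus (Cminus (Cinv (Cplus z h)) (Cinv z)) (Cmult (Copp (Cinv (Cmult z z))) h)
   = Cmult (Cmult h h) (Cinv (Cmult (Cmult z z) (Cplus z h))).
  by field; split.
rewrite !Cmod_mult Cmod_inv; last by do 2?apply: Cmult_neq_0.
rewrite !Cmod_mult.
rewrite Rmult_assoc Rmult_comm; apply: Rmult_le_compat_r; first exact: Cmod_ge_0.
have P1 : 0 < Cmod z * Cmod z * Cmod (Cplus z h).
  by repeat apply: Rmult_lt_0_compat => //; lra.
apply: (Rmult_le_reg_r _ _ _ P1).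
rewrite Rmult_assoc Rinv_l; last lra.
have : Cmod z * Cmod z * (Cmod z / 2) <= Cmod z * Cmod z * Cmod (Cplus z h).
  by apply: Rmult_le_compat_l; [nra | lra].
nra.
Qed.

(** Testing on one small real increment [t] suffices because the differentials are complex-linear.
    The pullback identity rests on this: one function is differentiated both by the chain rule and
    as a constant. *)
Lemma CD_unique f z d e : CD f z d -> CD f z e -> d = e.
Proof.
move=> [_ H1] [_ H2].
have H : forall eps, 0 < eps -> Cmod (Cminus d e) <= 2 * eps.
  move=> eps He; have [d1 [P1 {}H1]] := H1 eps He; have [d2 [P2 {}H2]] := H2 eps He.
  have Pm := Rmin_pos _ _ P1 P2.
  set t := Rmin d1 d2 / 2.
  have Ht : 0 < t by rewrite /t; lra.
  have Et : nnorm (n := NC) (RtoC t) = t by rewrite /= Cmod_RtoC Rabs_pos_eq; lra.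
  have A1 := H1 (RtoC t) ltac:(rewrite Et; have := Rmin_l d1 d2; rewrite /t in Ht *; lra).
  have A2 := H2 (RtoC t) ltac:(rewrite Et; have := Rmin_r d1 d2; rewrite /t in Ht *; lra).
  rewrite Et in A1 A2.
  have := Cmod_sub_le (Cminus (Cminus (f (nadd (n := NC) z (RtoC t))) (f z)) (Cmult e (RtoC t)))
    (Cminus (Cminus (f (nadd (n := NC) z (RtoC t))) (f z)) (Cmult d (RtoC t))).
  set X := Cmod (Cminus (Cminus _ _) _).
  have -> : X = Cmod (Cminus d e) * t.
    have <- : Cmod (RtoC t) = t by exact: Et.
    by rewrite -Cmod_mult /X; congr Cmod; ring.
  by move=> A3; apply: (Rmult_le_reg_r t) => //; lra.
have : Cmod (Cminus d e) = 0.
  apply: Rle_antisym; last exact: Cmod_ge_0.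
  apply: le_epsilon => eps He; have := H (eps / 2) ltac:(lra); lra.
move=> /Cmod_eq_0 E0; have -> : d = Cplus (Cminus d e) e by ring.
by rewrite E0; ring.
Qed.

Lemma CD_is_derive f z d : CD f z d ->
  is_derive (K := C_AbsRing) (V := C_NormedModule) f z d.
Proof.
move=> [_ H]; split; first exact: is_linear_scal_l.
move=> x Hx eps.
have <- : z = x by apply: (@is_filter_lim_locally_unique C_AbsRing (AbsRing_NormedModule C_AbsRing) z x Hx).
have [dl [Hdl {}H]] := H eps (cond_pos eps).
exists (mkposreal _ Hdl) => y Hy.
have := H (Cminus y z) Hy.
rewrite /= (_ : Cplus z (Cminus y z) = y); last by ring.
by rewrite Cmult_comm.
Qed.

(** * Integrals of complex-valued functions of a real variable *)

Definition is_CI (f : R -> C) (a b : R) (v : C) : Prop :=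
  is_RInt (fun x => fst (f x)) a b (fst v) /\ is_RInt (fun x => snd (f x)) a b (snd v).

Definition CI (f : R -> C) (a b : R) : C :=
  (RInt (fun x => fst (f x)) a b, RInt (fun x => snd (f x)) a b).

Lemma is_CI_unique f a b v : is_CI f a b v -> CI f a b = v.
Proof.
move=> [H1 H2]; rewrite /CI (is_RInt_unique _ _ _ _ H1) (is_RInt_unique _ _ _ _ H2).
by case: v {H1 H2}.
Qed.

Lemma cont_at_fst (f : R -> C) (x : R) : cont_at (E := NR) f x ->
  continuous (fun x => fst (f x)) x.
Proof.
move=> H P [e He]; have [d [Hd H1]] := H e (cond_pos e).
exists (mkposreal _ Hd) => y Hy; apply: He.
have := H1 (y - x) Hy; rewrite /= (_ : x + (y - x) = y); last by ring.
move=> H2; change (Rabs (fst (Cminus (f y) (f x))) < e); apply: Rle_lt_trans H2.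
exact: Rle_trans (Rmax_l _ _) (Rmax_Cmod _).
Qed.

Lemma cont_at_snd (f : R -> C) (x : R) : cont_at (E := NR) f x ->
  continuous (fun x => snd (f x)) x.
Proof.
move=> H P [e He]; have [d [Hd H1]] := H e (cond_pos e).
exists (mkposreal _ Hd) => y Hy; apply: He.
have := H1 (y - x) Hy; rewrite /= (_ : x + (y - x) = y); last by ring.
move=> H2; change (Rabs (snd (Cminus (f y) (f x))) < e); apply: Rle_lt_trans H2.
exact: Rle_trans (Rmax_r _ _) (Rmax_Cmod _).
Qed.

Lemma cont_is_CI f a b : a <= b -> (forall x, a <= x <= b -> cont_at (E := NR) f x) ->
  is_CI f a b (CI f a b).
Proof.
move=> Hab H.
split; apply: RInt_correct; apply: ex_RInt_continuous => z; rewrite Rmin_left // Rmax_right // => Hz.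
  by apply: cont_at_fst; apply: H.
by apply: cont_at_snd; apply: H.
Qed.

Lemma is_CI_ext f g a b v : a <= b -> (forall x, a <= x <= b -> f x = g x) ->
  is_CI f a b v -> is_CI g a b v.
Proof.
move=> Hab H [H1 H2]; split; [apply: is_RInt_ext H1 | apply: is_RInt_ext H2];
  by move=> x; rewrite Rmin_left // Rmax_right // => Hx; rewrite H //; lra.
Qed.

Lemma is_CI_plus f g a b v w : is_CI f a b v -> is_CI g a b w ->
  is_CI (fun x => Cplus (f x) (g x)) a b (Cplus v w).
Proof. move=> [H1 H2] [I1 I2]; split; exact: is_RInt_plus. Qed.

Lemma is_CI_scal c f a b v : is_CI f a b v -> is_CI (fun x => Cmult c (f x)) a b (Cmult c v).
Proof.
move=> [H1 H2]; split => /=.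
  apply: (is_RInt_minus (V := R_NormedModule) (fun x => fst c * fst (f x)) (fun x => snd c * snd (f x)));
    exact: (is_RInt_scal (V := R_NormedModule)).
apply: (is_RInt_plus (V := R_NormedModule) (fun x => fst c * snd (f x)) (fun x => snd c * fst (f x)));
    exact: (is_RInt_scal (V := R_NormedModule)).
Qed.

Lemma is_CI_minus f g a b v w : is_CI f a b v -> is_CI g a b w ->
  is_CI (fun x => Cminus (f x) (g x)) a b (Cminus v w).
Proof. move=> [H1 H2] [I1 I2]; split; exact: (is_RInt_minus (V := R_NormedModule)). Qed.

Lemma is_CI_const c a b : is_CI (fun _ => c) a b (Cmult c (RtoC (b - a))).
Proof.
have E1 : fst (Cmult c (RtoC (b - a))) = (b - a) * fst c by rewrite /=; ring.
have E2 : snd (Cmult c (RtoC (b - a))) = (b - a) * snd c by rewrite /=; ring.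
split; rewrite ?E1 ?E2; exact: (is_RInt_const (V := R_NormedModule)).
Qed.

Lemma is_CI_chasles f a b c v w : is_CI f a b v -> is_CI f b c w ->
  is_CI f a c (Cplus v w).
Proof. move=> [H1 H2] [I1 I2]; split; exact: (is_RInt_Chasles (V := R_NormedModule)) I1 || exact: (is_RInt_Chasles (V := R_NormedModule)) I2. Qed.

Lemma Cmod_le_sum (z : C) : Cmod z <= Rabs (fst z) + Rabs (snd z).
Proof.
apply: Rsqr_incr_0_var; last by have := Rabs_pos (fst z); have := Rabs_pos (snd z); lra.
rewrite /Cmod Rsqr_sqrt; last by nra.
rewrite /Rsqr; have := Rabs_pos (fst z); have := Rabs_pos (snd z).
have := Rsqr_abs (fst z); have := Rsqr_abs (snd z); rewrite /Rsqr; nra.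
Qed.

(* The factor 2 comes from bounding the real and imaginary parts separately. *)
Lemma is_CI_bound f a b v M : a <= b -> is_CI f a b v ->
  (forall x, a <= x <= b -> Cmod (f x) <= M) -> Cmod v <= 2 * M * (b - a).
Proof.
move=> Hab [H1 H2] HM.
have B : forall g u, is_RInt g a b u -> (forall x, a <= x <= b -> Rabs (g x) <= M) ->
    Rabs u <= M * (b - a).
  move=> g u Hg Hx.
  have := norm_RInt_le (V := R_NormedModule) g (fun _ => M) a b u _ Hab Hx Hg
    (is_RInt_const (V := R_NormedModule) a b M).
  by rewrite /norm /= /abs /= /scal /= /mult /= Rmult_comm.
have B1 := B _ _ H1 (fun x Hx => Rle_trans _ _ _ (Rle_trans _ _ _ (Rmax_l _ _) (Rmax_Cmod _)) (HM x Hx)).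
have B2 := B _ _ H2 (fun x Hx => Rle_trans _ _ _ (Rle_trans _ _ _ (Rmax_r _ _) (Rmax_Cmod _)) (HM x Hx)).
by have := Cmod_le_sum v; lra.
Qed.

Lemma is_CI_eq0 f a b v : a <= b -> is_CI f a b v -> (forall x, a <= x <= b -> f x = RtoC 0) ->
  v = RtoC 0.
Proof.
move=> Hab H H0; apply: Cmod_eq_0; apply: Rle_antisym; last exact: Cmod_ge_0.
have := is_CI_bound _ _ _ _ 0 Hab H; rewrite Rmult_0_r Rmult_0_l; apply.
by move=> x Hx; rewrite H0 // Cmod_0; lra.
Qed.

Lemma is_CI_derive (F f : R -> C) a b : a <= b ->
  (forall x, a <= x <= b -> FD (E := NR) F x (fun h => Cmult (f x) (RtoC h))) ->
  (forall x, a <= x <= b -> cont_at (E := NR) f x) ->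
  is_CI f a b (Cminus (F b) (F a)).
Proof.
move=> Hab HF Hf.
(* Stated for a real-linear projection [pr], to serve [fst] and [snd] alike; the bound by [Cmod]
   carries the error estimate over to the component. *)
have D : forall (pr : C -> R), (forall a b, pr (Cminus a b) = pr a - pr b) ->
   (forall a r, pr (Cmult a (RtoC r)) = pr a * r) -> (forall a, Rabs (pr a) <= Cmod a) ->
   forall x, a <= x <= b -> is_derive (fun x => pr (F x)) x (pr (f x)).
  move=> pr P1 P2 P3 x Hx; apply/is_derive_Reals => eps He.
  have [_ H] := HF x Hx.
  have [d [Hd {}H]] := H (eps / 2) ltac:(lra).
  exists (mkposreal _ Hd) => h Hh0 Hh.
  have Hp : 0 < Rabs h by apply: Rabs_pos_lt.
  have := H h Hh; rewrite /= => {}H.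
  have := P3 (Cminus (Cminus (F (x + h)) (F x)) (Cmult (f x) (RtoC h))).
  rewrite !P1 P2 => H3.
  have -> : (pr (F (x + h)) - pr (F x)) / h - pr (f x) =
     (pr (F (x + h)) - pr (F x) - pr (f x) * h) / h by field.
  rewrite Rabs_div //.
  apply: (Rmult_lt_reg_r (Rabs h)) => //.
  have -> : forall y, y / Rabs h * Rabs h = y by move=> y; field; lra.
  by nra.
have I : forall (pr : C -> R), (forall x, a <= x <= b -> is_derive (fun x => pr (F x)) x (pr (f x))) ->
   (forall x, a <= x <= b -> continuous (fun x => pr (f x)) x) ->
   is_RInt (fun x => pr (f x)) a b (pr (F b) - pr (F a)).
  move=> pr H1 H2; apply: (is_RInt_derive (V := R_CompleteNormedModule) (fun x => pr (F x))) => x;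
    rewrite Rmin_left // Rmax_right // => Hx; [exact: H1 | exact: H2].
split; apply: I => x Hx.
- apply: (D fst) => //; last by move=> c; apply: Rle_trans (Rmax_l _ _) (Rmax_Cmod _).
  by move=> c r /=; ring.
- by apply: cont_at_fst; apply: Hf.
- apply: (D snd) => //; last by move=> c; apply: Rle_trans (Rmax_r _ _) (Rmax_Cmod _).
  by move=> c r /=; ring.
- by apply: cont_at_snd; apply: Hf.
Qed.

Lemma FD_RtoC x : FD (E := NR) RtoC x RtoC.
Proof.
split; first by exists (RtoC 1) => h; ring.
move=> eps He; exists 1; split; first lra.
move=> h _ /=; have -> : Cminus (Cminus (RtoC (x + h)) (RtoC x)) (RtoC h) = RtoC 0.
  by rewrite RtoC_plus; ring.
by rewrite Cmod_0; apply: Rmult_le_pos; [lra | apply: Rabs_pos].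
Qed.

(** In Goursat's estimate the form is replaced along each side by its first-order expansion; this
    evaluates the replacement. *)
Lemma is_CI_affine (A B : C) a b : a <= b ->
  is_CI (fun x => Cplus A (Cmult B (RtoC x))) a b
    (Cplus (Cmult A (RtoC (b - a))) (Cmult B (RtoC ((b * b - a * a) / 2)))).
Proof.
move=> Hab.
have Haff : forall A B x, FD (E := NR) (fun x => Cplus A (Cmult B (RtoC x))) x (fun h => Cmult B (RtoC h)).
  move=> A' B' x; apply: FD_ext_lin (FD_plus _ _ _ _ _ _ (FD_const NR A' x) (FD_scal _ B' _ _ _ (FD_RtoC x))).
  by move=> h; ring.
have := is_CI_derive (fun x => Cmult (RtoC x) (Cplus A (Cmult (Cmult B (RtoC (/2))) (RtoC x))))
  (fun x => Cplus A (Cmult B (RtoC x))) a b Hab.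
move=> H; have {}H := H _ (fun x _ => FD_cont _ _ _ _ (Haff A B x)).
have -> : (Cplus (Cmult A (RtoC (b - a))) (Cmult B (RtoC ((b * b - a * a) / 2)))) =
  Cminus (Cmult (RtoC b) (Cplus A (Cmult (Cmult B (RtoC (/2))) (RtoC b))))
   (Cmult (RtoC a) (Cplus A (Cmult (Cmult B (RtoC (/2))) (RtoC a)))).
  by apply: injective_projections => /=; field.
apply: H => x _; apply: FD_ext_lin (FD_mult _ _ _ _ _ _ (FD_RtoC x) (Haff A _ x)) => h /=.
apply: injective_projections => /=; field.
Qed.

(** * Goursat's lemma for closed forms on rectangles *)

Section Bisection.

Variables (Phi : R -> R -> R -> R -> R) (a0 b0 c0 d0 : R).
Hypothesis Hab : a0 <= b0.
Hypothesis Hcd : c0 <= d0.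
Hypothesis Phi_ge0 : forall a b c d, 0 <= Phi a b c d.
Hypothesis Phi_split : forall a b c d x y,
  a0 <= a -> a <= x -> x <= b -> b <= b0 -> c0 <= c -> c <= y -> y <= d -> d <= d0 ->
  Phi a b c d <= Phi a x c y + Phi x b c y + Phi a x y d + Phi x b y d.
Hypothesis Phi_local : forall x y, a0 <= x <= b0 -> c0 <= y <= d0 -> forall eps, 0 < eps ->
  exists delta, 0 < delta /\ forall a b c d, a0 <= a -> a <= x -> x <= b -> b <= b0 ->
    c0 <= c -> c <= y -> y <= d -> d <= d0 -> b - a < delta -> d - c < delta ->
    Phi a b c d <= eps * ((b - a) + (d - c)) ^ 2.

Let W := b0 - a0.
Let H := d0 - c0.

Let size (n : nat) := (/ 2) ^ n.

Let PhiN (n : nat) (x : R * R) :=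
  Phi x.1 (x.1 + size n * W) x.2 (x.2 + size n * H).

Let inside (n : nat) (x : R * R) :=
  a0 <= x.1 /\ x.1 + size n * W <= b0 /\ c0 <= x.2 /\ x.2 + size n * H <= d0.

Let size_pos n : 0 < size n.
Proof. by apply: pow_lt; lra. Qed.

(** The last quarter is taken without a test: if each of the other three carries less than a quarter
    of [PhiN n x], subadditivity leaves at least a quarter for it. *)
Let step (n : nat) (x : R * R) : R * R :=
  let w := size n.+1 * W in let h := size n.+1 * H in
  if Rle_dec (PhiN n x / 4) (PhiN n.+1 x) then x
  else if Rle_dec (PhiN n x / 4) (PhiN n.+1 (x.1 + w, x.2)) then (x.1 + w, x.2)
  else if Rle_dec (PhiN n x / 4) (PhiN n.+1 (x.1, x.2 + h)) then (x.1, x.2 + h)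
  else (x.1 + w, x.2 + h).

Let WH_ge0 : 0 <= W /\ 0 <= H.
Proof. by rewrite /W /H; lra. Qed.

Let step_spec n x : inside n x ->
  [/\ inside n.+1 (step n x), PhiN n x / 4 <= PhiN n.+1 (step n x),
      x.1 <= (step n x).1 /\ (step n x).1 + size n.+1 * W <= x.1 + size n * W &
      x.2 <= (step n x).2 /\ (step n x).2 + size n.+1 * H <= x.2 + size n * H].
Proof.
move=> [I1 [I2 [I3 I4]]].
have [W0 H0] := WH_ge0.
have E1 : size n * W = 2 * (size n.+1 * W) by rewrite /size /=; field.
have E2 : size n * H = 2 * (size n.+1 * H) by rewrite /size /=; field.
have P1 : 0 <= size n.+1 * W by apply: Rmult_le_pos => //; apply: Rlt_le.
have P2 : 0 <= size n.+1 * H by apply: Rmult_le_pos => //; apply: Rlt_le.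
have S := Phi_split x.1 (x.1 + size n * W) x.2 (x.2 + size n * H)
   (x.1 + size n.+1 * W) (x.2 + size n.+1 * H) I1 ltac:(lra) ltac:(lra) I2 I3 ltac:(lra) ltac:(lra) I4.
rewrite /step; case: Rle_dec => [Q|Q1] /=.
  by split=> //; rewrite /inside; lra.
case: Rle_dec => [Q|Q2] /=.
  by split=> //; rewrite /inside /=; lra.
case: Rle_dec => [Q|Q3] /=.
  by split=> //; rewrite /inside /=; lra.
split; rewrite /inside /=; try lra.
move: S; rewrite -/(PhiN n x) -/(PhiN n.+1 x).
have EE1 : x.1 + size n * W = x.1 + size n.+1 * W + size n.+1 * W by lra.
have EE2 : x.2 + size n * H = x.2 + size n.+1 * H + size n.+1 * H by lra.
rewrite EE1 EE2.
move: Q1 Q2 Q3; rewrite /PhiN /=; lra.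
Qed.

Let rect := fix rect n := if n is n'.+1 then step n' (rect n') else (a0, c0).

Let rect_inside n : inside n (rect n).
Proof.
elim: n => [|n IH] /=; first by rewrite /inside /size /W /H /=; lra.
by have [] := step_spec _ _ IH.
Qed.

Let rect_mono n m : (rect n).1 <= (rect (n + m)%N).1 /\ (rect n).2 <= (rect (n + m)%N).2 /\
  (rect (n + m)%N).1 + size (n + m)%N * W <= (rect n).1 + size n * W /\
  (rect (n + m)%N).2 + size (n + m)%N * H <= (rect n).2 + size n * H.
Proof.
elim: m => [|m IH]; first by rewrite addn0; lra.
rewrite addnS /=; have [_ _ [] ? ? [] ? ?] := step_spec _ _ (rect_inside (n + m)%N); lra.
Qed.

(** Lower ends increase and upper ends decrease, so every lower end lies below every upper end, and
    the supremum of the lower ends belongs to all the intervals. *)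
Let rect_lub (pr : R * R -> R) (V : R) :
  0 <= V ->
  (forall n m, pr (rect n) <= pr (rect (n + m)%N)) ->
  (forall n m, pr (rect (n + m)%N) + size (n + m)%N * V <= pr (rect n) + size n * V) ->
  exists x, forall n, pr (rect n) <= x <= pr (rect n) + size n * V.
Proof.
move=> V0 M1 M2.
have B : forall n m, pr (rect n) <= pr (rect m) + size m * V.
  move=> n m; have A1 := M1 n m; have A2 := M2 m n.
  have := Rmult_le_pos _ _ (Rlt_le _ _ (size_pos (n + m)%N)) V0.
  by move: A2; rewrite addnC; lra.
have Hb : bound (fun y => exists n, y = pr (rect n)).
  by exists (pr (rect 0) + size 0 * V) => y [n ->]; apply: B.
have [x [Ux Lx]] := completeness _ Hb (ex_intro _ _ (ex_intro _ 0%N erefl)).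
exists x => n; split; first by apply: Ux; exists n.
by apply: Lx => y [m ->].
Qed.

(** The nested rectangles retain at least [4^(-n)] of the initial value. Near their common point
    [Phi_local] bounds the same quantity by a small multiple of the squared size, which also scales
    like [4^(-n)]. The powers cancel and leave an arbitrarily small bound. *)
Lemma bisection_zero : Phi a0 b0 c0 d0 = 0.
Proof.
have [W0 H0] := WH_ge0.
have Hn : forall n, Phi a0 b0 c0 d0 * (/ 4) ^ n <= PhiN n (rect n).
  elim=> [|n IH].
    rewrite /PhiN /size /= /W /H !Rmult_1_l Rmult_1_r.
    by apply: Req_le; congr (Phi _ _ _ _); ring.
  have [_ S _ _] := step_spec _ _ (rect_inside n).
  by rewrite /= in S *; lra.
have [x Hx] := rect_lub fst W W0 (fun n m => proj1 (rect_mono n m))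
   (fun n m => proj1 (proj2 (proj2 (rect_mono n m)))).
have [y Hy] := rect_lub snd H H0 (fun n m => proj1 (proj2 (rect_mono n m)))
   (fun n m => proj2 (proj2 (proj2 (rect_mono n m)))).
have Hx0 : a0 <= x <= b0 by have := Hx 0%N; have := rect_inside 0%N; rewrite /inside; lra.
have Hy0 : c0 <= y <= d0 by have := Hy 0%N; have := rect_inside 0%N; rewrite /inside; lra.
apply: Rle_antisym; last exact: Phi_ge0.
apply: le_epsilon => eps He; rewrite Rplus_0_l.
(* The summand 1 keeps the divisor positive for a degenerate rectangle. *)
set K := (W + H) ^ 2 + 1.
have HK : 0 < K by rewrite /K; have := pow2_ge_0 (W + H); lra.
have [d [Hd HP]] := Phi_local x y Hx0 Hy0 (eps / K) (Rdiv_lt_0_compat _ _ He HK).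
have HWH : 0 < W + H + 1 by lra.
have [N HN] := pow_lt_1_zero (/ 2) ltac:(rewrite Rabs_pos_eq; lra) (d / (W + H + 1)) (Rdiv_lt_0_compat _ _ Hd HWH).
have {}HN : size N < d / (W + H + 1).
  by have := HN N (le_n N); rewrite Rabs_pos_eq //; apply: Rlt_le; apply: size_pos.
have SN := size_pos N.
have HNd : size N * (W + H + 1) < d.
  have := Rmult_lt_compat_r _ _ _ HWH HN.
  by rewrite (_ : d / (W + H + 1) * (W + H + 1) = d) //; field; lra.
have [I1 [I2 [I3 I4]]] := rect_inside N.
have := HP (rect N).1 ((rect N).1 + size N * W) (rect N).2 ((rect N).2 + size N * H)
  I1 (proj1 (Hx N)) (proj2 (Hx N)) I2 I3 (proj1 (Hy N)) (proj2 (Hy N)) I4 ltac:(nra) ltac:(nra).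
have := Hn N; rewrite /PhiN.
set ph := Phi (rect N).1 _ _ _ => A1.
have -> : (rect N).1 + size N * W - (rect N).1 + ((rect N).2 + size N * H - (rect N).2) = size N * (W + H) by ring.
rewrite Rpow_mult_distr => A2.
have E4 : (/ 4) ^ N = size N ^ 2.
  by rewrite /size -pow_mult PeanoNat.Nat.mul_comm pow_mult; congr (_ ^ _); field.
have SN2 : 0 < size N ^ 2 by apply: pow_lt.
rewrite E4 in A1.
apply: (Rmult_le_reg_r (size N ^ 2)) => //.
apply: Rle_trans A1 (Rle_trans _ _ _ A2 _).
have -> : eps / K * (size N ^ 2 * (W + H) ^ 2) = (eps * size N ^ 2) * ((W + H) ^ 2 / K) by field; lra.
rewrite -[X in _ <= X]Rmult_1_r; apply: Rmult_le_compat_l; first nra.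
apply: (Rmult_le_reg_r K) => //; rewrite (_ : (W + H) ^ 2 / K * K = (W + H) ^ 2); last by field; lra.
by rewrite /K; lra.
Qed.

End Bisection.

Section Goursat.

Variables (P Q : R * R -> C) (a0 b0 c0 d0 : R).
Hypothesis Hab : a0 <= b0.
Hypothesis Hcd : c0 <= d0.
Hypothesis closed : forall x y, a0 <= x <= b0 -> c0 <= y <= d0 -> exists lP lQ,
  FD (E := Nprod NR NR) P (x, y) lP /\ FD (E := Nprod NR NR) Q (x, y) lQ /\
  lP (0, 1) = lQ (1, 0).

(** Counterclockwise integral of [P dx + Q dy]. The condition on [lP (0, 1)] and [lQ (1, 0)] says
    that the mixed partial derivatives agree at each point, with no continuity assumed. *)
Let boundary a b c d : C :=
  Cminus (Cplus (CI (fun x => P (x, c)) a b) (CI (fun y => Q (b, y)) c d))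
         (Cplus (CI (fun x => P (x, d)) a b) (CI (fun y => Q (a, y)) c d)).

Let cont_hor (f : R * R -> C) x y l : FD (E := Nprod NR NR) f (x, y) l ->
  cont_at (E := NR) (fun x => f (x, y)) x.
Proof.
move=> Hf eps He; have [d [Hd H]] := FD_cont _ _ _ _ Hf eps He.
exists d; split=> // h Hh; have := H (h, 0); rewrite /= Rplus_0_r; apply.
by rewrite Rabs_R0; apply: Rmax_lub_lt.
Qed.

Let cont_ver (f : R * R -> C) x y l : FD (E := Nprod NR NR) f (x, y) l ->
  cont_at (E := NR) (fun y => f (x, y)) y.
Proof.
move=> Hf eps He; have [d [Hd H]] := FD_cont _ _ _ _ Hf eps He.
exists d; split=> // h Hh; have := H (0, h); rewrite /= Rplus_0_r; apply.
by rewrite Rabs_R0; apply: Rmax_lub_lt.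
Qed.

Let intP y a b : c0 <= y <= d0 -> a0 <= a -> a <= b -> b <= b0 ->
  is_CI (fun x => P (x, y)) a b (CI (fun x => P (x, y)) a b).
Proof.
move=> Hy Ha Hb Hb0; apply: cont_is_CI => // x Hx.
have [lP [lQ [H1 _]]] := closed x y ltac:(lra) Hy; exact: cont_hor H1.
Qed.

Let intQ x c d : a0 <= x <= b0 -> c0 <= c -> c <= d -> d <= d0 ->
  is_CI (fun y => Q (x, y)) c d (CI (fun y => Q (x, y)) c d).
Proof.
move=> Hx Hc Hd Hd0; apply: cont_is_CI => // y Hy.
have [lP [lQ [_ [H1 _]]]] := closed x y Hx ltac:(lra); exact: cont_ver H1.
Qed.

Let boundary_split a b c d x y :
  a0 <= a -> a <= x -> x <= b -> b <= b0 -> c0 <= c -> c <= y -> y <= d -> d <= d0 ->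
  Cmod (boundary a b c d) <= Cmod (boundary a x c y) + Cmod (boundary x b c y) +
    Cmod (boundary a x y d) + Cmod (boundary x b y d).
Proof.
move=> H1 H2 H3 H4 H5 H6 H7 H8.
have -> : boundary a b c d = Cplus (Cplus (Cplus (boundary a x c y) (boundary x b c y))
    (boundary a x y d)) (boundary x b y d).
  have SP : forall y, c0 <= y <= d0 -> CI (fun x => P (x, y)) a b =
      Cplus (CI (fun x => P (x, y)) a x) (CI (fun x => P (x, y)) x b).
    move=> z Hz; apply: is_CI_unique; apply: (is_CI_chasles _ _ x); apply: intP; lra.
  have SQ : forall x, a0 <= x <= b0 -> CI (fun y => Q (x, y)) c d =
      Cplus (CI (fun y => Q (x, y)) c y) (CI (fun y => Q (x, y)) y d).
    move=> z Hz; apply: is_CI_unique; apply: (is_CI_chasles _ _ y); apply: intQ; lra.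
  rewrite /boundary (SP c) ?(SP d) ?(SQ a) ?(SQ b); try lra.
  ring.
apply: Rle_trans (Cmod_triangle _ _) _; apply: Rplus_le_compat_r.
apply: Rle_trans (Cmod_triangle _ _) _; apply: Rplus_le_compat_r.
exact: Cmod_triangle.
Qed.

(** The affine parts of [P] and [Q] at [(x0, y0)] have zero circulation, because closedness gives
    [p2 = q1]. Only the remainders are left: they are small compared with the size [s] of the
    rectangle, and the sides have total length [2 * s]. *)
Let boundary_local x0 y0 : a0 <= x0 <= b0 -> c0 <= y0 <= d0 -> forall eps, 0 < eps ->
  exists delta, 0 < delta /\ forall a b c d, a0 <= a -> a <= x0 -> x0 <= b -> b <= b0 ->
    c0 <= c -> c <= y0 -> y0 <= d -> d <= d0 -> b - a < delta -> d - c < delta ->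
    Cmod (boundary a b c d) <= eps * ((b - a) + (d - c)) ^ 2.
Proof.
move=> Hx0 Hy0 eps He.
have [lP [lQ [HP [HQ E]]]] := closed x0 y0 Hx0 Hy0.
case: HP => [[l1 [l2 [[p1 Hp1] [[p2 Hp2] HlP]]]] HP].
case: HQ => [[m1 [m2 [[q1 Hq1] [[q2 Hq2] HlQ]]]] HQ].
have Epq : p2 = q1.
  move: E; rewrite HlP HlQ /= Hp1 Hp2 Hq1 Hq2.
  have -> : Cplus (Cmult p1 (RtoC 0)) (Cmult p2 (RtoC 1)) = p2 by ring.
  by have -> : Cplus (Cmult q1 (RtoC 1)) (Cmult q2 (RtoC 0)) = q1 by ring.
subst q1.
(* The divisor 4 absorbs the factor 2 of [is_CI_bound] and the pairing of opposite sides. *)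
have [d1 [Hd1 {}HP]] := HP (eps / 4) ltac:(lra).
have [d2 [Hd2 {}HQ]] := HQ (eps / 4) ltac:(lra).
exists (Rmin d1 d2); split; first exact: Rmin_pos.
move=> a b c d Ha Hax Hxb Hb Hc Hcy Hyd Hd Hw Hh.
have [W1 W2] := Rmin_Rgt_l _ _ _ Hw; have [V1 V2] := Rmin_Rgt_l _ _ _ Hh.
set s := (b - a) + (d - c).
have near : forall x y, a <= x <= b -> c <= y <= d ->
   nnorm (n := Nprod NR NR) (x - x0, y - y0) <= s /\
   nnorm (n := Nprod NR NR) (x - x0, y - y0) < Rmin d1 d2.
  move=> x y Hx Hy /=; rewrite /s; split.
    by apply: Rmax_lub; apply: Rabs_le; lra.
  by apply: Rmax_lub_lt; apply: Rmin_Rgt_r; split; apply: Rabs_def1; lra.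
have locP : forall x y, a <= x <= b -> c <= y <= d ->
   Cmod (Cminus (P (x, y)) (Cplus (Cplus (Cminus (P (x0, y0)) (Cmult p1 (RtoC x0)))
      (Cmult p2 (RtoC (y - y0)))) (Cmult p1 (RtoC x)))) <= eps / 4 * s.
  move=> x y Hx Hy; have [N1 N2] := near x y Hx Hy.
  have := HP _ (Rlt_le_trans _ _ _ N2 (Rmin_l _ _)).
  rewrite HlP Hp1 Hp2 [(_, _).1]/= [(_, _).2]/=.
  have -> : nadd (n := Nprod NR NR) (x0, y0) (x - x0, y - y0) = (x, y).
    by rewrite /=; congr pair; ring.
  have He4 : 0 <= eps / 4 by lra.
  move=> B; have := Rle_trans _ _ _ B (Rmult_le_compat_l _ _ _ He4 N1).
  by congr (Cmod _ <= _); rewrite RtoC_minus; ring.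
have locQ : forall x y, a <= x <= b -> c <= y <= d ->
   Cmod (Cminus (Q (x, y)) (Cplus (Cplus (Cminus (Q (x0, y0)) (Cmult q2 (RtoC y0)))
      (Cmult p2 (RtoC (x - x0)))) (Cmult q2 (RtoC y)))) <= eps / 4 * s.
  move=> x y Hx Hy; have [N1 N2] := near x y Hx Hy.
  have := HQ _ (Rlt_le_trans _ _ _ N2 (Rmin_r _ _)).
  rewrite HlQ Hq1 Hq2 [(_, _).1]/= [(_, _).2]/=.
  have -> : nadd (n := Nprod NR NR) (x0, y0) (x - x0, y - y0) = (x, y).
    by rewrite /=; congr pair; ring.
  have He4 : 0 <= eps / 4 by lra.
  move=> B; have := Rle_trans _ _ _ B (Rmult_le_compat_l _ _ _ He4 N1).
  by congr (Cmod _ <= _); rewrite (RtoC_minus y); ring.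
have BP : forall y, c <= y <= d -> exists A, A = Cplus (Cminus (P (x0, y0)) (Cmult p1 (RtoC x0)))
      (Cmult p2 (RtoC (y - y0))) /\
    Cmod (Cminus (CI (fun x => P (x, y)) a b)
      (Cplus (Cmult A (RtoC (b - a))) (Cmult p1 (RtoC ((b * b - a * a) / 2))))) <= 2 * (eps / 4 * s) * (b - a).
  move=> y Hy; eexists; split; first reflexivity.
  have Hab' : a <= b by lra.
  apply: (is_CI_bound _ a b _ _ Hab' (is_CI_minus _ _ _ _ _ _ (intP y a b _ _ _ _) (is_CI_affine _ _ _ _ Hab'))); try lra.
  by move=> x Hx; apply: locP.
have BQ : forall x, a <= x <= b -> exists A, A = Cplus (Cminus (Q (x0, y0)) (Cmult q2 (RtoC y0)))
      (Cmult p2 (RtoC (x - x0))) /\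
    Cmod (Cminus (CI (fun y => Q (x, y)) c d)
      (Cplus (Cmult A (RtoC (d - c))) (Cmult q2 (RtoC ((d * d - c * c) / 2))))) <= 2 * (eps / 4 * s) * (d - c).
  move=> x Hx; eexists; split; first reflexivity.
  have Hcd' : c <= d by lra.
  apply: (is_CI_bound _ c d _ _ Hcd' (is_CI_minus _ _ _ _ _ _ (intQ x c d _ _ _ _) (is_CI_affine _ _ _ _ Hcd'))); try lra.
  by move=> y Hy; apply: locQ.
have [A1 [EA1 B1]] := BP c ltac:(lra); have [A2 [EA2 B2]] := BP d ltac:(lra).
have [A3 [EA3 B3]] := BQ a ltac:(lra); have [A4 [EA4 B4]] := BQ b ltac:(lra).
move: B1 B2 B3 B4.
set D1 := Cminus _ _; set D2 := Cminus _ _; set D3 := Cminus _ _; set D4 := Cminus _ _.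
move=> B1 B2 B3 B4.
have -> : boundary a b c d = Cminus (Cplus D1 D4) (Cplus D2 D3).
  rewrite /boundary /D1 /D2 /D3 /D4.
  set I1 := CI _ a b; set I2 := CI _ _ _; set I3 := CI _ _ _; set I4 := CI _ _ _.
  have -> : forall w1 w2 w3 w4, Cminus (Cplus (Cminus I1 w1) (Cminus I2 w2)) (Cplus (Cminus I3 w3) (Cminus I4 w4))
    = Cplus (Cminus (Cplus I1 I2) (Cplus I3 I4)) (Cminus (Cplus w3 w4) (Cplus w1 w2)) by move=> *; ring.
  rewrite EA1 EA2 EA3 EA4 !RtoC_minus; ring.
apply: Rle_trans (Cmod_sub_le _ _) _.
have T1 := Cmod_triangle D1 D4; have T2 := Cmod_triangle D2 D3.
have -> : eps * s ^ 2 = 4 * (eps / 4 * s) * ((b - a) + (d - c)) by rewrite /s; field.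
lra.
Qed.

Lemma goursat :
  Cplus (CI (fun x => P (x, c0)) a0 b0) (CI (fun y => Q (b0, y)) c0 d0) =
  Cplus (CI (fun x => P (x, d0)) a0 b0) (CI (fun y => Q (a0, y)) c0 d0).
Proof.
have : Cmod (boundary a0 b0 c0 d0) = 0.
  apply: (bisection_zero (fun a b c d => Cmod (boundary a b c d)) a0 b0 c0 d0 Hab Hcd).
  - by move=> *; apply: Cmod_ge_0.
  - exact: boundary_split.
  exact: boundary_local.
rewrite /boundary => /Cmod_eq_0.
set A := Cplus _ _; set B := Cplus _ _ => E0.
have -> : A = Cplus (Cminus A B) B by ring.
by rewrite E0; ring.
Qed.

End Goursat.

(** * The logarithm near 1 *)

(* [clog q] is the branch of [- log (1 - q)] on the unit disc. *)
Definition clog (q : C) : C :=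
  CI (fun t => Cmult q (Cinv (Cminus (RtoC 1) (Cmult (RtoC t) q)))) 0 1.

Lemma Cmod_one_minus (t : R) (q : C) k : 0 <= t <= 1 -> Cmod q <= k -> k < 1 ->
  1 - k <= Cmod (Cminus (RtoC 1) (Cmult (RtoC t) q)).
Proof.
move=> Ht Hq Hk.
have := Cmod_le_add_sub (RtoC 1) (Cminus (RtoC 1) (Cmult (RtoC t) q)).
have -> : Cminus (RtoC 1) (Cminus (RtoC 1) (Cmult (RtoC t) q)) = Cmult (RtoC t) q by ring.
rewrite Cmod_mult Cmod_1 Cmod_RtoC Rabs_pos_eq; last lra.
by have := Cmod_ge_0 q; nra.
Qed.

Lemma Cmod_one_minus1 (q : C) k : Cmod q <= k -> k < 1 -> 1 - k <= Cmod (Cminus (RtoC 1) q).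
Proof.
move=> Hq Hk; have := Cmod_one_minus 1 q k ltac:(lra) Hq Hk.
by rewrite (_ : Cmult (RtoC 1) q = q) //; ring.
Qed.

Lemma Cmod_pos_neq0 z r : 0 < r -> r <= Cmod z -> z <> RtoC 0.
Proof. by move=> Hr Hz E; move: Hz; rewrite E Cmod_0; lra. Qed.

Lemma one_minus_neq0 (t : R) (q : C) : 0 <= t <= 1 -> Cmod q < 1 ->
  Cminus (RtoC 1) (Cmult (RtoC t) q) <> RtoC 0.
Proof.
move=> Ht Hq; apply: (Cmod_pos_neq0 _ (1 - Cmod q)); first lra.
by apply: Cmod_one_minus => //; lra.
Qed.

Lemma one_minus_neq01 (q : C) : Cmod q < 1 -> Cminus (RtoC 1) q <> RtoC 0.
Proof.
move=> Hq; apply: (Cmod_pos_neq0 _ (1 - Cmod q)); first lra.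
by apply: Cmod_one_minus1 => //; lra.
Qed.

Lemma FD_affine q (t : R) :
  FD (E := NR) (fun t => Cminus (RtoC 1) (Cmult (RtoC t) q)) t (fun h => Copp (Cmult q (RtoC h))).
Proof.
apply: FD_ext_lin (FD_minus _ _ _ _ _ _ (FD_const NR (RtoC 1) t)
  (FD_mult _ _ _ _ _ _ (FD_RtoC t) (FD_const NR q t))) => h /=; ring.
Qed.

Lemma FD_one_minus q (t : R) : Cminus (RtoC 1) (Cmult (RtoC t) q) <> RtoC 0 ->
  FD (E := NR) (fun t => Cinv (Cminus (RtoC 1) (Cmult (RtoC t) q))) t
    (fun h => Cmult (Cmult q (Cinv (Cmult (Cminus (RtoC 1) (Cmult (RtoC t) q))
                                   (Cminus (RtoC 1) (Cmult (RtoC t) q))))) (RtoC h)).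
Proof.
move=> Hn.
apply: FD_ext_lin (FD_comp1 _ Cinv _ _ _ _ (CD_inv _ Hn) (FD_affine q t)) => h /=; ring.
Qed.

Lemma is_CI_clog q : Cmod q < 1 ->
  is_CI (fun t => Cmult q (Cinv (Cminus (RtoC 1) (Cmult (RtoC t) q)))) 0 1 (clog q).
Proof.
move=> Hq; apply: cont_is_CI; first lra.
move=> t Ht; have Hn := one_minus_neq0 t q Ht Hq.
exact: FD_cont (FD_scal _ _ _ _ _ (FD_one_minus q t Hn)).
Qed.

(** Common source of the Lipschitz bound and of the derivative of [clog]: subtracting the two
    fractions under the integral makes the factor [q' - q] explicit. *)
Lemma is_CI_clog_sub q q' : Cmod q < 1 -> Cmod q' < 1 ->
  is_CI (fun t => Cmult (Cminus q' q) (Cinv (Cmult (Cminus (RtoC 1) (Cmult (RtoC t) q))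
    (Cminus (RtoC 1) (Cmult (RtoC t) q'))))) 0 1 (Cminus (clog q') (clog q)).
Proof.
move=> Hq Hq'; apply: is_CI_ext (is_CI_minus _ _ _ _ _ _ (is_CI_clog q' Hq') (is_CI_clog q Hq)); first lra.
move=> t Ht; have Hn := one_minus_neq0 t q Ht Hq; have Hn' := one_minus_neq0 t q' Ht Hq'.
by field.
Qed.

Lemma Cmod_inv_le z r : 0 < r -> r <= Cmod z -> Cmod (Cinv z) <= / r.
Proof.
move=> Hr Hz; rewrite Cmod_inv; last exact: Cmod_pos_neq0 Hr Hz.
exact: Rinv_le_contravar.
Qed.

Lemma Cmod_mult_le a b x y : Cmod a <= x -> Cmod b <= y -> Cmod (Cmult a b) <= x * y.
Proof. by move=> Ha Hb; rewrite Cmod_mult; apply: Rmult_le_compat => //; apply: Cmod_ge_0. Qed.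

Lemma clog_lip k q q' : Cmod q <= k -> Cmod q' <= k -> k < 1 ->
  Cmod (Cminus (clog q') (clog q)) <= 2 * / ((1 - k) * (1 - k)) * Cmod (Cminus q' q).
Proof.
move=> Hq Hq' Hk.
have := is_CI_bound _ _ _ _ (Cmod (Cminus q' q) * / ((1 - k) * (1 - k))) Rle_0_1
  (is_CI_clog_sub q q' (Rle_lt_trans _ _ _ Hq Hk) (Rle_lt_trans _ _ _ Hq' Hk)).
move=> H; apply: Rle_trans (H _) _; last by apply: Req_le; ring.
move=> t Ht; apply: Cmod_mult_le; first lra.
apply: Cmod_inv_le; first by apply: Rmult_lt_0_compat; lra.
rewrite Cmod_mult; apply: Rmult_le_compat; try lra; exact: Cmod_one_minus.
Qed.

Lemma clog0 : clog (RtoC 0) = RtoC 0.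
Proof.
apply: (is_CI_eq0 _ _ _ _ Rle_0_1 (is_CI_clog (RtoC 0) _)); first by rewrite Cmod_0; lra.
by move=> t _; ring.
Qed.

(** The expected derivative is the integral of [1 / (1 - t q)^2], which has the primitive
    [t / (1 - t q)] and so equals [1 / (1 - q)]. The error integrand carries a factor [h^2] over
    three factors of modulus at least [1 - k], where [k] is midway between [Cmod q] and 1. *)
Lemma CD_clog q : Cmod q < 1 -> CD clog q (Cinv (Cminus (RtoC 1) q)).
Proof.
move=> Hq.
set k := (1 + Cmod q) / 2.
have Hk : Cmod q < k < 1 by rewrite /k; lra.
have HI : is_CI (fun t => Cinv (Cmult (Cminus (RtoC 1) (Cmult (RtoC t) q)) (Cminus (RtoC 1) (Cmult (RtoC t) q))))
   0 1 (Cinv (Cminus (RtoC 1) q)).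
  have H := is_CI_derive (fun t => Cmult (RtoC t) (Cinv (Cminus (RtoC 1) (Cmult (RtoC t) q))))
    (fun t => Cinv (Cmult (Cminus (RtoC 1) (Cmult (RtoC t) q)) (Cminus (RtoC 1) (Cmult (RtoC t) q)))) 0 1 Rle_0_1.
  move: H; have -> : Cminus (Cmult (RtoC 1) (Cinv (Cminus (RtoC 1) (Cmult (RtoC 1) q))))
     (Cmult (RtoC 0) (Cinv (Cminus (RtoC 1) (Cmult (RtoC 0) q)))) = Cinv (Cminus (RtoC 1) q).
    by rewrite (_ : Cmult (RtoC 1) q = q); ring.
  apply=> t Ht; have Hn := one_minus_neq0 t q Ht Hq; have Fi := FD_one_minus q t Hn.
    apply: FD_ext_lin (FD_mult _ _ _ _ _ _ (FD_RtoC t) Fi) => h /=; field => //.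
  have F1 := FD_affine q t.
  exact: FD_cont (FD_comp1 _ Cinv _ _ _ _ (CD_inv _ (Cmult_neq_0 _ _ Hn Hn)) (FD_mult _ _ _ _ _ _ F1 F1)).
apply: CDP => eps He.
set m := (1 - k) * (1 - k) * (1 - k).
have Hm : 0 < m by rewrite /m; repeat apply: Rmult_lt_0_compat; lra.
exists (Rmin (k - Cmod q) (eps * m / 2)); split.
  by apply: Rmin_pos; [lra | have := Rmult_lt_0_compat _ _ He Hm; lra].
move=> h Hh; have [G1 G2] := Rmin_Rgt_l _ _ _ Hh.
have Hqh : Cmod (Cplus q h) <= k by have := Cmod_triangle q h; lra.
have := is_CI_minus _ _ _ _ _ _ (is_CI_clog_sub q (Cplus q h) Hq ltac:(lra)) (is_CI_scal h _ _ _ _ HI).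
rewrite (_ : Cmult h (Cinv (Cminus (RtoC 1) q)) = Cmult (Cinv (Cminus (RtoC 1) q)) h); last by ring.
move=> HJ; apply: Rle_trans (is_CI_bound _ _ _ _ (Cmod h * Cmod h * / m) Rle_0_1 HJ _) _.
  move=> t Ht; have Hn := one_minus_neq0 t q Ht Hq.
  have Hn' := one_minus_neq0 t (Cplus q h) Ht ltac:(lra).
  have -> : forall A B, A <> RtoC 0 -> B <> RtoC 0 ->
    Cminus (Cmult (Cminus (Cplus q h) q) (Cinv (Cmult A B))) (Cmult h (Cinv (Cmult A A))) =
    Cmult (Cmult h (Cminus A B)) (Cinv (Cmult (Cmult A A) B)).
    by move=> A B HA HB; field.
  all: try assumption.
  apply: Cmod_mult_le.
    apply: Cmod_mult_le; first lra.
    have -> : Cminus (Cminus (RtoC 1) (Cmult (RtoC t) q)) (Cminus (RtoC 1) (Cmult (RtoC t) (Cplus q h)))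
      = Cmult (RtoC t) h by ring.
    rewrite Cmod_mult Cmod_RtoC Rabs_pos_eq; last lra.
    by have := Cmod_ge_0 h; nra.
  apply: Cmod_inv_le => //; rewrite !Cmod_mult /m.
  have B1 := Cmod_one_minus t q k Ht ltac:(lra) ltac:(lra).
  have B2 := Cmod_one_minus t (Cplus q h) k Ht Hqh ltac:(lra).
  by repeat apply: Rmult_le_compat => //; try lra; apply: Rmult_le_pos; lra.
have -> : 2 * (Cmod h * Cmod h * / m) * (1 - 0) = (2 * Cmod h * / m) * Cmod h by ring.
apply: Rmult_le_compat_r; first exact: Cmod_ge_0.
apply: (Rmult_le_reg_r m) => //; rewrite Rmult_assoc Rinv_l; lra.
Qed.

(** * Cauchy's formula *)

Definition cis (t : R) : C := (cos t, sin t).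
Definition cisV (t : R) : C := (cos t, - sin t).

Lemma cis_cisV t : Cmult (cis t) (cisV t) = RtoC 1.
Proof.
apply: injective_projections => /=; last by ring.
by have := sin2_cos2 t; rewrite /Rsqr; lra.
Qed.

Lemma Cmod_cis t : Cmod (cis t) = 1.
Proof.
rewrite /Cmod (_ : _ + _ = 1) ?sqrt_1 //=; have := sin2_cos2 t; rewrite /Rsqr; lra.
Qed.

Lemma Cmod_cisV t : Cmod (cisV t) = 1.
Proof.
rewrite /Cmod (_ : _ + _ = 1) ?sqrt_1 //=; have := sin2_cos2 t; rewrite /Rsqr; lra.
Qed.

Lemma cis_2PI : cis (2 * PI) = cis 0.
Proof. by rewrite /cis cos_2PI sin_2PI cos_0 sin_0. Qed.

Lemma FD_pair (f g : R -> R) x a b :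
  derivable_pt_lim f x a -> derivable_pt_lim g x b ->
  FD (E := NR) (fun t => (f t, g t) : C) x (fun h => Cmult (a, b) (RtoC h)).
Proof.
move=> Hf Hg; split; first by exists (a, b).
move=> eps He.
have [d1 H1] := Hf (eps / 2) ltac:(lra); have [d2 H2] := Hg (eps / 2) ltac:(lra).
exists (Rmin d1 d2); split; first by apply: Rmin_pos; apply: cond_pos.
move=> h Hh; have [G1 G2] := Rmin_Rgt_l _ _ _ Hh.
apply: Rle_trans (Cmod_le_sum _) _; rewrite [nnorm h]/=.
have key : forall (u : R -> R) c, (h <> 0 -> Rabs ((u (x + h) - u x) / h - c) < eps / 2) ->
   Rabs (u (x + h) - u x - c * h) <= eps / 2 * Rabs h.
  move=> u c Hu; case: (Req_dec h 0) => [->|Hh0].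
    by rewrite Rplus_0_r Rmult_0_r Rabs_R0 (_ : u x - u x - 0 = 0) ?Rabs_R0; lra.
  have -> : u (x + h) - u x - c * h = ((u (x + h) - u x) / h - c) * h by field.
  rewrite Rabs_mult; apply: Rmult_le_compat_r; first exact: Rabs_pos.
  by apply: Rlt_le; apply: Hu.
have K1 := key f a (fun Hh0 => H1 h Hh0 G1); have K2 := key g b (fun Hh0 => H2 h Hh0 G2).
set A := fst _; set B := snd _.
have -> : A = f (x + h) - f x - a * h by rewrite /A /=; ring.
have -> : B = g (x + h) - g x - b * h by rewrite /B /=; ring.
lra.
Qed.

Lemma FD_cis t : FD (E := NR) cis t (fun h => Cmult (Cmult Ci (cis t)) (RtoC h)).
Proof.
apply: FD_ext_lin (FD_pair cos sin t _ _ (derivable_pt_lim_cos t) (derivable_pt_lim_sin t)) => h.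
by apply: injective_projections => /=; ring.
Qed.

Lemma FD_cisV t : FD (E := NR) cisV t (fun h => Cmult (Copp (Cmult Ci (cisV t))) (RtoC h)).
Proof.
apply: FD_ext_lin (FD_pair cos (fun x => - sin x) t _ _ (derivable_pt_lim_cos t)
  (derivable_pt_lim_opp _ _ _ (derivable_pt_lim_sin t))) => h.
by apply: injective_projections => /=; ring.
Qed.

Lemma Ci_sqr : Cmult Ci Ci = Copp (RtoC 1).
Proof. by apply: injective_projections => /=; ring. Qed.

Lemma Cmod_mult_cisV q t : Cmod (Cmult q (cisV t)) = Cmod q.
Proof. by rewrite Cmod_mult Cmod_cisV Rmult_1_r. Qed.

Lemma FD_kernel q t : Cmod q < 1 ->
  exists l, FD (E := NR) (fun t => Cinv (Cminus (RtoC 1) (Cmult q (cisV t)))) t l.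
Proof.
move=> Hq; eexists; apply: FD_comp1.
  by apply: CD_inv; apply: one_minus_neq01; rewrite Cmod_mult_cisV.
apply: FD_minus; first exact: FD_const.
by apply: FD_scal; apply: FD_cisV.
Qed.

(** The integrand has the primitive [t + i clog(q e^(-it))]. Its second term is periodic, so only
    the increment of [t] survives. *)
Lemma is_CI_kernel q : Cmod q < 1 ->
  is_CI (fun t => Cinv (Cminus (RtoC 1) (Cmult q (cisV t)))) 0 (2 * PI) (RtoC (2 * PI)).
Proof.
move=> Hq; have HPI := PI_RGT_0.
have := is_CI_derive (fun t => Cplus (RtoC t) (Cmult Ci (clog (Cmult q (cisV t)))))
   (fun t => Cinv (Cminus (RtoC 1) (Cmult q (cisV t)))) 0 (2 * PI) ltac:(lra).
have -> : cisV (2 * PI) = cisV 0 by rewrite /cisV cos_2PI sin_2PI cos_0 sin_0.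
have -> : forall A, Cminus (Cplus (RtoC (2 * PI)) A) (Cplus (RtoC 0) A) = RtoC (2 * PI) by move=> A; ring.
apply=> t Ht; last by have [l Hl] := FD_kernel q t Hq; apply: FD_cont Hl.
have Hn : Cminus (RtoC 1) (Cmult q (cisV t)) <> RtoC 0 by apply: one_minus_neq01; rewrite Cmod_mult_cisV.
have F1 := FD_comp1 NR clog (fun t => Cmult q (cisV t)) t _ _
   (CD_clog (Cmult q (cisV t)) ltac:(by rewrite Cmod_mult_cisV)) (FD_scal _ q _ _ _ (FD_cisV t)).
apply: FD_ext_lin (FD_plus _ _ _ _ _ _ (FD_RtoC t) (FD_scal _ Ci _ _ _ F1)) => h /=.
have -> : Cmult Ci (Cmult (Cinv (Cminus (RtoC 1) (Cmult q (cisV t))))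
    (Cmult q (Cmult (Copp (Cmult Ci (cisV t))) (RtoC h)))) =
  Copp (Cmult (Cmult Ci Ci) (Cmult (Cinv (Cminus (RtoC 1) (Cmult q (cisV t)))) (Cmult (Cmult q (cisV t)) (RtoC h)))) by ring.
rewrite Ci_sqr; field; exact: Hn.
Qed.

Lemma Cmod_eq_of_le (a b : C) K : 0 <= K ->
  (forall eps, 0 < eps -> Cmod (Cminus a b) <= K * eps) -> a = b.
Proof.
move=> HK H.
have E0 : Cmod (Cminus a b) = 0.
  apply: Rle_antisym; last exact: Cmod_ge_0.
  apply: le_epsilon => eps He; rewrite Rplus_0_l.
  have HK1 : 0 < K + 1 by lra.
  apply: Rle_trans (H (eps / (K + 1)) (Rdiv_lt_0_compat _ _ He HK1)) _.
  apply: (Rmult_le_reg_r (K + 1)) => //.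
  have -> : K * (eps / (K + 1)) * (K + 1) = K * eps by field; lra.
  nra.
have -> : a = Cplus (Cminus a b) b by ring.
by rewrite (Cmod_eq_0 _ E0); ring.
Qed.

Lemma two_PI_ge0 : 0 <= 2 * PI.
Proof. by have := PI_RGT_0; lra. Qed.

Lemma RtoC_neq0 x : x <> 0 -> RtoC x <> RtoC 0.
Proof. by move=> Hx [E]. Qed.

(* The form [f(z) dz / (z - a)] is closed and pulls back to [0 < t <= 1] along
   [z = a + t (r e^(i theta) - a)], which contracts the circle onto [a]. *)
Section Cauchy.

Variables (f : C -> C) (r : R) (a : C).
Hypothesis Hr : 0 < r.
Hypothesis Ha : Cmod a < r.
Hypothesis Hf : forall z, Cmod z <= r -> exists d, CD f z d.

Let q := Cmult a (RtoC (/ r)).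

Lemma Cmod_div_lt1 : Cmod q < 1.
Proof.
rewrite /q Cmod_mult Cmod_RtoC Rabs_pos_eq; last by apply: Rlt_le; apply: Rinv_0_lt_compat.
by apply: (Rmult_lt_reg_r r) => //; rewrite Rmult_assoc Rinv_l; lra.
Qed.

(** Up to the factor [i], this is the angular coefficient of [dz / (z - a)] in the coordinates [Z];
    it does not depend on the radial variable. *)
Let K (t : R) := Cinv (Cminus (RtoC 1) (Cmult q (cisV t))).
Let Z (x : R * R) := Cplus a (Cmult (RtoC x.1) (Cminus (Cmult (RtoC r) (cis x.2)) a)).

Let K_spec t : Cmult (Cminus (Cmult (RtoC r) (cis t)) a) (K t) = Cmult (RtoC r) (cis t).
Proof.
have Hn : Cminus (RtoC 1) (Cmult q (cisV t)) <> RtoC 0.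
  by apply: one_minus_neq01; rewrite Cmod_mult_cisV; apply: Cmod_div_lt1.
have E : Cminus (Cmult (RtoC r) (cis t)) a =
    Cmult (Cmult (RtoC r) (cis t)) (Cminus (RtoC 1) (Cmult q (cisV t))).
  have -> : Cmult (Cmult (RtoC r) (cis t)) (Cminus (RtoC 1) (Cmult q (cisV t))) =
    Cminus (Cmult (RtoC r) (cis t)) (Cmult (Cmult a (Cmult (RtoC r) (RtoC (/ r)))) (Cmult (cis t) (cisV t))).
    by rewrite /q; ring.
  rewrite cis_cisV -RtoC_mult Rinv_r; last lra.
  ring.
rewrite E /K; field; exact: Hn.
Qed.

Let Z_mod t u : 0 <= t <= 1 -> Cmod (Z (t, u)) <= r.
Proof.
move=> Ht; rewrite /Z /=.
have -> : Cplus a (Cmult (RtoC t) (Cminus (Cmult (RtoC r) (cis u)) a)) =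
  Cplus (Cmult (RtoC (1 - t)) a) (Cmult (RtoC (t * r)) (cis u)).
  by rewrite RtoC_minus RtoC_mult; ring.
apply: Rle_trans (Cmod_triangle _ _) _.
rewrite !Cmod_mult Cmod_cis !Cmod_RtoC !Rabs_pos_eq; try nra.
Qed.

Let FD_Z x : FD (E := Nprod NR NR) Z x (fun h =>
  Cplus (Cmult (RtoC x.1) (Cmult (RtoC r) (Cmult (Cmult Ci (cis x.2)) (RtoC h.2))))
        (Cmult (Cminus (Cmult (RtoC r) (cis x.2)) a) (RtoC h.1))).
Proof.
have F1 := FD_fst NR NR RtoC x _ (FD_RtoC x.1).
have F2 := FD_scal _ (RtoC r) _ _ _ (FD_snd NR NR cis x _ (FD_cis x.2)).
have F3 := FD_minus _ _ _ _ _ _ F2 (FD_const (Nprod NR NR) a x).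
apply: FD_ext_lin (FD_plus _ _ _ _ _ _ (FD_const (Nprod NR NR) a x) (FD_mult _ _ _ _ _ _ F1 F3)) => h /=.
ring.
Qed.

(** Goursat's lemma on [[eps, 1] x [0, 2 pi]] for the form [-i f(z) dz / (z - a)]. The two sides of
    constant angle, 0 and [2 pi], carry the same integral by periodicity, so the sides of constant
    radial variable carry equal integrals. *)
Let cauchy_shrink eps : 0 < eps <= 1 ->
  CI (fun t => Cmult (f (Z (1, t))) (K t)) 0 (2 * PI) =
  CI (fun t => Cmult (f (Z (eps, t))) (K t)) 0 (2 * PI).
Proof.
move=> He; have HPI := PI_RGT_0.
have := goursat (fun x => Cmult (f (Z x)) (Cmult (Copp Ci) (Cinv (RtoC x.1))))
   (fun x => Cmult (f (Z x)) (K x.2)) eps 1 0 (2 * PI) ltac:(lra) ltac:(lra).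
rewrite /=.
have -> : (fun x => Cmult (f (Z (x, 2 * PI))) (Cmult (Copp Ci) (Cinv (RtoC x)))) =
  (fun x => Cmult (f (Z (x, 0))) (Cmult (Copp Ci) (Cinv (RtoC x)))).
  by apply: functional_extensionality => x; rewrite /Z /= cis_2PI.
set A := CI _ eps 1; set B := CI _ _ _; set D := CI _ _ _ => H.
have -> : B = Cminus (Cplus A B) A by ring.
rewrite H; first by ring.
move=> x y Hx Hy.
have Hx0 : RtoC x <> RtoC 0 by apply: RtoC_neq0; lra.
have [d Hd] := Hf (Z (x, y)) (Z_mod x y ltac:(lra)).
have F1 := FD_comp1 (Nprod NR NR) f Z (x, y) _ _ Hd (FD_Z (x, y)).
have F2 := FD_scal _ (Copp Ci) _ _ _ (FD_comp1 (Nprod NR NR) Cinv (fun x => RtoC x.1) (x, y) _ _ (CD_inv _ Hx0)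
   (FD_fst NR NR RtoC (x, y) _ (FD_RtoC x))).
have [lK FK] := FD_kernel q y Cmod_div_lt1.
have F3 := FD_snd NR NR K (x, y) _ FK.
have F4 := FD_mult _ _ _ _ _ _ F1 F2; have F5 := FD_mult _ _ _ _ _ _ F1 F3.
eexists; eexists; split; [exact: F4 | split; [exact: F5 | rewrite /=]].
case: FK => [[c Hc] _]; rewrite Hc.
have -> : Cplus
  (Cmult (f (Z (x, y)))
     (Cmult (Copp Ci) (Cmult (Copp (Cinv (Cmult (RtoC x) (RtoC x)))) (RtoC 0))))
  (Cmult (Cmult (Copp Ci) (Cinv (RtoC x)))
     (Cmult d
        (Cplus (Cmult (RtoC x) (Cmult (RtoC r) (Cmult (Cmult Ci (cis y)) (RtoC 1))))
           (Cmult (Cminus (Cmult (RtoC r) (cis y)) a) (RtoC 0))))) =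
  Cmult (Cmult (Copp (Cmult Ci Ci)) d) (Cmult (RtoC r) (cis y)).
  by field.
(* Both mixed derivatives equal [d r e^(iy)], with [d] the derivative of [f] at [Z (x, y)]: in the
   first [x] cancels against its inverse, in the second [K_spec] absorbs [K]. *)
rewrite Ci_sqr -{1}(K_spec y); ring.
Qed.

(** The integral is unchanged when the circle is shrunk towards [a]. There continuity replaces [f]
    by [f a], and the kernel alone integrates to [2 pi]. *)
Lemma cauchy_formula :
  is_CI (fun t => Cmult (f (Cmult (RtoC r) (cis t)))
                   (Cinv (Cminus (RtoC 1) (Cmult (Cmult a (RtoC (/ r))) (cisV t)))))
    0 (2 * PI) (Cmult (RtoC (2 * PI)) (f a)).
Proof.
have HPI := PI_RGT_0.
have Hq := Cmod_div_lt1.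
have int s : 0 <= s <= 1 -> is_CI (fun t => Cmult (f (Z (s, t))) (K t)) 0 (2 * PI)
    (CI (fun t => Cmult (f (Z (s, t))) (K t)) 0 (2 * PI)).
  move=> Hs; apply: cont_is_CI; first lra.
  move=> t Ht; have [d Hd] := Hf (Z (s, t)) (Z_mod s t Hs).
  have [lK FK] := FD_kernel q t Hq.
  have FZ := FD_plus NR _ _ t _ _ (FD_const NR a t) (FD_scal NR (RtoC s) _ t _
    (FD_minus NR _ _ t _ _ (FD_scal NR (RtoC r) cis t _ (FD_cis t)) (FD_const NR a t))).
  exact: FD_cont (FD_mult _ _ _ _ _ _ (FD_comp1 NR f (fun t => Z (s, t)) t _ _ Hd FZ) FK).
have E1 : CI (fun t => Cmult (f (Z (1, t))) (K t)) 0 (2 * PI) = Cmult (RtoC (2 * PI)) (f a).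
  have [d Hd] := Hf a ltac:(lra).
  set k := / (1 - Cmod q).
  have Hk : 0 < k by apply: Rinv_0_lt_compat; lra.
  apply: (Cmod_eq_of_le _ _ (2 * k * (2 * PI))); first by nra.
  move=> eps He; have [dl [Hdl HC]] := FD_cont _ _ _ _ Hd eps He.
  (* Points of the circle are at distance at most [2 * r] from [a], so the contracted circle lies
     within [dl] of [a]; the cap 1 keeps [s] in the range of [cauchy_shrink]. *)
  set s := Rmin 1 (dl / (4 * r)).
  have Hs : 0 < s <= 1.
    by split; [apply: Rmin_pos; [lra | apply: Rdiv_lt_0_compat; lra] | apply: Rmin_l].
  have Hs2 : s * (2 * r) < dl.
    apply: (Rle_lt_trans _ (dl / (4 * r) * (2 * r))).
      by apply: Rmult_le_compat_r; [lra | apply: Rmin_r].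
    by rewrite (_ : dl / (4 * r) * (2 * r) = dl / 2); [lra | field; lra].
  rewrite (cauchy_shrink s Hs).
  have HI := is_CI_minus _ _ _ _ _ _ (int s ltac:(lra)) (is_CI_scal (f a) _ _ _ _ (is_CI_kernel q Hq)).
  rewrite (Cmult_comm (RtoC (2 * PI))).
  have := is_CI_bound _ _ _ _ (eps * k) two_PI_ge0 HI.
  rewrite Rminus_0_r => HB; apply: Rle_trans (HB _) _; last by apply: Req_le; ring.
  move=> t Ht; rewrite -/(K t).
  have -> : Cminus (Cmult (f (Z (s, t))) (K t)) (Cmult (f a) (K t)) =
     Cmult (Cminus (f (Z (s, t))) (f a)) (K t) by ring.
  apply: Cmod_mult_le.
    apply: Rlt_le; apply: HC => /=.
    rewrite Cmod_mult Cmod_RtoC Rabs_pos_eq; last lra.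
    apply: Rle_lt_trans Hs2; apply: Rmult_le_compat_l; first lra.
    apply: Rle_trans (Cmod_sub_le _ _) _; rewrite Cmod_mult Cmod_cis Cmod_RtoC Rabs_pos_eq; lra.
  apply: Cmod_inv_le; first lra.
  by apply: Cmod_one_minus1 => //; rewrite Cmod_mult_cisV; lra.
rewrite -E1; apply: is_CI_ext (int 1 ltac:(lra)); first lra.
move=> t Ht; rewrite /K /q /Z /=; congr (Cmult (f _) _); ring.
Qed.

End Cauchy.

(** Cauchy's formula on the circle of radius [T / 2], with the kernel expanded as
    [1 / (1 - w) = 1 + w + w^2 / (1 - w)]. The assumption on [t] gives [|w| <= 1/2], hence
    [|1 / (1 - w)| <= 2]. The constant 16 is this 2, times the 2 of [is_CI_bound], times the 4 from
    halving the radius. *)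
Lemma cauchy_second_order (g : C -> C) T M d t :
  0 < T -> (forall z, Cmod z < T -> exists d, CD g z d) ->
  (forall z, Cmod z < T -> Cmod (g z) <= M) -> CD g (RtoC 0) d -> Cmod t <= T / 4 ->
  Cmod (Cminus (Cminus (g t) (g (RtoC 0))) (Cmult d t)) <= 16 * M * (Cmod t / T) ^ 2.
Proof.
move=> HT Hg HM Hd.
have HPI := PI_RGT_0.
set r := T / 2.
have Hr : 0 < r by rewrite /r; lra.
have Hg' : forall z, Cmod z <= r -> exists d, CD g z d by move=> z Hz; apply: Hg; rewrite /r in Hz; lra.
set q := fun t => Cmult t (RtoC (/ r)).
have Hir : 0 < / r by apply: Rinv_0_lt_compat.
have HPC : RtoC (2 * PI) <> RtoC 0 by apply: RtoC_neq0; lra.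
have qm : forall t, Cmod (q t) = Cmod t / r.
  by move=> z; rewrite /q Cmod_mult Cmod_RtoC Rabs_pos_eq; lra.
set G := fun s => g (Cmult (RtoC r) (cis s)).
have GM : forall s, Cmod (G s) <= M.
  move=> s; apply: HM; rewrite Cmod_mult Cmod_cis Cmod_RtoC Rabs_pos_eq /r; lra.
have contG : forall s, cont_at (E := NR) G s.
  move=> s; have [e He] := Hg' (Cmult (RtoC r) (cis s)) ltac:(rewrite Cmod_mult Cmod_cis Cmod_RtoC Rabs_pos_eq; lra).
  exact: FD_cont (FD_comp1 NR g _ s _ _ He (FD_scal _ (RtoC r) _ _ _ (FD_cis s))).
have contG1 : forall s, cont_at (E := NR) (fun s => Cmult (G s) (cisV s)) s.
  move=> s; have [e He] := Hg' (Cmult (RtoC r) (cis s)) ltac:(rewrite Cmod_mult Cmod_cis Cmod_RtoC Rabs_pos_eq; lra).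
  exact: FD_cont (FD_mult _ _ _ _ _ _ (FD_comp1 NR g _ s _ _ He (FD_scal _ (RtoC r) _ _ _ (FD_cis s))) (FD_cisV s)).
set A1 := CI (fun s => Cmult (G s) (cisV s)) 0 (2 * PI).
have I1 : is_CI (fun s => Cmult (G s) (cisV s)) 0 (2 * PI) A1.
  by apply: cont_is_CI => //; lra.
set d' := Cmult (Cmult A1 (RtoC (/ r))) (Cinv (RtoC (2 * PI))).
have key : forall t, Cmod t <= T / 4 ->
    Cmod (Cminus (Cminus (g t) (g (RtoC 0))) (Cmult d' t)) <= 16 * M * (Cmod t / T) ^ 2.
  move=> z Hz.
  have Hzr : Cmod z < r by rewrite /r; lra.
  have J1 := cauchy_formula g r z Hr Hzr Hg'.
  have J0 := cauchy_formula g r (RtoC 0) Hr ltac:(rewrite Cmod_0; lra) Hg'.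
  have J := is_CI_minus _ _ _ _ _ _ (is_CI_minus _ _ _ _ _ _ J1 J0) (is_CI_scal (q z) _ _ _ _ I1).
  have Eq : Cminus (Cminus (Cmult (RtoC (2 * PI)) (g z)) (Cmult (RtoC (2 * PI)) (g (RtoC 0)))) (Cmult (q z) A1)
    = Cmult (RtoC (2 * PI)) (Cminus (Cminus (g z) (g (RtoC 0))) (Cmult d' z)).
    rewrite /d' /q; set B := Cinv (RtoC (2 * PI)).
    have HB : Cmult (RtoC (2 * PI)) B = RtoC 1 by rewrite /B; field.
    have -> : Cmult (RtoC (2 * PI)) (Cminus (Cminus (g z) (g (RtoC 0))) (Cmult (Cmult (Cmult A1 (RtoC (/ r))) B) z))
       = Cminus (Cmult (RtoC (2 * PI)) (Cminus (g z) (g (RtoC 0)))) (Cmult (Cmult (RtoC (2 * PI)) B) (Cmult (Cmult A1 (RtoC (/ r))) z)) by ring.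
    by rewrite HB; ring.
  rewrite Eq in J.
  have Hqz : Cmod (q z) <= / 2.
    rewrite qm; apply: (Rmult_le_reg_r r) => //; rewrite (_ : Cmod z / r * r = Cmod z); last by field; lra.
    by rewrite /r; lra.
  have := is_CI_bound _ _ _ _ (M * (Cmod (q z) * Cmod (q z) * 2)) two_PI_ge0 J.
  rewrite Cmod_mult Cmod_RtoC Rabs_pos_eq; last lra.
  rewrite Rminus_0_r => HB.
  apply: (Rmult_le_reg_l (2 * PI)); first lra.
  apply: Rle_trans (HB _) _.
    move=> s Hs; rewrite -/(G s).
    set w := Cmult (q z) (cisV s).
    have Hw : Cmod w = Cmod (q z) by rewrite /w Cmod_mult_cisV.
    have Hn : Cminus (RtoC 1) w <> RtoC 0 by apply: one_minus_neq01; lra.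
    have -> : Cminus (RtoC 1) (Cmult (Cmult (RtoC 0) (RtoC (/ r))) (cisV s)) = RtoC 1 by ring.
    rewrite -/(q z) -/w.
    have -> : Cmult (q z) (Cmult (G s) (cisV s)) = Cmult (G s) w by rewrite /w; ring.
    have -> : Cminus (Cminus (Cmult (G s) (Cinv (Cminus (RtoC 1) w))) (Cmult (G s) (Cinv (RtoC 1)))) (Cmult (G s) w)
      = Cmult (G s) (Cmult (Cmult w w) (Cinv (Cminus (RtoC 1) w))).
      by field; exact: Hn.
    apply: Cmod_mult_le; first exact: GM.
    apply: Cmod_mult_le; first by rewrite Cmod_mult Hw; lra.
    have -> : 2 = / (1 - / 2) by field.
    apply: Cmod_inv_le; first lra.
    by apply: Cmod_one_minus1; lra.
  apply: Req_le; rewrite !qm /r; field; lra.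
move=> Ht.
(* [d'] is the Cauchy integral for the derivative. The quadratic bound just proved shows that it is
   a derivative at 0, so uniqueness identifies it with [d]. *)
suff <- : d' = d by apply: key.
apply: CD_unique Hd.
apply: CDP => eps He.
have M0 : 0 <= M by apply: Rle_trans (Cmod_ge_0 _) (GM 0).
set c := 16 * M / (T * T) + 1.
have HTT : 0 < T * T by apply: Rmult_lt_0_compat.
have Hc0 : 0 <= 16 * M / (T * T) by apply: Rmult_le_pos; [lra | apply: Rlt_le; apply: Rinv_0_lt_compat].
have Hc : 0 < c by rewrite /c; lra.
exists (Rmin (T / 4) (eps / c)); split; first by apply: Rmin_pos; [lra | apply: Rdiv_lt_0_compat].
move=> h Hh; have [G1 G2] := Rmin_Rgt_l _ _ _ Hh.
have := key h ltac:(lra); rewrite Cplus_0_l => Hkey; apply: Rle_trans Hkey _.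
have -> : 16 * M * (Cmod h / T) ^ 2 = 16 * M / (T * T) * Cmod h * Cmod h by field; lra.
apply: Rmult_le_compat_r; first exact: Cmod_ge_0.
have G3 : c * Cmod h <= eps.
  have := Rmult_lt_compat_l c _ _ Hc G2; rewrite (_ : c * (eps / c) = eps); [lra | field; lra].
by rewrite /c in G3; have := Cmod_ge_0 h; lra.
Qed.

(** * Holomorphic dependence on parameters *)

Section Dependence.

Variable n : nat.

Notation X := (Nprod NC (NCn n)).

Let dil (t : C) (h : X) : X := (Cmult t h.1, Cn_scal n t h.2).

Let dil_add (x h : X) t s : nadd (nadd x (dil t h)) (dil s h) = nadd x (dil (Cplus t s) h).
Proof.
rewrite /dil /=; congr pair; first by ring.
by apply: functional_extensionality => i; rewrite /Cn_add /Cn_scal; ring.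
Qed.

Let norm_dil t h : nnorm (dil t h) <= Cmod t * nnorm h.
Proof.
rewrite /dil /=; have M1 := Rmax_l (Cmod h.1) (Cn_norm h.2).
have M2 := Rmax_r (Cmod h.1) (Cn_norm h.2); have := Cmod_ge_0 t => Ht.
apply: Rmax_lub; first by rewrite Cmod_mult; apply: Rmult_le_compat_l.
exact: Rle_trans (Cn_norm_scal n t h.2) (Rmult_le_compat_l _ _ _ Ht M2).
Qed.

Let nlin_dil (l : X -> C) t h : nlin l -> l (dil t h) = Cmult t (l h).
Proof.
move=> [l1 [l2 [[c Hc] [[e He] H]]]]; rewrite !H /= !Hc !He Cn_lin_scalr; ring.
Qed.

Let dil_1 h : dil (RtoC 1) h = h.
Proof.
case: h => w h; rewrite /dil /=; congr pair; first by ring.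
by apply: functional_extensionality => i; rewrite /Cn_scal; ring.
Qed.

Let dil_0 x h : nadd x (dil (RtoC 0) h) = x.
Proof.
case: x => z u; rewrite /dil /=; congr pair; first by ring.
by apply: functional_extensionality => i; rewrite /Cn_scal /Cn_add; ring.
Qed.

Let line_CD (f : X -> C) x h t l : FD f (nadd x (dil t h)) l ->
  CD (fun s => f (nadd x (dil s h))) t (l h).
Proof.
move=> [Hl Hf]; apply: CDP => eps He.
have HN : 0 < nnorm h + 1 by have := nnorm_ge0 _ h; lra.
have [d [Hd H]] := Hf (eps / (nnorm h + 1)) (Rdiv_lt_0_compat _ _ He HN).
exists (d / (nnorm h + 1)); split; first exact: Rdiv_lt_0_compat.
move=> s Hs.
have Hsn : nnorm (dil s h) <= Cmod s * (nnorm h + 1).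
  apply: Rle_trans (norm_dil s h) _; apply: Rmult_le_compat_l; [exact: Cmod_ge_0 | lra].
have Hsd : nnorm (dil s h) < d.
  apply: Rle_lt_trans Hsn _; have := Rmult_lt_compat_r _ _ _ HN Hs.
  by rewrite (_ : d / (nnorm h + 1) * (nnorm h + 1) = d) //; field; lra.
have := H _ Hsd; rewrite dil_add nlin_dil // (Cmult_comm s) => H1; apply: Rle_trans H1 _.
have Hq : 0 <= eps / (nnorm h + 1) by apply: Rlt_le; apply: Rdiv_lt_0_compat.
apply: Rle_trans (Rmult_le_compat_l _ _ _ Hq Hsn) _.
by apply: Req_le; field; lra.
Qed.

(** Restriction to the complex line [t -> x + t h] reduces this to one variable: the restriction is
    holomorphic for [|t| < rho / nnorm h] and is expanded at [t = 1]. The assumption on [h] is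
    exactly that 1 is at most a quarter of this radius. *)
Lemma taylor_second_order (f : X -> C) (x : X) rho M l :
  0 < rho -> (forall h, nnorm h < rho -> exists l, FD f (nadd x h) l) ->
  (forall h, nnorm h < rho -> Cmod (f (nadd x h)) <= M) -> FD f x l ->
  forall h, nnorm h <= rho / 4 ->
  Cmod (Cminus (Cminus (f (nadd x h)) (f x)) (l h)) <= 16 * M * (nnorm h / rho) ^ 2.
Proof.
move=> Hrho Hf HM Hl h Hh.
(* An increment of norm 0 gives no radius [T]; there the definition of the differential already
   yields the value 0. *)
case: (Rle_lt_or_eq_dec _ _ (nnorm_ge0 _ h)) => [Hp|H0]; last first.
  case: Hl => _ Hl; have [d [Hd H]] := Hl 1 Rlt_0_1.
  have := H h ltac:(by rewrite -H0); rewrite -H0 => H1; apply: Rle_trans H1 _.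
  by apply: Req_le; field; lra.
set T := rho / nnorm h.
have HT : 0 < T by apply: Rdiv_lt_0_compat.
have TN : T * nnorm h = rho by rewrite /T; field; lra.
have Hlt : forall t, Cmod t < T -> nnorm (dil t h) < rho.
  move=> t Ht; apply: Rle_lt_trans (norm_dil t h) _; rewrite -TN.
  exact: Rmult_lt_compat_r.
have := cauchy_second_order (fun t => f (nadd x (dil t h))) T M (l h) (RtoC 1) HT.
rewrite dil_1 dil_0 Cmod_1 => H.
have -> : nnorm h / rho = 1 / T by rewrite /T; field; lra.
have -> : l h = Cmult (l h) (RtoC 1) by ring.
apply: H.
- by move=> t /Hlt Ht; have [l' Hl'] := Hf _ Ht; exists (l' h); apply: line_CD.
- by move=> t /Hlt Ht; apply: HM.
- by apply: line_CD; rewrite dil_0.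
apply: (Rmult_le_reg_r (nnorm h)) => //.
have -> : T / 4 * nnorm h = T * nnorm h / 4 by field.
by rewrite TN; lra.
Qed.

Lemma is_CI_Cn_lin (c : R -> Cn n) (d h : Cn n) a b :
  (forall i, is_CI (fun t => c t i) a b (d i)) ->
  is_CI (fun t => Cn_lin (c t) h) a b (Cn_lin d h).
Proof.
move=> H; rewrite /Cn_lin; elim: (index_enum _) => [|i s IH].
  have := is_CI_const (RtoC 0) a b; rewrite Cmult_0_l big_nil.
  by rewrite (_ : (fun _ => RtoC 0) = (fun t => \big[Cplus/RtoC 0]_(i <- [::]) Cmult (c t i) (h i))) //;
    apply: functional_extensionality => t; rewrite big_nil.
rewrite big_cons.
have E : (fun t => \big[Cplus/RtoC 0]_(j <- i :: s) Cmult (c t j) (h j)) =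
  (fun t => Cplus (Cmult (h i) (c t i)) (\big[Cplus/RtoC 0]_(j <- s) Cmult (c t j) (h j))).
  by apply: functional_extensionality => t; rewrite big_cons (Cmult_comm (h i)).
rewrite E (Cmult_comm (d i)); apply: is_CI_plus IH; exact: is_CI_scal.
Qed.

Section Integral.

Variables (F l0 : R -> X -> C) (x : X) (rho M a b : R).
Hypothesis Hab : a <= b.
Hypothesis Hrho : 0 < rho.
Hypothesis HF : forall t h, nnorm h < rho -> exists l, FD (F t) (nadd x h) l.
Hypothesis HM : forall t h, nnorm h < rho -> Cmod (F t (nadd x h)) <= M.
Hypothesis Hcont : forall t h, nnorm h < rho -> cont_at (E := NR) (fun t => F t (nadd x h)) t.
Hypothesis Hl0 : forall t, FD (F t) x (l0 t).

Let M0 : 0 <= M.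
Proof.
have H0 : nnorm (nzero : X) < rho by rewrite nnorm0.
exact: Rle_trans (Cmod_ge_0 _) (HM 0 _ H0).
Qed.

Let taylor t h : nnorm h <= rho / 4 ->
  Cmod (Cminus (Cminus (F t (nadd x h)) (F t x)) (l0 t h)) <= 16 * M * (nnorm h / rho) ^ 2.
Proof. exact: (taylor_second_order (F t) x rho M (l0 t) Hrho (HF t) (HM t) (Hl0 t) h). Qed.

Let cont_x t : cont_at (E := NR) (fun t => F t x) t.
Proof. by have := Hcont t nzero; rewrite naddx0 nnorm0; apply. Qed.

(* The differential is a locally uniform limit of difference quotients. *)
Let cont_l0 h t : cont_at (E := NR) (fun t => l0 t h) t.
Proof.
move=> eps He.
set N := nnorm h; have HN : 0 <= N := nnorm_ge0 _ h.
set c := 16 * M * (N / rho) ^ 2.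
have Hc : 0 <= c by apply: Rmult_le_pos; [lra | apply: pow2_ge_0].
set s := Rmin (rho / (4 * (N + 1))) (eps / (4 * (c + 1))).
have Hs : 0 < s by apply: Rmin_pos; apply: Rdiv_lt_0_compat; lra.
have Hs1 : s * N <= rho / 4.
  apply: (Rle_trans _ (rho / (4 * (N + 1)) * (N + 1))).
    by apply: Rmult_le_compat; try lra; apply: Rmin_l.
  by apply: Req_le; field; lra.
have Hs2 : 2 * c * s <= eps / 2.
  apply: (Rle_trans _ (2 * (c + 1) * (eps / (4 * (c + 1))))).
    by apply: Rmult_le_compat; try lra; apply: Rmin_r.
  by apply: Req_le; field; lra.
set k := dil (RtoC s) h.
have Nk : nnorm k <= s * N.
  apply: Rle_trans (norm_dil (RtoC s) h) _; rewrite Cmod_RtoC Rabs_pos_eq -/N; lra.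
have Lk : forall t, l0 t k = Cmult (RtoC s) (l0 t h).
  by move=> u; apply: nlin_dil; have [] := Hl0 u.
have Tk : forall t, Cmod (Cminus (Cminus (F t (nadd x k)) (F t x)) (Cmult (RtoC s) (l0 t h))) <= c * s * s.
  move=> u; rewrite -Lk; apply: Rle_trans (taylor u k _) _; first lra.
  have -> : c * s * s = 16 * M * (s * N / rho) ^ 2 by rewrite /c; field; lra.
  apply: Rmult_le_compat_l; first lra.
  apply: pow_incr; split.
    by apply: Rmult_le_pos; [exact: nnorm_ge0 | apply: Rlt_le; apply: Rinv_0_lt_compat].
  by apply: Rmult_le_compat_r => //; apply: Rlt_le; apply: Rinv_0_lt_compat.
have Hse : 0 < s * eps / 8 by have := Rmult_lt_0_compat _ _ Hs He; lra.
have [d1 [Hd1 C1]] := Hcont t k ltac:(lra) _ Hse.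
have [d2 [Hd2 C2]] := cont_x t _ Hse.
exists (Rmin d1 d2); split; first exact: Rmin_pos.
move=> y Hy; have [G1 G2] := Rmin_Rgt_l _ _ _ Hy.
have {}C1 := C1 y G1; have {}C2 := C2 y G2.
have T1 := Tk t; have T2 := Tk (nadd (n := NR) t y).
apply: (Rmult_lt_reg_l s) => //.
have -> : s * Cmod (Cminus (l0 (nadd (n := NR) t y) h) (l0 t h)) =
   Cmod (Cmult (RtoC s) (Cminus (l0 (nadd (n := NR) t y) h) (l0 t h))).
  by rewrite Cmod_mult Cmod_RtoC Rabs_pos_eq; lra.
move: T1 T2 C1 C2.
set D1 := Cminus (Cminus _ _) _; set D2 := Cminus (Cminus _ _) _.
set D3 := Cminus _ _; set D4 := Cminus _ _ => T1 T2 C1 C2.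
have -> : Cmult (RtoC s) (Cminus (l0 (nadd (n := NR) t y) h) (l0 t h)) =
  Cplus (Cminus D1 D2) (Cminus D3 D4).
  by rewrite /D1 /D2 /D3 /D4; ring.
have := Cmod_triangle (Cminus D1 D2) (Cminus D3 D4).
have := Cmod_sub_le D1 D2; have := Cmod_sub_le D3 D4.
have : c * s * s * 2 <= eps / 2 * s by have := Rmult_le_compat_r s _ _ ltac:(lra) Hs2; lra.
lra.
Qed.

(** The Taylor remainder is bounded uniformly in [t], so integrating it gives a quadratic remainder
    for the integral. The continuity of [t -> l0 t h] is what makes the candidate differential an
    integral. *)
Lemma FD_integral : exists l, FD (fun y => CI (fun t => F t y) a b) x l /\
  forall h, is_CI (fun t => l0 t h) a b (l h).
Proof.
exists (fun h => CI (fun t => l0 t h) a b).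
have HI : forall h, is_CI (fun t => l0 t h) a b (CI (fun t => l0 t h) a b).
  by move=> h; apply: cont_is_CI.
split=> //; split.
  (* Admissibility requires explicit coefficients; they are the integrals of [l0] on the coordinate
     vectors. *)
  set A := CI (fun t => l0 t (RtoC 1, Cn_zero)) a b.
  set B := fun i => CI (fun t => l0 t (RtoC 0, Cn_unit n i)) a b.
  exists (fun w => Cmult A w), (fun h => Cn_lin B h); split; first by exists A.
  split; first by exists B.
  move=> h; apply: is_CI_unique.
  have := is_CI_plus _ _ _ _ _ _ (is_CI_scal h.1 _ _ _ _ (HI (RtoC 1, Cn_zero)))
     (is_CI_Cn_lin (fun t i => l0 t (RtoC 0, Cn_unit n i)) B h.2 a b (fun i => HI (RtoC 0, Cn_unit n i))).
  rewrite (Cmult_comm h.1); apply: is_CI_ext => // t _.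
  have [[l1 [l2 [[c Hc] [[e He] H]]]] _] := Hl0 t.
  rewrite !H /= !Hc !He Cn_lin_zeror.
  have -> : (fun i => l0 t (RtoC 0, Cn_unit n i)) = e.
    by apply: functional_extensionality => i; rewrite H /= Hc He Cn_lin_unit; ring.
  ring.
move=> eps He.
set c := 32 * M * (b - a) / (rho * rho) + 1.
have Hrr : 0 < rho * rho by apply: Rmult_lt_0_compat.
have Hc0 : 0 <= 32 * M * (b - a) / (rho * rho).
  by apply: Rmult_le_pos; [apply: Rmult_le_pos; lra | apply: Rlt_le; apply: Rinv_0_lt_compat].
have Hc : 0 < c by rewrite /c; lra.
exists (Rmin (rho / 4) (eps / c)); split; first by apply: Rmin_pos; [lra | apply: Rdiv_lt_0_compat].
move=> h Hh; have [G1 G2] := Rmin_Rgt_l _ _ _ Hh.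
have I1 : is_CI (fun t => F t (nadd x h)) a b (CI (fun t => F t (nadd x h)) a b).
  by apply: cont_is_CI => // t _; apply: Hcont; lra.
have I2 : is_CI (fun t => F t x) a b (CI (fun t => F t x) a b) by apply: cont_is_CI.
have I3 := is_CI_minus _ _ _ _ _ _ (is_CI_minus _ _ _ _ _ _ I1 I2) (HI h).
have B := is_CI_bound _ _ _ _ (16 * M * (nnorm h / rho) ^ 2) Hab I3.
apply: Rle_trans (B _) _; first by move=> t _; apply: taylor; lra.
have -> : 2 * (16 * M * (nnorm h / rho) ^ 2) * (b - a) =
  32 * M * (b - a) / (rho * rho) * nnorm h * nnorm h by field; lra.
apply: Rmult_le_compat_r; first exact: nnorm_ge0.
have G3 : c * nnorm h <= eps.
  have := Rmult_lt_compat_l c _ _ Hc G2; rewrite (_ : c * (eps / c) = eps); [lra | field; lra].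
have := nnorm_ge0 _ h; rewrite /c in G3; lra.
Qed.

End Integral.

End Dependence.

Lemma FD_slice_l (F : nspace) (g : C -> F -> C) z u l :
  FD (E := Nprod NC F) (fun y => g y.1 y.2) (z, u) l ->
  CD (fun w => g w u) z (l (RtoC 1, nzero)).
Proof.
move=> H; case: (H) => [Hl _].
have Hl' : nlin (n := NC) (fun h => l (h, nzero)).
  case: Hl => [l1 [l2 [[c Hc] [H2 HH]]]].
  apply: (nlin_ext NC (fun h => Cplus (Cmult c h) (l2 nzero))); first by move=> h; rewrite HH Hc.
  by exists c => h; rewrite (nlin_at0 _ _ H2); ring.
apply: (FD_CD _ _ (fun h => l (h, nzero))).
apply: (FD_proj NC (Nprod NC F) (fun y => g y.1 y.2) (fun w => (w, u)) (fun h => (h, nzero)) z l) => //.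
  by move=> h /=; rewrite naddx0.
by move=> h /=; rewrite nnorm0; apply: Rmax_lub; [lra | apply: Cmod_ge_0].
Qed.

Lemma FD_slice_r (F : nspace) (g : C -> F -> C) z u l :
  FD (E := Nprod NC F) (fun y => g y.1 y.2) (z, u) l ->
  FD (fun v => g z v) u (fun h => l (RtoC 0, h)).
Proof.
move=> H; case: (H) => [Hl _].
apply: (FD_proj F (Nprod NC F) (fun y => g y.1 y.2) (fun v => (z, v)) (fun h => (RtoC 0, h)) u l) => //.
- by move=> h /=; rewrite Cplus_0_r.
- by move=> h /=; rewrite Cmod_0; apply: Rmax_lub; [apply: nnorm_ge0 | lra].
exact: (nlin_pairr NC F l Hl).
Qed.

Lemma clog_bound k q : Cmod q <= k -> k < 1 -> Cmod (clog q) <= 2 * / ((1 - k) * (1 - k)) * Cmod q.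
Proof.
move=> Hq Hk; have Hk0 : 0 <= k := Rle_trans _ _ _ (Cmod_ge_0 _) Hq.
have := clog_lip k (RtoC 0) q ltac:(by rewrite Cmod_0) Hq Hk.
by rewrite clog0 !(_ : forall z, Cminus z (RtoC 0) = z) // => z; ring.
Qed.

(** * A primitive of the regular part of [alpha_u(z) dz / z] *)

Section Potential.

Variables (n : nat) (R0 r delta M : R) (alpha : C -> Cn n -> C).
Notation X := (Nprod NC (NCn n)).
Hypothesis Hr : 0 < r.
Hypothesis HrR : r < R0.
Hypothesis Halpha : forall z u, Cmod z < R0 -> Cn_norm u < delta ->
  exists l, FD (E := X) (fun y => alpha y.1 y.2) (z, u) l.
Hypothesis HM : forall t u, Cn_norm u < delta -> Cmod (alpha (Cmult (RtoC r) (cis t)) u) <= M.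

(* Integrating the Cauchy kernel in [w] turns [(alpha_u(w) - alpha_u(0)) / w]
   into an average of branches of [- log (1 - w e^(-it) / r)]. *)
Let F (t : R) (y : X) : C :=
  Cmult (alpha (Cmult (RtoC r) (cis t)) y.2) (clog (Cmult (Cmult y.1 (RtoC (/ r))) (cisV t))).

Definition potential (w : C) (u : Cn n) : C :=
  Cmult (Cinv (RtoC (2 * PI))) (CI (fun t => F t (w, u)) 0 (2 * PI)).

Let circ_mod t : Cmod (Cmult (RtoC r) (cis t)) = r.
Proof. by rewrite Cmod_mult Cmod_cis Cmod_RtoC Rabs_pos_eq; lra. Qed.

Let ratio_mod w t : Cmod (Cmult (Cmult w (RtoC (/ r))) (cisV t)) = Cmod w / r.
Proof.
rewrite Cmod_mult_cisV Cmod_mult Cmod_RtoC Rabs_pos_eq //.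
by apply: Rlt_le; apply: Rinv_0_lt_compat.
Qed.

Let ratio_lt w : Cmod w < r -> Cmod w / r < 1.
Proof.
move=> Hw; apply: (Rmult_lt_reg_r r) => //.
by rewrite (_ : Cmod w / r * r = Cmod w) ?Rmult_1_l //; field; lra.
Qed.

Let FD_F t w u la : Cmod w < r ->
  FD (E := X) (fun y => alpha y.1 y.2) (Cmult (RtoC r) (cis t), u) la ->
  FD (F t) (w, u) (fun h =>
    Cplus (Cmult (alpha (Cmult (RtoC r) (cis t)) u)
             (Cmult (Cmult (Cinv (Cminus (RtoC 1) (Cmult (Cmult w (RtoC (/ r))) (cisV t))))
                (Cmult (RtoC (/ r)) (cisV t))) h.1))
          (Cmult (clog (Cmult (Cmult w (RtoC (/ r))) (cisV t))) (la (RtoC 0, h.2)))).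
Proof.
move=> Hw Hla.
have F1 := FD_snd NC (NCn n) _ (w, u) _ (FD_slice_r (NCn n) alpha _ _ _ Hla).
have D1 : CD (fun w => Cmult (Cmult w (RtoC (/ r))) (cisV t)) w (Cmult (RtoC (/ r)) (cisV t)).
  have := FD_scal NC (Cmult (RtoC (/ r)) (cisV t)) _ _ _ (CD_id w) => H.
  apply: FD_ext_lin (FD_ext _ _ _ _ _ _ H) => ? /=; ring.
have D2 := CD_clog (Cmult (Cmult w (RtoC (/ r))) (cisV t)) ltac:(by rewrite ratio_mod; apply: ratio_lt).
have F2 := FD_fst NC (NCn n) _ (w, u) _ (FD_comp1 NC clog _ w _ _ D2 D1).
apply: FD_ext_lin (FD_mult _ _ _ _ _ _ F1 F2) => h /=; ring.
Qed.

Let cont_F w u t : Cmod w < r -> Cn_norm u < delta ->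
  cont_at (E := NR) (fun t => F t (w, u)) t.
Proof.
move=> Hw Hu.
have [la Hla] := Halpha (Cmult (RtoC r) (cis t)) u ltac:(rewrite circ_mod; lra) Hu.
have F1 := FD_comp1 NR (fun z => alpha z u) _ t _ _ (FD_slice_l (NCn n) alpha _ _ _ Hla)
   (FD_scal NR (RtoC r) _ _ _ (FD_cis t)).
have D2 := CD_clog (Cmult (Cmult w (RtoC (/ r))) (cisV t)) ltac:(by rewrite ratio_mod; apply: ratio_lt).
have F2 := FD_comp1 NR clog _ t _ _ D2 (FD_scal NR (Cmult w (RtoC (/ r))) _ _ _ (FD_cisV t)).
exact: FD_cont (FD_mult _ _ _ _ _ _ F1 F2).
Qed.

(** With [q = w e^(-it) / r], differentiating the logarithm and multiplying by [w] gives the factor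
    [q / (1 - q) = 1 / (1 - q) - 1]. The average of [alpha] against it is Cauchy's formula at [w]
    minus Cauchy's formula at 0. *)
Lemma FD_potential w u : Cmod w < r -> Cn_norm u < delta ->
  exists l, FD (E := X) (fun y => potential y.1 y.2) (w, u) l /\
    Cmult w (l (RtoC 1, Cn_zero)) = Cminus (alpha w u) (alpha (RtoC 0) u).
Proof.
move=> Hw Hu; have HPI := PI_RGT_0.
have HPC : RtoC (2 * PI) <> RtoC 0 by apply: RtoC_neq0; lra.
have Hex : forall t, exists la, FD (E := X) (fun y => alpha y.1 y.2) (Cmult (RtoC r) (cis t), u) la.
  by move=> t; apply: Halpha => //; rewrite circ_mod; lra.
(* [FD_integral] takes the differentials of the integrand as a function of [t], so one is chosen for
   each [t]. *)
pose la t := proj1_sig (constructive_indefinite_description _ (Hex t)).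
have Hla : forall t, FD (E := X) (fun y => alpha y.1 y.2) (Cmult (RtoC r) (cis t), u) (la t).
  by move=> t; exact: (proj2_sig (constructive_indefinite_description _ (Hex t))).
set rho := Rmin ((r - Cmod w) / 2) (delta - Cn_norm u).
have Hrho : 0 < rho by apply: Rmin_pos; lra.
(* Within [rho] of [w] the modulus stays at most [(r + Cmod w) / 2], so [k] bounds the arguments of
   [clog] for all [t], strictly inside the unit disc. *)
set k := (r + Cmod w) / 2 / r.
have Hk : k < 1.
  apply: (Rmult_lt_reg_r r) => //.
  by rewrite (_ : k * r = (r + Cmod w) / 2); [lra | rewrite /k; field; lra].
have near : forall h : X, nnorm h < rho ->
   Cmod (Cplus w h.1) <= (r + Cmod w) / 2 /\ Cn_norm (Cn_add u h.2) < delta.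
  move=> h Hh; have [G1 G2] := Rmin_Rgt_l _ _ _ Hh.
  have A1 : Cmod h.1 <= nnorm h := Rmax_l _ _.
  have A2 : Cn_norm h.2 <= nnorm h := Rmax_r _ _.
  have B1 := Cmod_triangle w h.1; have B2 := Cn_norm_add n u h.2.
  split; lra.
have M0 : 0 <= M := Rle_trans _ _ _ (Cmod_ge_0 _) (HM 0 u Hu).
have H1 : forall t (h : X), nnorm h < rho -> exists l, FD (F t) (nadd (n := X) (w, u) h) l.
  move=> t h Hh; have [N1 N2] := near h Hh.
  have [la' Hla'] := Halpha (Cmult (RtoC r) (cis t)) (Cn_add u h.2) ltac:(rewrite circ_mod; lra) N2.
  by eexists; apply: (FD_F t (Cplus w h.1) (Cn_add u h.2) _ _ Hla'); lra.
have H2 : forall t (h : X), nnorm h < rho ->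
    Cmod (F t (nadd (n := X) (w, u) h)) <= M * (2 * / ((1 - k) * (1 - k)) * k).
  move=> t h Hh; have [N1 N2] := near h Hh.
  have Hq : Cmod (Cmult (Cmult (Cplus w h.1) (RtoC (/ r))) (cisV t)) <= k.
    by rewrite ratio_mod /k; apply: Rmult_le_compat_r => //; apply: Rlt_le; apply: Rinv_0_lt_compat.
  apply: Cmod_mult_le; first exact: HM.
  apply: Rle_trans (clog_bound k _ Hq Hk) _; apply: Rmult_le_compat_l => //.
  by apply: Rmult_le_pos; [lra | apply: Rlt_le; apply: Rinv_0_lt_compat; apply: Rmult_lt_0_compat; lra].
have H3 : forall t (h : X), nnorm h < rho ->
    cont_at (E := NR) (fun t => F t (nadd (n := X) (w, u) h)) t.
  move=> t h Hh; have [N1 N2] := near h Hh.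
  by apply: (cont_F (Cplus w h.1) (Cn_add u h.2)) => //; lra.
have [l [Hl Il]] := FD_integral n F _ (w, u) rho _ 0 (2 * PI)
  two_PI_ge0 Hrho H1 H2 H3 (fun t => FD_F t w u (la t) Hw (Hla t)).
exists (fun h => Cmult (Cinv (RtoC (2 * PI))) (l h)); split.
  by apply: FD_scal; apply: FD_ext Hl => y; case: y.
have := is_CI_scal w _ _ _ _ (Il (RtoC 1, Cn_zero)).
have Hf : forall z, Cmod z <= r -> exists d, CD (fun z => alpha z u) z d.
  move=> z Hz; have [l' Hl'] := Halpha z u ltac:(lra) Hu; eexists; exact: (FD_slice_l (NCn n) alpha _ _ _ Hl').
have J1 := cauchy_formula (fun z => alpha z u) r w Hr Hw Hf.
have J0 := cauchy_formula (fun z => alpha z u) r (RtoC 0) Hr ltac:(rewrite Cmod_0; lra) Hf.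
have J := is_CI_minus _ _ _ _ _ _ J1 J0.
move=> I.
have E1 := is_CI_unique _ _ _ _ I.
have E2 : CI (fun t => Cmult w (Cplus (Cmult (alpha (Cmult (RtoC r) (cis t)) u)
             (Cmult (Cmult (Cinv (Cminus (RtoC 1) (Cmult (Cmult w (RtoC (/ r))) (cisV t))))
                (Cmult (RtoC (/ r)) (cisV t))) (RtoC 1)))
          (Cmult (clog (Cmult (Cmult w (RtoC (/ r))) (cisV t))) (la t (RtoC 0, Cn_zero)))))
    0 (2 * PI) = Cminus (Cmult (RtoC (2 * PI)) (alpha w u)) (Cmult (RtoC (2 * PI)) (alpha (RtoC 0) u)).
  apply: is_CI_unique; apply: is_CI_ext J; first lra.
  move=> t _.
  have -> : la t (RtoC 0, Cn_zero) = RtoC 0 by apply: (nlin_at0 X); case: (Hla t).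
  set q := Cmult (Cmult w (RtoC (/ r))) (cisV t).
  have Hn : Cminus (RtoC 1) q <> RtoC 0.
    by apply: one_minus_neq01; rewrite ratio_mod; apply: ratio_lt.
  have -> : Cminus (RtoC 1) (Cmult (Cmult (RtoC 0) (RtoC (/ r))) (cisV t)) = RtoC 1 by ring.
  set A := alpha _ u.
  have -> : Cmult w (Cplus (Cmult A (Cmult (Cmult (Cinv (Cminus (RtoC 1) q)) (Cmult (RtoC (/ r)) (cisV t))) (RtoC 1)))
     (Cmult (clog q) (RtoC 0))) = Cmult (Cmult A (Cinv (Cminus (RtoC 1) q))) q by rewrite /q; ring.
  by field; exact: Hn.
rewrite E1 in E2.
have -> : Cmult w (Cmult (Cinv (RtoC (2 * PI))) (l (RtoC 1, Cn_zero))) =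
  Cmult (Cinv (RtoC (2 * PI))) (Cmult w (l (RtoC 1, Cn_zero))) by ring.
rewrite E2; field; exact: HPC.
Qed.

(** The function [alpha] enters only through its bound [M] on the circle of radius [r], so a small
    [M] makes the potential nearly constant on the whole disc of radius [s]. The 4 combines the
    factors 2 of [clog_lip] and [is_CI_bound]. *)
Lemma potential_lip w w' u s : s < r -> Cmod w <= s -> Cmod w' <= s -> Cn_norm u < delta ->
  Cmod (Cminus (potential w' u) (potential w u)) <=
    M * (4 * / ((1 - s / r) * (1 - s / r)) * / r) * Cmod (Cminus w' w).
Proof.
move=> Hs Hw Hw' Hu; have HPI := PI_RGT_0.
have Hir : 0 < / r by apply: Rinv_0_lt_compat.
have I1 : is_CI (fun t => F t (w, u)) 0 (2 * PI) (CI (fun t => F t (w, u)) 0 (2 * PI)).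
  by apply: cont_is_CI; [exact: two_PI_ge0 | move=> t _; apply: cont_F => //; lra].
have I2 : is_CI (fun t => F t (w', u)) 0 (2 * PI) (CI (fun t => F t (w', u)) 0 (2 * PI)).
  by apply: cont_is_CI; [exact: two_PI_ge0 | move=> t _; apply: cont_F => //; lra].
set k := s / r.
have Hk : k < 1.
  apply: (Rmult_lt_reg_r r) => //.
  by rewrite (_ : k * r = s); [lra | rewrite /k; field; lra].
have B := is_CI_bound _ _ _ _ (M * (2 * / ((1 - k) * (1 - k)) * (Cmod (Cminus w' w) * / r))) two_PI_ge0
  (is_CI_minus _ _ _ _ _ _ I2 I1).
rewrite /potential.
have -> : forall c a b, Cminus (Cmult c a) (Cmult c b) = Cmult c (Cminus a b) by move=> c a b; ring.
rewrite Cmod_mult Cmod_inv; last by apply: RtoC_neq0; lra.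
rewrite Cmod_RtoC Rabs_pos_eq; last lra.
apply: (Rmult_le_reg_l (2 * PI)); first lra.
rewrite -Rmult_assoc Rinv_r ?Rmult_1_l; last lra.
apply: Rle_trans (B _) _; last by rewrite Rminus_0_r; apply: Req_le; ring.
move=> t _; rewrite /F /=.
have -> : forall c a b, Cminus (Cmult c a) (Cmult c b) = Cmult c (Cminus a b) by move=> c a b; ring.
apply: Cmod_mult_le; first exact: HM.
have Hq : forall v, Cmod v <= s -> Cmod (Cmult (Cmult v (RtoC (/ r))) (cisV t)) <= k.
  by move=> v Hv; rewrite ratio_mod /k; apply: Rmult_le_compat_r => //; lra.
apply: Rle_trans (clog_lip k _ _ (Hq w Hw) (Hq w' Hw') Hk) _.
apply: Req_le; congr (_ * _).
have -> : Cminus (Cmult (Cmult w' (RtoC (/ r))) (cisV t)) (Cmult (Cmult w (RtoC (/ r))) (cisV t)) =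
  Cmult (Cmult (Cminus w' w) (RtoC (/ r))) (cisV t) by ring.
exact: ratio_mod.
Qed.

Lemma potential0 u : Cn_norm u < delta -> potential (RtoC 0) u = RtoC 0.
Proof.
move=> Hu.
have I1 : is_CI (fun t => F t (RtoC 0, u)) 0 (2 * PI) (CI (fun t => F t (RtoC 0, u)) 0 (2 * PI)).
  by apply: cont_is_CI; [exact: two_PI_ge0 | move=> t _; apply: cont_F => //; rewrite Cmod_0].
rewrite /potential (is_CI_eq0 _ _ _ _ two_PI_ge0 I1); first by ring.
move=> t _; rewrite /F /= (_ : Cmult (Cmult (RtoC 0) (RtoC (/ r))) (cisV t) = RtoC 0); last by ring.
rewrite clog0; ring.
Qed.

Lemma potential_eq0 w u : Cmod w < r -> Cn_norm u < delta ->
  (forall t, alpha (Cmult (RtoC r) (cis t)) u = RtoC 0) -> potential w u = RtoC 0.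
Proof.
move=> Hw Hu H0.
have I1 : is_CI (fun t => F t (w, u)) 0 (2 * PI) (CI (fun t => F t (w, u)) 0 (2 * PI)).
  by apply: cont_is_CI; [exact: two_PI_ge0 | move=> t _; apply: cont_F].
rewrite /potential (is_CI_eq0 _ _ _ _ two_PI_ge0 I1); first by ring.
by move=> t _; rewrite /F /= H0; ring.
Qed.

End Potential.

(** * Fixed points and implicit functions *)

(** The two bounds give [|T s| <= |s| / 2 + eta / 2], so the iterates of 0 stay in the disc. They
    form a Cauchy sequence, whose limit is taken in each real component. *)
Lemma contraction_fixpoint (T : C -> C) eta : 0 < eta ->
  (forall s s', Cmod s <= eta -> Cmod s' <= eta ->
     Cmod (Cminus (T s) (T s')) <= Cmod (Cminus s s') / 2) ->
  Cmod (T (RtoC 0)) <= eta / 2 -> exists s, Cmod s <= eta /\ T s = s.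
Proof.
move=> He HT H0.
pose it := fix it (m : nat) := if m is m'.+1 then T (it m') else RtoC 0.
have Hit : forall m, Cmod (it m) <= eta.
  elim=> [|m IH] /=; first by rewrite Cmod_0; lra.
  have Z : Cmod (RtoC 0) <= eta by rewrite Cmod_0; lra.
  have := HT _ _ IH Z; rewrite (_ : Cminus (it m) (RtoC 0) = it m); last by ring.
  by have := Cmod_le_add_sub (T (it m)) (T (RtoC 0)); lra.
(* Contracting the pair [(it (m + j), it m)] down to [(it j, 0)] bounds all differences at once,
   without a geometric sum. *)
have Hd : forall m j, Cmod (Cminus (it (m + j)%N) (it m)) <= (/ 2) ^ m * eta.
  elim=> [|m IH] j.
    rewrite add0n /= (_ : Cminus (it j) (RtoC 0) = it j); last by ring.
    by have := Hit j; lra.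
  rewrite addSn /=; apply: Rle_trans (HT _ _ (Hit _) (Hit _)) _.
  by have := IH j; lra.
have small : forall eps, 0 < eps -> exists N, (/ 2) ^ N * eta < eps.
  move=> eps Hep; have [N HN] := pow_lt_1_zero (/ 2) ltac:(rewrite Rabs_pos_eq; lra) (eps / eta) (Rdiv_lt_0_compat _ _ Hep He).
  exists N; have := HN N (le_n N); rewrite Rabs_pos_eq; last by apply: pow_le; lra.
  move=> H; have := Rmult_lt_compat_r _ _ _ He H.
  by rewrite (_ : eps / eta * eta = eps) //; field; lra.
have dist : forall N i j, (N <= i)%coq_nat -> (N <= j)%coq_nat ->
    Cmod (Cminus (it i) (it j)) <= 2 * ((/ 2) ^ N * eta).
  move=> N i j Hi Hj.
  have B : forall i, (N <= i)%coq_nat -> Cmod (Cminus (it i) (it N)) <= (/ 2) ^ N * eta.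
    by move=> i' /leP Hi'; have := Hd N (i' - N)%N; rewrite subnKC.
  have -> : Cminus (it i) (it j) = Cminus (Cminus (it i) (it N)) (Cminus (it j) (it N)) by ring.
  by have := Cmod_sub_le (Cminus (it i) (it N)) (Cminus (it j) (it N)); have := B i Hi; have := B j Hj; lra.
have cv : forall pr : C -> R, (forall a b, pr (Cminus a b) = pr a - pr b) ->
    (forall a, Rabs (pr a) <= Cmod a) -> exists x, Un_cv (fun m => pr (it m)) x.
  move=> pr P1 P2.
  have Hc : Cauchy_crit (fun m => pr (it m)).
    move=> eps Hep; have [N HN] := small (eps / 2) ltac:(lra).
    exists N => i j Hi Hj; rewrite /R_dist -P1; apply: Rle_lt_trans (P2 _) _.
    by have := dist N i j Hi Hj; lra.
  by have [x Hx] := Rcomplete.R_complete _ Hc; exists x.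
have [x Hx] := cv fst ltac:(by []) (fun a => Rle_trans _ _ _ (Rmax_l _ _) (Rmax_Cmod a)).
have [y Hy] := cv snd ltac:(by []) (fun a => Rle_trans _ _ _ (Rmax_r _ _) (Rmax_Cmod a)).
pose s : C := (x, y).
have lim : forall eps, 0 < eps -> exists N, Cmod (Cminus (it N) s) <= eps /\ Cmod (Cminus (it N.+1) s) <= eps.
  move=> eps Hep; have [N1 H1] := Hx (eps / 2) ltac:(lra); have [N2 H2] := Hy (eps / 2) ltac:(lra).
  have B : forall N, (N1 <= N)%coq_nat -> (N2 <= N)%coq_nat -> Cmod (Cminus (it N) s) <= eps.
    move=> N L1 L2; apply: Rle_trans (Cmod_le_sum _) _.
    by have := H1 N L1; have := H2 N L2; rewrite /R_dist /= /Rminus; lra.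
  by exists (N1 + N2)%coq_nat; split; apply: B; lia.
have Hs : Cmod s <= eta.
  apply: le_epsilon => eps Hep; have [N [H1 _]] := lim eps Hep.
  by have := Cmod_le_add_sub s (it N); rewrite Cmod_sub_sym; have := Hit N; lra.
exists s; split=> //.
apply: (Cmod_eq_of_le _ _ 2); first lra.
move=> eps Hep; have [N [H1 H2]] := lim eps Hep.
have B := HT _ _ Hs (Hit N); rewrite Cmod_sub_sym in H1.
have -> : Cminus (T s) s = Cplus (Cminus (T s) (T (it N))) (Cminus (it N.+1) s) by rewrite /=; ring.
by have := Cmod_triangle (Cminus (T s) (T (it N))) (Cminus (it N.+1) s); lra.
Qed.

(** The lower bound [kappa] forces the partial derivative [m] in the first slot to be nonzero. If
    [D] is the increment of [s], differentiability of [G] makes [m D + l2 h] small relative to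
    [max(|D|, |h|)]. A first use with tolerance [|m| / 2] gives [|D| <= K' |h|]; a second, with
    arbitrary tolerance, then identifies the differential as [- l2 / m]. *)
Lemma FD_implicit (E : nspace) (G : C -> E -> C) (s : E -> C) (x : E) l kappa r :
  FD (E := Nprod NC E) (fun y => G y.1 y.2) (s x, x) l -> cont_at s x ->
  0 < r -> (forall h, nnorm h < r -> G (s (nadd x h)) (nadd x h) = RtoC 0) ->
  0 < kappa -> (forall t, Cmod t < r -> kappa * Cmod t <= Cmod (Cminus (G (Cplus (s x) t) x) (G (s x) x))) ->
  exists l', FD s x l'.
Proof.
move=> [[l1 [l2 [[m Hm] [Hl2 Hl]]]] HG] Hs Hr Hz Hk Hlow.
have l20 := nlin_at0 E l2 Hl2.
have Hm0 : 0 < Cmod m.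
  have [d [Hd H]] := HG (kappa / 2) ltac:(lra).
  pose t := Rmin r d / 2.
  have Hmin := Rmin_pos _ _ Hr Hd.
  have Ht : 0 < t by rewrite /t; lra.
  have Et : Cmod (RtoC t) = t by rewrite Cmod_RtoC Rabs_pos_eq; lra.
  have T1 : t < r by have := Rmin_l r d; rewrite /t; lra.
  have T2 : t < d by have := Rmin_r r d; rewrite /t; lra.
  have L := Hlow (RtoC t); rewrite Et in L; have {}L := L T1.
  have En : nnorm (n := Nprod NC E) (RtoC t, nzero) = t.
    by rewrite /= nnorm0 Et Rmax_left; lra.
  have := H (RtoC t, nzero); rewrite En => {}H; have := H T2.
  rewrite Hl /= naddx0 Hm l20 Cplus_0_r => B.
  have := Cmod_le_add_sub (Cminus (G (Cplus (s x) (RtoC t)) x) (G (s x) x)) (Cmult m (RtoC t)).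
  rewrite Cmod_mult Et => A.
  have : 0 < Cmod m * t by nra.
  by move=> P; apply: (Rmult_lt_reg_r t) => //; lra.
have Hmn : m <> RtoC 0 by move=> E0; move: Hm0; rewrite E0 Cmod_0; lra.
have [K [HK HlK]] := nlin_bound _ _ Hl2.
exists (fun h => Cmult (Copp (Cinv m)) (l2 h)); split; first exact: nlin_scal.
move=> eps He.
(* The first term is the bound when [|D|] exceeds [|h|], where half of [|m D|] can be absorbed; the
   1 covers the other case. *)
set K' := 2 * K / Cmod m + 1.
have HKm : 0 < 2 * K / Cmod m by apply: Rdiv_lt_0_compat; lra.
have HK' : 1 <= K' by rewrite /K'; lra.
have He' : 0 < eps * Cmod m / K' by apply: Rdiv_lt_0_compat; [apply: Rmult_lt_0_compat | lra].
have [d1 [Hd1 H1]] := HG (Cmod m / 2) ltac:(lra).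
have [d2 [Hd2 H2]] := HG _ He'.
have [d3 [Hd3 H3]] := Hs _ (Rmin_pos _ _ Hd1 Hd2).
exists (Rmin (Rmin d1 d2) (Rmin d3 r)); split; first by repeat apply: Rmin_pos.
move=> h Hh.
have [G1 G2] := Rmin_Rgt_l _ _ _ Hh; have [G3 G4] := Rmin_Rgt_l _ _ _ G1; have [G5 G6] := Rmin_Rgt_l _ _ _ G2.
have {}H3 := H3 h G5; have [G7 G8] := Rmin_Rgt_l _ _ _ H3.
set D := Cminus (s (nadd x h)) (s x) in G7 G8 *.
have Eadd : nadd (n := Nprod NC E) (s x, x) (D, h) = (s (nadd x h), nadd x h).
  by rewrite /= /D; congr pair; ring.
have G00 : G (s x) x = RtoC 0.
  by have := Hz nzero; rewrite naddx0 nnorm0; apply.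
have step : forall e d, (forall h, nnorm h < d -> Cmod (Cminus (Cminus
     ((fun y : Nprod NC E => G y.1 y.2) (nadd (n := Nprod NC E) (s x, x) h)) ((fun y : Nprod NC E => G y.1 y.2) (s x, x))) (l h)) <= e * nnorm h) ->
    Cmod D < d -> nnorm h < d -> Cmod (Cplus (Cmult m D) (l2 h)) <= e * Rmax (Cmod D) (nnorm h).
  move=> e d He1 L1 L2; have := He1 (D, h) (Rmax_lub_lt _ _ _ L1 L2).
  rewrite Eadd /= Hz // G00 Hl /= Hm => A; apply: Rle_trans A.
  by apply: Req_le; rewrite -Cmod_opp; congr Cmod; ring.
have S1 := step _ _ H1 G7 G3; have S2 := step _ _ H2 G8 G4.
have N0 := nnorm_ge0 _ h; have D0 := Cmod_ge_0 D.
have LD : Cmod D <= K' * nnorm h.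
  have A := Cmod_le_add_sub (Cmult m D) (Copp (l2 h)).
  rewrite Cmod_opp Cmod_mult (_ : Cminus (Cmult m D) (Copp (l2 h)) = Cplus (Cmult m D) (l2 h)) in A; last by ring.
  have B := HlK h.
  case: (Rle_lt_dec (Cmod D) (nnorm h)) => L; first by nra.
  rewrite Rmax_left in S1; last lra.
  apply: (Rmult_le_reg_l (Cmod m)) => //.
  have -> : Cmod m * (K' * nnorm h) = 2 * K * nnorm h + Cmod m * nnorm h by rewrite /K'; field; lra.
  by have := Rmult_le_pos _ _ (Rlt_le _ _ Hm0) N0; lra.
have -> : Cminus D (Cmult (Copp (Cinv m)) (l2 h)) = Cmult (Cinv m) (Cplus (Cmult m D) (l2 h)) by field; exact: Hmn.
rewrite Cmod_mult Cmod_inv //.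
have MX : Rmax (Cmod D) (nnorm h) <= K' * nnorm h by apply: Rmax_lub => //; nra.
apply: (Rmult_le_reg_l (Cmod m)) => //.
rewrite -Rmult_assoc Rinv_r ?Rmult_1_l; last lra.
apply: Rle_trans S2 _; apply: Rle_trans (Rmult_le_compat_l _ _ _ (Rlt_le _ _ He') MX) _.
by apply: Req_le; field; lra.
Qed.

(** * Compactness of the circle, powers near 1 and roots of unity *)

Lemma cis_period_nat t m : cis (t + 2 * INR m * PI) = cis t.
Proof. by rewrite /cis cos_period sin_period. Qed.

Lemma cis_reduce t : exists t', 0 <= t' <= 2 * PI /\ cis t = cis t'.
Proof.
have HPI := PI_RGT_0; have HP : 0 < 2 * PI by lra.
set k := Int_part (t / (2 * PI)).
have [B1 B2] := base_Int_part (t / (2 * PI)); rewrite -/k in B1 B2.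
have Ht : t = t / (2 * PI) * (2 * PI) by field; lra.
exists (t - IZR k * (2 * PI)); split.
  by rewrite {1 2}Ht; split; nra.
(* Periodicity is available for natural multiples only, so a negative number of turns is added on
   the other side. *)
case: (Z.le_gt_cases 0 k) => Hk.
  have -> : IZR k = INR (Z.to_nat k) by rewrite INR_IZR_INZ Z2Nat.id.
  by rewrite -(cis_period_nat (t - _) (Z.to_nat k)); congr cis; ring.
have -> : IZR k = - INR (Z.to_nat (- k)) by rewrite INR_IZR_INZ Z2Nat.id ?opp_IZR; [lra | lia].
by rewrite -(cis_period_nat t (Z.to_nat (- k))); congr cis; ring.
Qed.

(** Continuity at each point [(z, 0)] gives a radius that depends on the angle; compactness of
    [[0, 2 pi]] extracts a common one, and other angles are reduced modulo [2 pi]. *)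
Lemma uniform_on_circle (n : nat) (f : C -> Cn n -> C) r eps :
  0 < r -> 0 < eps ->
  (forall z, Cmod z = r -> cont_at (E := Nprod NC (NCn n)) (fun y => f y.1 y.2) (z, Cn_zero)) ->
  (forall z, Cmod z = r -> f z Cn_zero = RtoC 0) ->
  exists delta, 0 < delta /\ forall t u, Cn_norm u < delta -> Cmod (f (Cmult (RtoC r) (cis t)) u) <= eps.
Proof.
move=> Hr He Hc H0.
have cm t : Cmod (Cmult (RtoC r) (cis t)) = r.
  by rewrite Cmod_mult Cmod_cis Cmod_RtoC Rabs_pos_eq; lra.
have loc : forall t, exists d : posreal, forall t' u, Rabs (t' - t) < d -> Cn_norm u < d ->
    Cmod (f (Cmult (RtoC r) (cis t')) u) <= eps.
  move=> t; have [d1 [Hd1 H1]] := Hc _ (cm t) eps He.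
  have [d2 [Hd2 H2]] := FD_cont _ _ _ _ (FD_scal NR (RtoC r) _ _ _ (FD_cis t)) d1 Hd1.
  exists (mkposreal _ (Rmin_pos _ _ Hd1 Hd2)) => t' u /= Ht' Hu.
  have [A1 A2] := Rmin_Rgt_l _ _ _ Ht'; have [A3 A4] := Rmin_Rgt_l _ _ _ Hu.
  have := H2 (t' - t) A2; rewrite /= (_ : t + (t' - t) = t'); last by ring.
  move=> B; have := H1 (Cminus (Cmult (RtoC r) (cis t')) (Cmult (RtoC r) (cis t)), u) (Rmax_lub_lt _ _ _ B A3).
  rewrite /= Cn_zero_add H0 //.
  rewrite !(_ : forall a b, Cplus a (Cminus b a) = b); last by move=> a b; ring.
  by rewrite !(_ : forall a, Cminus a (RtoC 0) = a); [lra | move=> a; ring].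
pose dl t := proj1_sig (constructive_indefinite_description _ (loc t)).
have Hdl : forall t t' u, Rabs (t' - t) < dl t -> Cn_norm u < dl t -> Cmod (f (Cmult (RtoC r) (cis t')) u) <= eps.
  by move=> t; exact: (proj2_sig (constructive_indefinite_description _ (loc t))).
have [d Hd] := compactness_value_1d 0 (2 * PI) dl.
exists d; split; first exact: cond_pos.
move=> t u Hu; have [t' [Ht' ->]] := cis_reduce t.
(* The compactness statement yields its nearby centre [v] under a double negation. *)
apply: NNPP => Hn; apply: (Hd t' Ht') => [[v [_ [V1 V2]]]]; apply: Hn.
by apply: (Hdl v) => //; lra.
Qed.

(** The function [(1 + s)^(k+1) - (k+1) s] has zero derivative at 0, so its Lipschitz constant on
    [|s| <= eta] is of order [eta]. The induction proves this algebraically, factoring [s - s'] out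
    of the difference at the next exponent. *)
Lemma pow_near_identity k : exists K, 0 < K /\ forall eta s s', 0 <= eta <= 1 ->
  Cmod s <= eta -> Cmod s' <= eta ->
  Cmod (Cminus (Cminus (Cpow (Cplus (RtoC 1) s) k.+1) (Cmult (RtoC (INR k.+1)) s))
               (Cminus (Cpow (Cplus (RtoC 1) s') k.+1) (Cmult (RtoC (INR k.+1)) s')))
    <= K * eta * Cmod (Cminus s s').
Proof.
elim: k => [|k [K [HK IH]]].
  exists 1; split; first lra.
  move=> eta s s' He Hs Hs'; rewrite (_ : Cminus _ _ = RtoC 0); last by rewrite /=; ring.
  by rewrite Cmod_0; apply: Rmult_le_pos; [lra | apply: Cmod_ge_0].
have Hk : 0 <= INR k.+1 by apply: pos_INR.
exists (2 * INR k.+1 + 3 * K); split; first lra.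
move=> eta s s' He Hs Hs'.
have I1 := IH eta s s' He Hs Hs'.
(* Comparison with 0 bounds [(1 + s')^(k+1) - 1 - (k+1) s'], the coefficient of [s - s'] in the last
   term of the identity below. *)
have I2 := IH eta s' (RtoC 0) He Hs' ltac:(by rewrite Cmod_0; lra).
set D1 := Cminus (Cminus _ _) _ in I1; set D2 := Cminus (Cminus _ _) _ in I2.
rewrite (_ : Cminus s' (RtoC 0) = s') in I2; last by ring.
rewrite (S_INR k.+1) RtoC_plus.
have E0 : Cpow (Cplus (RtoC 1) (RtoC 0)) k.+1 = RtoC 1.
  by rewrite (_ : Cplus (RtoC 1) (RtoC 0) = RtoC 1) ?Cpow_1_l //; ring.
have -> : Cminus (Cminus (Cpow (Cplus (RtoC 1) s) k.+2) (Cmult (Cplus (RtoC (INR k.+1)) (RtoC 1)) s))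
   (Cminus (Cpow (Cplus (RtoC 1) s') k.+2) (Cmult (Cplus (RtoC (INR k.+1)) (RtoC 1)) s')) =
   Cplus (Cmult (RtoC (INR k.+1)) (Cmult (Cplus s s') (Cminus s s')))
     (Cplus (Cmult (Cplus (RtoC 1) s) D1) (Cmult D2 (Cminus s s'))).
  rewrite /D1 /D2 E0 !(Cpow_S _ k.+1); ring.
have N := Cmod_ge_0 (Cminus s s').
apply: Rle_trans (Cmod_triangle _ _) _.
have B1 : Cmod (Cmult (RtoC (INR k.+1)) (Cmult (Cplus s s') (Cminus s s'))) <= INR k.+1 * (2 * eta * Cmod (Cminus s s')).
  apply: Cmod_mult_le; first by rewrite Cmod_RtoC Rabs_pos_eq; lra.
  by apply: Cmod_mult_le; last lra; have := Cmod_triangle s s'; lra.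
have B2 : Cmod (Cmult (Cplus (RtoC 1) s) D1) <= 2 * (K * eta * Cmod (Cminus s s')).
  by apply: Cmod_mult_le => //; have := Cmod_triangle (RtoC 1) s; rewrite Cmod_1; lra.
have B3 : Cmod (Cmult D2 (Cminus s s')) <= K * eta * Cmod (Cminus s s').
  apply: Cmod_mult_le; last lra.
  apply: Rle_trans I2 _; have KE : 0 <= K * eta by apply: Rmult_le_pos; lra.
  by nra.
have := Cmod_triangle (Cmult (Cplus (RtoC 1) s) D1) (Cmult D2 (Cminus s s')).
lra.
Qed.

Lemma Cpow_cis t m : Cpow (cis t) m = cis (INR m * t).
Proof.
elim: m => [|m IH]; first by rewrite /cis /= Rmult_0_l cos_0 sin_0.
rewrite Cpow_S IH S_INR.
have -> : (INR m + 1) * t = t + INR m * t by ring.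
by rewrite /cis cos_plus sin_plus; apply: injective_projections => /=; ring.
Qed.

Lemma root_unity_cis k j : root_unity k j = cis (2 * PI * INR j / INR k.+1).
Proof. by []. Qed.

Lemma root_unity_pow k j : Cpow (root_unity k j) k.+1 = RtoC 1.
Proof.
have Hk : INR k.+1 <> 0 by apply: not_0_INR.
rewrite root_unity_cis Cpow_cis.
have -> : INR k.+1 * (2 * PI * INR j / INR k.+1) = 0 + 2 * INR j * PI by field.
by rewrite cis_period_nat /cis cos_0 sin_0.
Qed.

(** * Straightening the forms *)

Lemma nlin_Nprod_NCn n l : nlin (n := Nprod NC (NCn n)) l ->
  exists a c, forall w h, l (w, h) = Cplus (Cmult a w) (Cn_lin c h).
Proof.
move=> [l1 [l2 [[a Ha] [[c Hc] H]]]]; exists a, c => w h; by rewrite H /= Ha Hc.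
Qed.

Lemma holo2_FD n (D : C -> Prop) (U : Cn n -> Prop) (f : C -> Cn n -> C) :
  holo2 D U f <-> forall z u, D z -> U u ->
    exists l, FD (E := Nprod NC (NCn n)) (fun y => f y.1 y.2) (z, u) l.
Proof.
have E : forall f' f0 a b : C, Cminus (Cminus (Cminus f' f0) a) b = Cminus (Cminus f' f0) (Cplus a b).
  by move=> *; ring.
split=> H z u Hz Hu.
  have [a [c Hac]] := H z u Hz Hu.
  exists (fun h => Cplus (Cmult a h.1) (Cn_lin c h.2)); split.
    exists (fun w => Cmult a w), (fun h => Cn_lin c h).
    by split; [exists a | split; [exists c |]].
  move=> eps He; have [d [Hd H1]] := Hac eps He; exists d; split=> // [[w h]] Hh.
  have := H1 w h (Rle_lt_trans _ _ _ (Rmax_l _ _) Hh) (Rle_lt_trans _ _ _ (Rmax_r _ _) Hh).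
  by rewrite E.
have [l [Hl HF]] := H z u Hz Hu; have [a [c Hac]] := nlin_Nprod_NCn n l Hl.
exists a, c => eps He; have [d [Hd H1]] := HF eps He; exists d; split=> // w h Hw Hh.
have := H1 (w, h) (Rmax_lub_lt _ _ _ Hw Hh); rewrite Hac E; exact.
Qed.

Lemma holoN_FD n (U : Cn n -> Prop) (f : Cn n -> C) : holoN U f -> forall u, U u ->
  exists l, FD (E := NCn n) f u l.
Proof.
move=> H u Hu; have [c Hc] := H u Hu.
by exists (fun h => Cn_lin c h); split; first by exists c.
Qed.

(** The integral of [(1 + t)^k] from 0 to [s]. Multiplied by [z^(k+1)], it is the increment of
    [w^(k+1) / (k+1)] from [theta z] to [theta z (1 + s)]; the division makes its derivative at 0
    equal to 1. *)
Definition powmean (k : nat) (s : C) : C :=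
  Cmult (Cinv (RtoC (INR k.+1))) (Cminus (Cpow (Cplus (RtoC 1) s) k.+1) (RtoC 1)).

Lemma INRS_neq0 k : RtoC (INR k.+1) <> RtoC 0.
Proof. by apply: RtoC_neq0; apply: not_0_INR. Qed.

Lemma powmeanE k s :
  Cmult (RtoC (INR k.+1)) (powmean k s) = Cminus (Cpow (Cplus (RtoC 1) s) k.+1) (RtoC 1).
Proof. by rewrite /powmean; field; apply: INRS_neq0. Qed.

Lemma powmean0 k : powmean k (RtoC 0) = RtoC 0.
Proof.
rewrite /powmean (_ : Cplus (RtoC 1) (RtoC 0) = RtoC 1) ?Cpow_1_l; ring.
Qed.

Lemma CD_powmean k s : CD (powmean k) s (Cpow (Cplus (RtoC 1) s) k).
Proof.
have D1 : CD (fun s => Cplus (RtoC 1) s) s (RtoC 1).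
  by apply: FD_ext_lin (FD_plus _ _ _ _ _ _ (FD_const NC (RtoC 1) s) (CD_id s)) => h /=; ring.
have D2 := FD_comp1 NC (fun w => Cpow w k.+1) _ s _ _ (CD_pow k.+1 (Cplus (RtoC 1) s)) D1.
have D3 := FD_scal _ (Cinv (RtoC (INR k.+1))) _ _ _ (FD_minus _ _ _ _ _ _ D2 (FD_const NC (RtoC 1) s)).
apply: FD_ext_lin D3 => h; rewrite -[k.+1.-1]/k; field; exact: INRS_neq0.
Qed.

Definition log1p (s : C) : C := Copp (clog (Copp s)).

Lemma log1p0 : log1p (RtoC 0) = RtoC 0.
Proof. by rewrite /log1p (_ : Copp (RtoC 0) = RtoC 0) ?clog0; ring. Qed.

Lemma CD_log1p s : Cmod s < 1 -> CD log1p s (Cinv (Cplus (RtoC 1) s)).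
Proof.
move=> Hs; have D1 := FD_opp _ _ _ _ (CD_id s).
have D2 := FD_comp1 NC clog _ s _ _ (CD_clog (Copp s) ltac:(by rewrite Cmod_opp)) D1.
apply: FD_ext_lin (FD_opp _ _ _ _ D2) => h /=.
have -> : Cminus (RtoC 1) (Copp s) = Cplus (RtoC 1) s by ring.
ring.
Qed.

(** * The integrated pullback equation and its small solution *)

Section Straighten.

Variables (n k : nat) (R1 R2 R0 r rr eta eps delta : R).
Variables (alpha : C -> Cn n -> C) (theta p : C) (s0 : Cn n -> C).

Notation X := (Nprod NC (NCn n)).
Notation B := (potential n r alpha).

(** The constant of [potential_lip] on the disc of radius [rr], with the bound on [alpha] factored
    out. *)
Let Klip := 4 * / ((1 - rr / r) * (1 - rr / r)) * / r.

Hypothesis HR1 : 0 < R1.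
Hypothesis HR12 : R1 < R2.
Hypothesis Hrr : rr < r.
Hypothesis HrR0 : r < R0.
Hypothesis Heta : 0 < eta <= / 2.
Hypothesis Hrr_eta : R2 * (1 + eta) <= rr.
Hypothesis Hpow : forall s s', Cmod s <= eta -> Cmod s' <= eta ->
  Cmod (Cminus (Cminus (powmean k s) s) (Cminus (powmean k s') s')) <= / 4 * Cmod (Cminus s s').
Hypothesis Heps : eps * (8 + Klip * R2) <= R1 ^ k.+1 * eta / 16.
Hypothesis Halpha : forall z u, Cmod z < R0 -> Cn_norm u < delta ->
  exists l, FD (E := X) (fun y => alpha y.1 y.2) (z, u) l.
Hypothesis HM : forall t u, Cn_norm u < delta -> Cmod (alpha (Cmult (RtoC r) (cis t)) u) <= eps.
Hypothesis HM0 : forall u, Cn_norm u < delta -> Cmod (alpha (RtoC 0) u) <= eps.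
Hypothesis Hdelta : 0 < delta.
Hypothesis Htheta : Cmod theta = 1.
Hypothesis Htheta_pow : Cpow theta k.+1 = RtoC 1.
Hypothesis Hp : annulus R1 R2 p.
Hypothesis Hs0 : forall u, Cn_norm u < delta -> Cmod (s0 u) <= R1 ^ k.+1 * eta / (16 * R2 ^ k.+1).
Hypothesis FD_s0 : forall u, Cn_norm u < delta -> exists l, FD (E := NCn n) s0 u l.

Let r_pos : 0 < r.
Proof. by have := Rmult_lt_0_compat R2 (1 + eta); lra. Qed.

Let R1k : 0 < R1 ^ k.+1.
Proof. exact: pow_lt. Qed.

Let R2k : 0 < R2 ^ k.+1.
Proof. by apply: pow_lt; lra. Qed.

Let R12k : R1 ^ k.+1 <= R2 ^ k.+1.
Proof. by apply: pow_incr; lra. Qed.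

Let eps_ge0 : 0 <= eps.
Proof.
have H0 : Cn_norm (@Cn_zero n) < delta by rewrite Cn_norm_zero.
exact: Rle_trans (Cmod_ge_0 _) (HM0 _ H0).
Qed.

Let Klip_ge0 : 0 <= Klip.
Proof.
have Hir : 0 < / r by apply: Rinv_0_lt_compat.
have H1 : 0 < 1 - rr / r.
  by rewrite (_ : 1 - rr / r = (r - rr) * / r); [apply: Rmult_lt_0_compat; lra | field; lra].
apply: Rmult_le_pos; last lra.
by apply: Rmult_le_pos; [lra | apply: Rlt_le; apply: Rinv_0_lt_compat; apply: Rmult_lt_0_compat].
Qed.

Let pt (z s : C) := Cmult (Cmult theta z) (Cplus (RtoC 1) s).

Let pt_mod z s : annulus R1 R2 z -> Cmod s <= eta -> Cmod (pt z s) <= rr.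
Proof.
move=> [_ Hz] Hs; rewrite /pt !Cmod_mult Htheta Rmult_1_l.
apply: Rle_trans Hrr_eta; apply: Rmult_le_compat; try exact: Cmod_ge_0; first lra.
by have := Cmod_triangle (RtoC 1) s; rewrite Cmod_1; lra.
Qed.

Let zk_mod z : annulus R1 R2 z -> R1 ^ k.+1 <= Cmod (Cpow z k.+1) <= R2 ^ k.+1.
Proof. by move=> [H1 H2]; rewrite Cmod_pow; split; apply: pow_incr; lra. Qed.

Let H (s z : C) (u : Cn n) : C :=
  Cplus (Cplus (Cmult (Cpow z k.+1) (powmean k s)) (Cmult (alpha (RtoC 0) u) (log1p s)))
        (B (pt z s) u).

(** Half of the leading coefficient is the error budget. [powmean] takes a quarter by [Hpow]; the
    logarithm and the potential share the other quarter, which [Heps] grants since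
    [R1 ^ k.+1 * eta / 16] is below [|z^(k+1)| / 4]. The 8 in [Heps] is the Lipschitz constant of
    [log1p] for [|s| <= 1/2]. *)
Let H_close s s' z u : annulus R1 R2 z -> Cn_norm u < delta -> Cmod s <= eta -> Cmod s' <= eta ->
  Cmod (Cminus (Cminus (H s z u) (H s' z u)) (Cmult (Cpow z k.+1) (Cminus s s'))) <=
    Cmod (Cpow z k.+1) / 2 * Cmod (Cminus s s').
Proof.
move=> Hz Hu Hs Hs'.
have [Z1 Z2] := zk_mod z Hz.
have N := Cmod_ge_0 (Cminus s s').
have -> : Cminus (Cminus (H s z u) (H s' z u)) (Cmult (Cpow z k.+1) (Cminus s s')) =
  Cplus (Cplus (Cmult (Cpow z k.+1) (Cminus (Cminus (powmean k s) s) (Cminus (powmean k s') s')))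
     (Cmult (alpha (RtoC 0) u) (Cminus (log1p s) (log1p s')))) (Cminus (B (pt z s) u) (B (pt z s') u)).
  by rewrite /H; ring.
have B1 : Cmod (Cmult (Cpow z k.+1) (Cminus (Cminus (powmean k s) s) (Cminus (powmean k s') s'))) <=
   Cmod (Cpow z k.+1) * (/ 4 * Cmod (Cminus s s')) by apply: Cmod_mult_le; [lra | exact: Hpow].
have B2 : Cmod (Cmult (alpha (RtoC 0) u) (Cminus (log1p s) (log1p s'))) <= eps * (8 * Cmod (Cminus s s')).
  apply: Cmod_mult_le; first exact: HM0.
  have := clog_lip (/ 2) (Copp s) (Copp s') ltac:(rewrite Cmod_opp; lra) ltac:(rewrite Cmod_opp; lra) ltac:(lra).
  have -> : Cminus (clog (Copp s')) (clog (Copp s)) = Cminus (log1p s) (log1p s') by rewrite /log1p; ring.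
  have -> : Cminus (Copp s') (Copp s) = Cminus s s' by ring.
  move=> A; apply: Rle_trans A _; apply: Req_le; field.
have B3 : Cmod (Cminus (B (pt z s) u) (B (pt z s') u)) <= eps * Klip * (R2 * Cmod (Cminus s s')).
  have A := potential_lip n R0 r delta eps alpha r_pos HrR0 Halpha HM (pt z s') (pt z s) u rr Hrr
    (pt_mod z s' Hz Hs') (pt_mod z s Hz Hs) Hu.
  apply: Rle_trans A _; apply: Rmult_le_compat_l; first exact: Rmult_le_pos.
  have -> : Cminus (pt z s) (pt z s') = Cmult (Cmult theta z) (Cminus s s') by rewrite /pt; ring.
  apply: Cmod_mult_le; last lra.
  by rewrite Cmod_mult Htheta; case: Hz; lra.
have B4 : eps * (8 + Klip * R2) * Cmod (Cminus s s') <= Cmod (Cpow z k.+1) / 4 * Cmod (Cminus s s').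
  apply: Rmult_le_compat_r => //; nra.
have T1 := Cmod_triangle (Cplus (Cmult (Cpow z k.+1) (Cminus (Cminus (powmean k s) s) (Cminus (powmean k s') s')))
     (Cmult (alpha (RtoC 0) u) (Cminus (log1p s) (log1p s')))) (Cminus (B (pt z s) u) (B (pt z s') u)).
have T2 := Cmod_triangle (Cmult (Cpow z k.+1) (Cminus (Cminus (powmean k s) s) (Cminus (powmean k s') s')))
     (Cmult (alpha (RtoC 0) u) (Cminus (log1p s) (log1p s'))).
lra.
Qed.

(** The perturbation consumes at most half of the slope [z^(k+1)]. From the remaining half come the
    uniqueness of [s], its continuity and the lower bound required by [FD_implicit]. *)
Let H_low s s' z u : annulus R1 R2 z -> Cn_norm u < delta -> Cmod s <= eta -> Cmod s' <= eta ->
  R1 ^ k.+1 / 2 * Cmod (Cminus s s') <= Cmod (Cminus (H s z u) (H s' z u)).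
Proof.
move=> Hz Hu Hs Hs'; have A := H_close s s' z u Hz Hu Hs Hs'.
have [Z1 Z2] := zk_mod z Hz; have N := Cmod_ge_0 (Cminus s s').
have := Cmod_le_add_sub (Cmult (Cpow z k.+1) (Cminus s s')) (Cminus (H s z u) (H s' z u)).
rewrite (Cmod_sub_sym (Cmult _ _)) Cmod_mult.
by have := Rmult_le_compat_r _ _ _ N Z1; lra.
Qed.

(** The constant of integration is read off at [p], where the desired solution [s0 u] is
    prescribed. *)
Let cc (u : Cn n) := H (s0 u) p u.

Let G (s : C) (x : X) := Cminus (H s x.1 x.2) (cc x.2).

Let GE s z u : G s (z, u) = Cminus (H s z u) (cc u).
Proof. by []. Qed.

Let s0_small u : Cn_norm u < delta -> Cmod (s0 u) <= eta / 2.
Proof.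
move=> Hu; apply: Rle_trans (Hs0 u Hu) _.
apply: (Rmult_le_reg_r (16 * R2 ^ k.+1)); first lra.
have -> : R1 ^ k.+1 * eta / (16 * R2 ^ k.+1) * (16 * R2 ^ k.+1) = R1 ^ k.+1 * eta by field; lra.
nra.
Qed.

(** At [s = 0] only the potential remains. It vanishes at the centre, so its Lipschitz bound over a
    distance of at most [R2] controls it. *)
Let H0_bound z u : annulus R1 R2 z -> Cn_norm u < delta -> Cmod (H (RtoC 0) z u) <= R1 ^ k.+1 * eta / 16.
Proof.
move=> Hz Hu.
have Z0 : Cmod (RtoC 0) <= eta by rewrite Cmod_0; lra.
have P0 := pt_mod z _ Hz Z0.
have -> : H (RtoC 0) z u = Cminus (B (pt z (RtoC 0)) u) (B (RtoC 0) u).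
  rewrite /H powmean0 log1p0 (potential0 n R0 r delta alpha r_pos HrR0 Halpha u Hu); ring.
have A := potential_lip n R0 r delta eps alpha r_pos HrR0 Halpha HM (RtoC 0) (pt z (RtoC 0)) u rr Hrr
    ltac:(rewrite Cmod_0; have := Rmult_lt_0_compat R2 (1 + eta); lra) P0 Hu.
apply: Rle_trans A _; apply: Rle_trans Heps.
have B2 : Cmod (Cminus (pt z (RtoC 0)) (RtoC 0)) <= R2.
  rewrite /pt (_ : Cminus _ _ = Cmult theta z); last by ring.
  by rewrite Cmod_mult Htheta; case: Hz; lra.
have KE : 0 <= eps * Klip by apply: Rmult_le_pos.
apply: Rle_trans (Rmult_le_compat_l _ _ _ KE B2) _; nra.
Qed.

(** The fraction is [1/16 + 3/32]: the first is [H0_bound] at [p], the second comes from moving to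
    [s0 u], where [H] varies by at most [3/2] of [|p^(k+1)| |s0 u|], itself at most [1/16] of
    [R1 ^ k.+1 * eta]. *)
Let cc_bound u : Cn_norm u < delta -> Cmod (cc u) <= R1 ^ k.+1 * eta * (5 / 32).
Proof.
move=> Hu; have S := s0_small u Hu.
have Z0 : Cmod (RtoC 0) <= eta by rewrite Cmod_0; lra.
have A := H_close (s0 u) (RtoC 0) p u Hp Hu ltac:(lra) Z0.
have B0 := H0_bound p u Hp Hu; have [Z1 Z2] := zk_mod p Hp.
rewrite (_ : Cminus (s0 u) (RtoC 0) = s0 u) in A; last by ring.
have T1 := Cmod_le_add_sub (Cminus (H (s0 u) p u) (H (RtoC 0) p u)) (Cmult (Cpow p k.+1) (s0 u)).
have T2 := Cmod_le_add_sub (H (s0 u) p u) (H (RtoC 0) p u).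
rewrite Cmod_mult in T1.
have S1 : Cmod (Cpow p k.+1) * Cmod (s0 u) <= R1 ^ k.+1 * eta / 16.
  apply: Rle_trans (Rmult_le_compat _ _ _ _ (Cmod_ge_0 _) (Cmod_ge_0 _) Z2 (Hs0 u Hu)) _.
  by apply: Req_le; field; lra.
rewrite /cc; lra.
Qed.

(** A Newton iteration with the slope frozen at [z^(k+1)]: [H_close] makes it a contraction by one
    half. At 0 it moves by at most [1/16 + 5/32 = 7/32] of [eta], within the [eta / 4] allowed for
    the disc of radius [eta / 2]. *)
Let solvable z u : annulus R1 R2 z -> Cn_norm u < delta ->
  exists s, Cmod s <= eta / 2 /\ G s (z, u) = RtoC 0.
Proof.
move=> Hz Hu; have [Z1 Z2] := zk_mod z Hz.
have Zn : Cpow z k.+1 <> RtoC 0 by apply: (Cmod_pos_neq0 _ _ R1k Z1).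
have ZP : 0 < Cmod (Cpow z k.+1) by lra.
pose T s := Cminus s (Cmult (Cinv (Cpow z k.+1)) (G s (z, u))).
have [s [Hs Es]] : exists s, Cmod s <= eta / 2 /\ T s = s.
  apply: contraction_fixpoint; first lra.
    move=> s s' Hs Hs'.
    have -> : Cminus (T s) (T s') = Copp (Cmult (Cinv (Cpow z k.+1))
       (Cminus (Cminus (H s z u) (H s' z u)) (Cmult (Cpow z k.+1) (Cminus s s')))).
      by rewrite /T !GE; field; exact: Zn.
    rewrite Cmod_opp Cmod_mult Cmod_inv //.
    apply: (Rmult_le_reg_l (Cmod (Cpow z k.+1))) => //.
    rewrite -Rmult_assoc Rinv_r ?Rmult_1_l; last lra.
    apply: Rle_trans (H_close s s' z u Hz Hu ltac:(lra) ltac:(lra)) _; apply: Req_le; field.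
  have -> : T (RtoC 0) = Copp (Cmult (Cinv (Cpow z k.+1)) (Cminus (H (RtoC 0) z u) (cc u))).
    by rewrite /T /G /=; ring.
  rewrite Cmod_opp Cmod_mult Cmod_inv //.
  apply: (Rmult_le_reg_l (Cmod (Cpow z k.+1))) => //.
  rewrite -Rmult_assoc Rinv_r ?Rmult_1_l; last lra.
  apply: Rle_trans (Cmod_sub_le _ _) _.
  have := H0_bound z u Hz Hu; have := cc_bound u Hu.
  have := Rmult_le_compat_r eta _ _ ltac:(lra) Z1.
  have := Rmult_lt_0_compat _ _ R1k (proj1 Heta).
  lra.
exists s; split=> //.
have -> : G s (z, u) = Cmult (Cpow z k.+1) (Cminus s (T s)).
  by rewrite /T; field; exact: Zn.
by rewrite Es; ring.
Qed.

Let unique s s' z u : annulus R1 R2 z -> Cn_norm u < delta -> Cmod s <= eta -> Cmod s' <= eta ->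
  G s (z, u) = RtoC 0 -> G s' (z, u) = RtoC 0 -> s = s'.
Proof.
move=> Hz Hu Hs Hs' E E'.
have L := H_low s s' z u Hz Hu Hs Hs'.
have E0 : Cminus (H s z u) (H s' z u) = RtoC 0.
  have -> : Cminus (H s z u) (H s' z u) = Cminus (G s (z, u)) (G s' (z, u)) by rewrite /G /=; ring.
  by rewrite E E'; ring.
rewrite E0 Cmod_0 in L.
have N := Cmod_ge_0 (Cminus s s').
have E1 : Cmod (Cminus s s') = 0 by nra.
have -> : s = Cplus (Cminus s s') s' by ring.
by rewrite (Cmod_eq_0 _ E1); ring.
Qed.

Let sf (z : C) (u : Cn n) : C :=
  epsilon (inhabits (RtoC 0)) (fun s => Cmod s <= eta / 2 /\ G s (z, u) = RtoC 0).

Let sf_spec z u : annulus R1 R2 z -> Cn_norm u < delta ->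
  Cmod (sf z u) <= eta / 2 /\ G (sf z u) (z, u) = RtoC 0.
Proof.
move=> Hz Hu; apply: (epsilon_spec (inhabits (RtoC 0)) (fun s => Cmod s <= eta / 2 /\ G s (z, u) = RtoC 0)).
exact: solvable.
Qed.

(** One formula serves three uses: [cc], with [Z] constant; [G], with all slots varying; and the
    pullback, with the parameter fixed, where [D] is zero and the terms in [lA] and [lB] disappear.
    The number [b] is the derivative of the potential in its first variable. *)
Let FD_H (E : nspace) (S Z : E -> C) (m D : E -> NCn n) (x : E) lS lZ :
  FD S x lS -> FD Z x lZ ->
  (forall h, m (nadd x h) = nadd (m x) (D h)) -> (forall h, nnorm (D h) <= nnorm h) ->
  (forall l, nlin l -> nlin (fun h => l (D h))) ->
  Cmod (S x) < 1 -> Cmod (pt (Z x) (S x)) < r -> Cn_norm (m x) < delta ->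
  exists lA b lB, nlin (n := NCn n) lA /\ nlin (n := NCn n) lB /\
    Cmult (pt (Z x) (S x)) b = Cminus (alpha (pt (Z x) (S x)) (m x)) (alpha (RtoC 0) (m x)) /\
    FD (fun y => H (S y) (Z y) (m y)) x (fun h =>
      Cplus (Cplus
        (Cplus (Cmult (Cmult (Cpow (Z x) k.+1) (Cpow (Cplus (RtoC 1) (S x)) k)) (lS h))
               (Cmult (Cmult (Cmult (RtoC (INR k.+1)) (powmean k (S x))) (Cpow (Z x) k)) (lZ h)))
        (Cplus (Cmult (Cmult (alpha (RtoC 0) (m x)) (Cinv (Cplus (RtoC 1) (S x)))) (lS h))
               (Cmult (log1p (S x)) (lA (D h)))))
        (Cplus (Cmult b (Cmult theta (Cplus (Cmult (Cplus (RtoC 1) (S x)) (lZ h)) (Cmult (Z x) (lS h)))))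
               (lB (D h)))).
Proof.
move=> FS FZ Hm HD HlD HS Hpt Hu.
have [la Hla] := Halpha (RtoC 0) (m x) ltac:(rewrite Cmod_0; lra) Hu.
have FA0 := FD_slice_r (NCn n) alpha _ _ _ Hla.
have FA := FD_proj E (NCn n) (fun v => alpha (RtoC 0) v) m D x _ Hm HD (HlD _ (proj1 FA0)) FA0.
have FP := FD_comp1 E (powmean k) S x _ _ (CD_powmean k (S x)) FS.
have FL := FD_comp1 E log1p S x _ _ (CD_log1p (S x) HS) FS.
have FZk := FD_comp1 E (fun w => Cpow w k.+1) Z x _ _ (CD_pow k.+1 (Z x)) FZ.
have Fpt := FD_mult E _ _ x _ _ (FD_scal E theta _ _ _ FZ)
   (FD_plus E _ _ _ _ _ (FD_const E (RtoC 1) x) FS).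
have [lb [Hlb Eb]] := FD_potential n R0 r delta eps alpha r_pos HrR0 Halpha HM _ _ Hpt Hu.
have FB := FD_comp_pair E (NCn n) B (fun y => pt (Z y) (S y)) m D x lb _ Hlb Fpt Hm HD HlD.
case: (Hlb) => [[l1 [l2 [[b Hb] [Hl2 Hll]]]] _].
have b1 : lb (RtoC 1, Cn_zero) = b.
  rewrite Hll /= Hb (nlin_at0 _ _ Hl2); ring.
exists (fun h => la (RtoC 0, h)), b, l2; split; first by case: FA0.
split=> //; split; first by rewrite -Eb b1.
have FF := FD_plus E _ _ _ _ _ (FD_plus E _ _ _ _ _ (FD_mult E _ _ _ _ _ FZk FP) (FD_mult E _ _ _ _ _ FA FL)) FB.
apply: FD_ext_lin FF => h; rewrite Hll /= Hb -/(Cpow (Z x) k); ring.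
Qed.

Let FD_cc u : Cn_norm u < delta -> exists l, FD (E := NCn n) cc u l.
Proof.
move=> Hu; have [lS FS] := FD_s0 u Hu; have S := s0_small u Hu.
have [lA [b [lB [_ [_ [_ F]]]]]] := FD_H (NCn n) s0 (fun _ => p) (fun v => v) (fun h => h) u _ _
  FS (FD_const (NCn n) p u) ltac:(by []) (fun h => Rle_refl _) ltac:(by []) ltac:(lra)
  ltac:(have := pt_mod p (s0 u) Hp ltac:(lra); lra) Hu.
by eexists; exact: F.
Qed.

Let FD_G s z u : annulus R1 R2 z -> Cn_norm u < delta -> Cmod s <= eta ->
  exists l, FD (E := Nprod NC X) (fun y => G y.1 y.2) (s, (z, u)) l.
Proof.
move=> Hz Hu Hs.
have F1 : FD (E := Nprod NC X) (fun y => y.1) (s, (z, u)) (fun h => Cmult (RtoC 1) h.1).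
  exact: (FD_fst NC X (fun w => w) (s, (z, u)) _ (CD_id s)).
have F2 : FD (E := Nprod NC X) (fun y => y.2.1) (s, (z, u)) (fun h => Cmult (RtoC 1) h.2.1).
  exact: (FD_snd NC X (fun x => x.1) (s, (z, u)) _ (FD_fst NC (NCn n) (fun w => w) (z, u) _ (CD_id z))).
have [lA [b [lB [_ [_ [_ F]]]]]] := FD_H (Nprod NC X) (fun y => y.1) (fun y => y.2.1) (fun y => y.2.2)
  (fun h => h.2.2) (s, (z, u)) _ _ F1 F2 ltac:(by [])
  (fun h => Rle_trans _ _ _ (Rmax_r _ _) (Rmax_r _ _))
  (fun l Hl => nlin_snd NC X _ (nlin_snd NC (NCn n) l Hl)) ltac:(rewrite /=; lra)
  ltac:(have := pt_mod z s Hz Hs; rewrite /=; lra) Hu.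
have [lc Fc] := FD_cc u Hu.
have F3 := FD_snd NC X _ (s, (z, u)) _ (FD_snd NC (NCn n) cc (z, u) _ Fc).
by eexists; exact: (FD_minus _ _ _ _ _ _ F F3).
Qed.

Let annulus_near z : annulus R1 R2 z -> exists d, 0 < d /\ forall w, Cmod w < d -> annulus R1 R2 (Cplus z w).
Proof.
move=> [H1 H2]; exists (Rmin (Cmod z - R1) (R2 - Cmod z)); split; first by apply: Rmin_pos; lra.
move=> w Hw; have [G1 G2] := Rmin_Rgt_l _ _ _ Hw; split; last by have := Cmod_triangle z w; lra.
have := Cmod_le_add_sub z (Cplus z w).
by rewrite (_ : Cminus z (Cplus z w) = Copp w) ?Cmod_opp; [lra | ring].
Qed.

Let domain_near (x : X) : annulus R1 R2 x.1 -> Cn_norm x.2 < delta -> exists d, 0 < d /\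
  forall h : X, nnorm h < d -> annulus R1 R2 (nadd x h).1 /\ Cn_norm (nadd x h).2 < delta.
Proof.
move=> Hz Hu; have [d [Hd H1]] := annulus_near _ Hz.
exists (Rmin d (delta - Cn_norm x.2)); split; first by apply: Rmin_pos; lra.
move=> h Hh; have [G1 G2] := Rmin_Rgt_l _ _ _ Hh.
have A1 : Cmod h.1 <= nnorm h := Rmax_l _ _.
have A2 : Cn_norm h.2 <= nnorm h := Rmax_r _ _.
split; first by apply: H1; lra.
by apply: Rle_lt_trans (Cn_norm_add n x.2 h.2) _; lra.
Qed.

(** Keep the old value [sf z u] at a nearby point: by continuity of [G] the equation fails there
    only slightly, and [H_low] turns this residual into a bound on the change of the solution. *)
Let cont_sf z u : annulus R1 R2 z -> Cn_norm u < delta -> cont_at (E := X) (fun x => sf x.1 x.2) (z, u).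
Proof.
move=> Hz Hu e He; have [S1 S2] := sf_spec z u Hz Hu.
have [l Hl] := FD_G (sf z u) z u Hz Hu ltac:(lra).
have He' : 0 < R1 ^ k.+1 / 2 * e by apply: Rmult_lt_0_compat; lra.
have [d1 [Hd1 H1]] := FD_cont _ _ _ _ (FD_slice_r X G _ _ _ Hl) _ He'.
have [d2 [Hd2 H2]] := domain_near (z, u) Hz Hu.
exists (Rmin d1 d2); split; first exact: Rmin_pos.
move=> h Hh; have [G1 G2] := Rmin_Rgt_l _ _ _ Hh.
have {}H1 := H1 h G1; have [N1 N2] := H2 h G2.
set x' := nadd _ h in H1 N1 N2 *.
have [T1 T2] := sf_spec x'.1 x'.2 N1 N2.
have L := H_low (sf x'.1 x'.2) (sf z u) x'.1 x'.2 N1 N2 ltac:(lra) ltac:(lra).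
have E1 : Cminus (H (sf x'.1 x'.2) x'.1 x'.2) (H (sf z u) x'.1 x'.2) = Copp (Cminus (G (sf z u) x') (G (sf z u) (z, u))).
  rewrite S2.
  have -> : Cminus (H (sf x'.1 x'.2) x'.1 x'.2) (H (sf z u) x'.1 x'.2) =
    Cminus (G (sf x'.1 x'.2) (x'.1, x'.2)) (G (sf z u) x') by rewrite /G /=; ring.
  by rewrite T2; ring.
rewrite E1 Cmod_opp in L.
apply: (Rmult_lt_reg_l (R1 ^ k.+1 / 2)); first lra.
exact: Rle_lt_trans L H1.
Qed.

Let FD_sf z u : annulus R1 R2 z -> Cn_norm u < delta ->
  exists l, FD (E := X) (fun x => sf x.1 x.2) (z, u) l.
Proof.
move=> Hz Hu; have [S1 S2] := sf_spec z u Hz Hu.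
have [l Hl] := FD_G (sf z u) z u Hz Hu ltac:(lra).
have [d2 [Hd2 H2]] := domain_near (z, u) Hz Hu.
apply: (FD_implicit X G (fun x => sf x.1 x.2) (z, u) l (R1 ^ k.+1 / 2) (Rmin d2 (eta / 2)) Hl (cont_sf z u Hz Hu)).
- by apply: Rmin_pos; lra.
- move=> h Hh; have [G1 G2] := Rmin_Rgt_l _ _ _ Hh; have [N1 N2] := H2 h G1.
  by have [_ T2] := sf_spec _ _ N1 N2.
- lra.
move=> t Ht; have [G1 G2] := Rmin_Rgt_l _ _ _ Ht.
have L := H_low (Cplus (sf z u) t) (sf z u) z u Hz Hu
   ltac:(have := Cmod_triangle (sf z u) t; lra) ltac:(lra).
rewrite (_ : Cminus (Cplus (sf z u) t) (sf z u) = t) in L; last by ring.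
apply: Rle_trans L _; apply: Req_le; congr Cmod; rewrite /G /=; ring.
Qed.

Definition straightening (z : C) (u : Cn n) : C := pt z (sf z u).

Lemma FD_straightening z u : annulus R1 R2 z -> Cn_norm u < delta ->
  exists l, FD (E := X) (fun x => straightening x.1 x.2) (z, u) l.
Proof.
move=> Hz Hu; have [l Hl] := FD_sf z u Hz Hu.
have F1 := FD_fst NC (NCn n) (fun w => w) (z, u) _ (CD_id z).
by eexists; exact: (FD_mult X _ _ _ _ _ (FD_scal X theta _ _ _ F1)
   (FD_plus X _ _ _ _ _ (FD_const X (RtoC 1) (z, u)) Hl)).
Qed.

Lemma straightening_mod z u : annulus R1 R2 z -> Cn_norm u < delta -> Cmod (straightening z u) < R0.
Proof.
move=> Hz Hu; have [S1 _] := sf_spec z u Hz Hu.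
by have := pt_mod z (sf z u) Hz ltac:(lra); rewrite /straightening; lra.
Qed.

Let one_plus_neq0 s : Cmod s <= eta -> Cplus (RtoC 1) s <> RtoC 0.
Proof.
move=> Hs; have -> : Cplus (RtoC 1) s = Cminus (RtoC 1) (Copp s) by ring.
by apply: one_minus_neq01; rewrite Cmod_opp; lra.
Qed.

Let theta_neq0 : theta <> RtoC 0.
Proof. by move=> E; move: Htheta; rewrite E Cmod_0; lra. Qed.

Let z_neq0 z : annulus R1 R2 z -> z <> RtoC 0.
Proof. by move=> [H1 _] E; move: H1; rewrite E Cmod_0; lra. Qed.

Lemma straightening_neq0 z u : annulus R1 R2 z -> Cn_norm u < delta -> straightening z u <> RtoC 0.
Proof.
move=> Hz Hu; have [S1 _] := sf_spec z u Hz Hu.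
apply: Cmult_neq_0; last by apply: one_plus_neq0; lra.
by apply: Cmult_neq_0; [exact: theta_neq0 | exact: z_neq0].
Qed.

(** The primitive equation is differentiated back: along the solution [H] is constant in [z], so the
    formula of [FD_H] gives a vanishing sum, and this sum is the difference of the two sides once
    [theta^(k+1) = 1] is used. *)
Lemma straightening_pullback z u : annulus R1 R2 z -> Cn_norm u < delta -> exists d,
  CD (fun w => straightening w u) z d /\
  Cmult (Cplus (Cpow (straightening z u) k) (Cdiv (alpha (straightening z u) u) (straightening z u))) d
    = Cplus (Cpow z k) (Cdiv (alpha (RtoC 0) u) z).
Proof.
move=> Hz Hu; have [S1 S2] := sf_spec z u Hz Hu.
have [l Hl] := FD_sf z u Hz Hu.
have DS := FD_slice_l (NCn n) sf z u l Hl.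
set ds := l _ in DS.
have Dphi := FD_mult NC _ _ _ _ _ (FD_scal NC theta _ _ _ (CD_id z))
   (FD_plus NC _ _ _ _ _ (FD_const NC (RtoC 1) z) DS).
exists (Cmult theta (Cplus (Cplus (RtoC 1) (sf z u)) (Cmult z ds))); split.
  by apply: FD_ext_lin Dphi => h /=; ring.
have [lA [b [lB [HlA [HlB [Eb F]]]]]] := FD_H NC (fun w => sf w u) (fun w => w) (fun _ => u) (fun _ => nzero) z _ _
  DS (CD_id z) (fun h => esym (naddx0 _ _)) (fun h => ltac:(rewrite nnorm0; exact: nnorm_ge0))
  (fun l Hl => ltac:(apply: (nlin_ext NC (fun _ => RtoC 0)); [by move=> h; rewrite (nlin_at0 _ _ Hl) | exact: nlin_zero]))
  ltac:(rewrite /=; lra) ltac:(have := pt_mod z (sf z u) Hz ltac:(lra); rewrite /=; lra) Hu.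
(* The equation holds on a neighbourhood of [z] with a right-hand side independent of [z]. *)
have D0 : CD (fun w => H (sf w u) w u) z (RtoC 0).
  have [d [Hd Hnear]] := annulus_near z Hz.
  apply: FD_ext_lin (FD_ext_near NC (fun _ => cc u) _ z _ d Hd _ (FD_const NC (cc u) z)).
    by move=> h /=; ring.
  move=> h Hh; have [_ T2] := sf_spec _ u (Hnear h Hh) Hu.
  have -> : H (sf (nadd (n := NC) z h) u) (nadd (n := NC) z h) u =
    Cplus (G (sf (nadd (n := NC) z h) u) (nadd (n := NC) z h, u)) (cc u) by rewrite /G /=; ring.
  by rewrite T2; ring.
have E0 := CD_unique _ _ _ _ (FD_CD _ _ _ F) D0.
rewrite (nlin_at0 _ _ HlA) (nlin_at0 _ _ HlB) powmeanE in E0.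
rewrite /straightening.
set s := sf z u in S1 S2 Eb E0 *; set f := pt z s in Eb *.
have Hz0 := z_neq0 z Hz; have Hs1 : Cplus (RtoC 1) s <> RtoC 0 by apply: one_plus_neq0; lra.
have Hf0 : f <> RtoC 0 by apply: straightening_neq0.
have Ea : alpha f u = Cplus (alpha (RtoC 0) u) (Cmult f b) by rewrite Eb; ring.
(* Residue part and regular part; the regular part is the derivative [b] of the potential. *)
have -> : Cdiv (alpha f u) f = Cplus (Cdiv (alpha (RtoC 0) u) f) b by rewrite Ea; field.
have -> : Cpow f k = Cmult (Cmult (Cpow theta k) (Cpow z k)) (Cpow (Cplus (RtoC 1) s) k).
  by rewrite /f /pt !Cpow_mult_l.
set A := alpha (RtoC 0) u in E0 *.
set d := Cmult theta _.
have Ed : Cmult (Cdiv A f) d = Cplus (Cdiv A z) (Cmult (Cmult A (Cinv (Cplus (RtoC 1) s))) ds).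
  by rewrite /d /f /pt; field; do ?split.
have Ek : Cmult (Cmult (Cmult (Cpow theta k) (Cpow z k)) (Cpow (Cplus (RtoC 1) s) k)) d =
   Cmult (Cpow theta k.+1) (Cplus (Cmult (Cpow z k) (Cpow (Cplus (RtoC 1) s) k.+1))
     (Cmult (Cmult (Cpow z k.+1) (Cpow (Cplus (RtoC 1) s) k)) ds)).
  by rewrite /d !Cpow_S; ring.
rewrite Htheta_pow in Ek.
have -> : forall a b c, Cmult (Cplus a (Cplus b c)) d = Cplus (Cmult a d) (Cplus (Cmult b d) (Cmult c d)).
  by move=> *; ring.
rewrite Ek Ed.
set Sum := Cplus _ _ in E0.
(* Adding the vanishing sum to the right-hand side turns the claim into a polynomial identity. *)
have -> : Cplus (Cpow z k) (Cdiv A z) = Cplus (Cplus (Cpow z k) (Cdiv A z)) Sum by rewrite E0; ring.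
rewrite /Sum /d; ring.
Qed.

(** By the choice of [cc], the number [s0 u] solves the equation at [p], and small solutions are
    unique. *)
Lemma straightening_base u : Cn_norm u < delta ->
  straightening p u = Cmult (Cmult theta p) (Cplus (RtoC 1) (s0 u)).
Proof.
move=> Hu; have [S1 S2] := sf_spec p u Hp Hu; have S := s0_small u Hu.
rewrite /straightening /pt (unique (sf p u) (s0 u) p u Hp Hu) //; try lra.
by rewrite /G /cc /=; ring.
Qed.

(** When [alpha] vanishes, every term of [H] is 0 at [s = 0], and so is the constant [cc]; hence 0
    is the small solution. *)
Lemma straightening_zero z : annulus R1 R2 z ->
  (forall w, Cmod w < R0 -> alpha w Cn_zero = RtoC 0) -> s0 Cn_zero = RtoC 0 ->
  straightening z Cn_zero = Cmult theta z.
Proof.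
move=> Hz Ha Hs.
have Hu : Cn_norm (@Cn_zero n) < delta by rewrite Cn_norm_zero.
have Z0 : Cmod (RtoC 0) <= eta by rewrite Cmod_0; lra.
have H0 : forall w, annulus R1 R2 w -> H (RtoC 0) w Cn_zero = RtoC 0.
  move=> w Hw; rewrite /H powmean0 Ha ?Cmod_0; last lra.
  rewrite (potential_eq0 n R0 r delta alpha r_pos HrR0 Halpha (pt w (RtoC 0)) Cn_zero) //; first by ring.
    by have := pt_mod w _ Hw Z0; lra.
  by move=> t; apply: Ha; rewrite Cmod_mult Cmod_cis Cmod_RtoC Rabs_pos_eq; lra.
have [S1 S2] := sf_spec z Cn_zero Hz Hu.
rewrite /straightening /pt (unique (sf z Cn_zero) (RtoC 0) z Cn_zero Hz Hu) //; try lra.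
  ring.
by rewrite /G /cc /= Hs !H0 //; ring.
Qed.

End Straighten.

(** * Choice of the constants *)

Lemma powmean_near_identity k : exists eta0, 0 < eta0 /\ forall eta, 0 < eta <= eta0 -> eta <= 1 ->
  forall s s', Cmod s <= eta -> Cmod s' <= eta ->
  Cmod (Cminus (Cminus (powmean k s) s) (Cminus (powmean k s') s')) <= / 4 * Cmod (Cminus s s').
Proof.
have [K [HK H]] := pow_near_identity k.
have Hk : 0 < INR k.+1 by apply: lt_0_INR; lia.
have Hik : 0 < / INR k.+1 by apply: Rinv_0_lt_compat.
(* Makes [K * eta / (k + 1)] at most [1/4], the share of [powmean] in the contraction. *)
exists (INR k.+1 / (4 * K)); split; first by apply: Rdiv_lt_0_compat; lra.
move=> eta He He1 s s' Hs Hs'.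
have He01 : 0 <= eta <= 1 by lra.
have B := H eta s s' He01 Hs Hs'.
set D := Cminus (Cminus _ _) _ in B.
have Hn := INRS_neq0 k.
have -> : Cminus (Cminus (powmean k s) s) (Cminus (powmean k s') s') = Cmult (Cinv (RtoC (INR k.+1))) D.
  by rewrite /powmean /D; field; exact: Hn.
rewrite Cmod_mult Cmod_inv // Cmod_RtoC Rabs_pos_eq; last lra.
apply: (Rmult_le_reg_l (INR k.+1)) => //.
rewrite -Rmult_assoc Rinv_r ?Rmult_1_l; last lra.
apply: Rle_trans B _; rewrite -Rmult_assoc; apply: Rmult_le_compat_r; first exact: Cmod_ge_0.
have := Rmult_le_compat_l K _ _ (Rlt_le _ _ HK) (proj2 He).
have -> : K * (INR k.+1 / (4 * K)) = INR k.+1 * / 4 by field; lra.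
exact.
Qed.

Theorem theorem4p3 (n k j : nat) (R1 R2 R0 : R)
  (hR1 : 0 < R1) (hR12 : R1 < R2) (hR2 : R2 < R0)
  (U : Cn n -> Prop) (hUo : Cn_open U) (hU0 : U Cn_zero)
  (alpha : C -> Cn n -> C) (halpha : holo2 (cdisc R0) U alpha)
  (halpha0 : forall z, cdisc R0 z -> alpha z Cn_zero = RtoC 0)
  (p : C) (hp : annulus R1 R2 p)
  (sigma : Cn n -> C) (hsigma : holoN U sigma)
  (hsigmaD : forall u, U u -> cdisc R0 (sigma u))
  (hsigma0 : sigma Cn_zero = Cmult (root_unity k j) p) :
  exists (U0 : Cn n -> Prop) (phi : C -> Cn n -> C),
    Cn_open U0 /\ U0 Cn_zero /\ (forall u, U0 u -> U u) /\
    holo2 (annulus R1 R2) U0 phi /\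
    (forall z u, annulus R1 R2 z -> U0 u -> cdisc R0 (phi z u)) /\
    (* pullback: phi_u^* omega_u = (z^k + alpha_u(0)/z) dz on A *)
    (forall u z, U0 u -> annulus R1 R2 z ->
       phi z u <> RtoC 0 /\
       exists d : C,
         is_derive (K := C_AbsRing) (V := C_NormedModule) (fun w => phi w u) z d /\
         Cmult (Cplus (Cpow (phi z u) k) (Cdiv (alpha (phi z u) u) (phi z u))) d
         = Cplus (Cpow z k) (Cdiv (alpha (RtoC 0) u) z)) /\
    (forall z, annulus R1 R2 z -> phi z Cn_zero = Cmult (root_unity k j) z) /\
    (forall u, U0 u -> phi p u = sigma u).
Proof.
set theta := root_unity k j.
have Htheta : Cmod theta = 1 by rewrite /theta root_unity_cis Cmod_cis.
have Htheta_pow : Cpow theta k.+1 = RtoC 1 by apply: root_unity_pow.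
have Hth0 : theta <> RtoC 0 by move=> E; move: Htheta; rewrite E Cmod_0; lra.
have Hp0 : p <> RtoC 0 by case: (hp) => H1 _ E; move: H1; rewrite E Cmod_0; lra.
have Htp : Cmult theta p <> RtoC 0 by apply: Cmult_neq_0.
(* The Cauchy integrals live on radius [r]; the values of [phi] stay in the disc of radius [rr], so
   the arguments of the logarithm have modulus at most [rr / r < 1]. *)
pose r := (R2 + R0) / 2; pose rr := (R2 + r) / 2.
have Hr : R2 < r < R0 by rewrite /r; lra.
have Hrr : R2 < rr < r by rewrite /rr; lra.
have [eta0 [He0 Hpow]] := powmean_near_identity k.
(* The three bounds keep [s] well inside the domain of [log1p], keep [theta z (1 + s)] in the disc
   of radius [rr], and make [powmean] close to the identity. *)
pose eta := Rmin (/ 2) (Rmin ((rr - R2) / R2) eta0).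
have Heta : 0 < eta by repeat apply: Rmin_pos => //; [lra | apply: Rdiv_lt_0_compat; lra].
have Heta2 : eta <= / 2 by apply: Rmin_l.
have Heta3 : eta <= (rr - R2) / R2 by apply: Rle_trans (Rmin_r _ _) (Rmin_l _ _).
have Heta4 : eta <= eta0 by apply: Rle_trans (Rmin_r _ _) (Rmin_r _ _).
have Hrr_eta : R2 * (1 + eta) <= rr.
  have := Rmult_le_compat_l R2 _ _ ltac:(lra) Heta3.
  by rewrite (_ : R2 * ((rr - R2) / R2) = rr - R2); [lra | field; lra].
pose Klip := 4 * / ((1 - rr / r) * (1 - rr / r)) * / r.
have HK : 0 < 8 + Klip * R2.
  have Hir : 0 < / r by apply: Rinv_0_lt_compat; lra.
  have H1 : 0 < 1 - rr / r.
    by rewrite (_ : 1 - rr / r = (r - rr) * / r); [apply: Rmult_lt_0_compat; lra | field; lra].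
  have H2 := Rinv_0_lt_compat _ (Rmult_lt_0_compat _ _ H1 H1).
  have : 0 < Klip by rewrite /Klip; repeat apply: Rmult_lt_0_compat => //; lra.
  by move=> H3; have := Rmult_lt_0_compat Klip R2; lra.
have R1k : 0 < R1 ^ k.+1 by apply: pow_lt.
have R2k : 0 < R2 ^ k.+1 by apply: pow_lt; lra.
have R1e := Rmult_lt_0_compat _ _ R1k Heta.
pose eps := R1 ^ k.+1 * eta / 16 / (8 + Klip * R2).
have Heps : 0 < eps by apply: Rdiv_lt_0_compat => //; lra.
have Heps2 : eps * (8 + Klip * R2) <= R1 ^ k.+1 * eta / 16.
  by apply: Req_le; rewrite /eps; field; lra.
have FA := proj1 (holo2_FD n _ _ _) halpha.
(* Solves [theta p (1 + s0 u) = sigma u]; it vanishes at [u = 0] by the assumption on [sigma]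
   there. *)
pose s0 u := Cminus (Cmult (Cinv (Cmult theta p)) (sigma u)) (RtoC 1).
have FD_s0 : forall u, U u -> exists l, FD (E := NCn n) s0 u l.
  move=> u Hu; have [l Hl] := holoN_FD n U sigma hsigma u Hu.
  by eexists; exact: (FD_minus _ _ _ _ _ _ (FD_scal _ _ _ _ _ Hl) (FD_const (NCn n) (RtoC 1) u)).
have s00 : s0 Cn_zero = RtoC 0 by rewrite /s0 hsigma0 -/theta; field; split.
have [d1 [Hd1 B1]] := hUo _ hU0.
have {}B1 : forall u, Cn_norm u < d1 -> U u.
  by move=> u Hu; apply: B1; rewrite (_ : Cn_sub u Cn_zero = u) //;
    apply: functional_extensionality => i; rewrite /Cn_sub /Cn_zero; ring.
have [d2 [Hd2 B2]] : exists delta, 0 < delta /\ forall t u, Cn_norm u < delta ->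
    Cmod (alpha (Cmult (RtoC r) (cis t)) u) <= eps.
  apply: uniform_on_circle => //; first lra.
    move=> z Hz; have [l Hl] := FA z Cn_zero ltac:(rewrite /cdisc Hz; lra) hU0; exact: FD_cont Hl.
  by move=> z Hz; apply: halpha0; rewrite /cdisc Hz; lra.
(* The centre is treated apart, since [alpha_u(0)] multiplies the logarithm while the preceding
   bound concerns the circle only. *)
have [d3 [Hd3 B3]] : exists delta, 0 < delta /\ forall u, Cn_norm u < delta -> Cmod (alpha (RtoC 0) u) <= eps.
  have C0 : cdisc R0 (RtoC 0) by rewrite /cdisc Cmod_0; lra.
  have [l Hl] := FA (RtoC 0) Cn_zero C0 hU0.
  have [d [Hd H]] := FD_cont _ _ _ _ (FD_slice_r (NCn n) alpha _ _ _ Hl) eps Heps.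
  exists d; split=> // u Hu; have := H u Hu; rewrite /= Cn_zero_add halpha0 //.
  by rewrite (_ : Cminus (alpha (RtoC 0) u) (RtoC 0) = alpha (RtoC 0) u); [lra | ring].
have Hsm : 0 < R1 ^ k.+1 * eta / (16 * R2 ^ k.+1) by apply: Rdiv_lt_0_compat; lra.
have [d4 [Hd4 B4]] : exists delta, 0 < delta /\ forall u, Cn_norm u < delta ->
    Cmod (s0 u) <= R1 ^ k.+1 * eta / (16 * R2 ^ k.+1).
  have [l Hl] := FD_s0 Cn_zero hU0.
  have [d [Hd H]] := FD_cont _ _ _ _ Hl _ Hsm.
  exists d; split=> // u Hu; have := H u Hu; rewrite /= Cn_zero_add s00.
  by rewrite (_ : Cminus (s0 u) (RtoC 0) = s0 u); [lra | ring].
pose delta := Rmin (Rmin d1 d2) (Rmin d3 d4).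
have Hdelta : 0 < delta by repeat apply: Rmin_pos.
have D1 : forall u : Cn n, Cn_norm u < delta ->
    [/\ Cn_norm u < d1, Cn_norm u < d2, Cn_norm u < d3 & Cn_norm u < d4].
  move=> u Hu; have [G1 G2] := Rmin_Rgt_l _ _ _ Hu.
  by have [? ?] := Rmin_Rgt_l _ _ _ G1; have [? ?] := Rmin_Rgt_l _ _ _ G2.
have DU : forall u, Cn_norm u < delta -> U u by move=> u /D1 [? _ _ _]; apply: B1.
have hA : forall z u, Cmod z < R0 -> Cn_norm u < delta ->
  exists l, FD (E := Nprod NC (NCn n)) (fun y => alpha y.1 y.2) (z, u) l.
  by move=> z u Hz Hu; apply: FA => //; apply: DU.
have hM : forall t u, Cn_norm u < delta -> Cmod (alpha (Cmult (RtoC r) (cis t)) u) <= eps.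
  by move=> t u /D1 [_ ? _ _]; apply: B2.
have hM0 : forall u, Cn_norm u < delta -> Cmod (alpha (RtoC 0) u) <= eps.
  by move=> u /D1 [_ _ ? _]; apply: B3.
have hs0 : forall u, Cn_norm u < delta -> Cmod (s0 u) <= R1 ^ k.+1 * eta / (16 * R2 ^ k.+1).
  by move=> u /D1 [_ _ _ ?]; apply: B4.
have hFs0 : forall u, Cn_norm u < delta -> exists l, FD (E := NCn n) s0 u l.
  by move=> u Hu; apply: FD_s0; apply: DU.
have hpow := Hpow eta (conj Heta Heta4) ltac:(lra).
exists (fun u => Cn_norm u < delta), (straightening n k r eta alpha theta p s0).
split.
  move=> u Hu; exists (delta - Cn_norm u); split; first lra.
  move=> v Hv; have := Cn_norm_add n u (Cn_sub v u); rewrite Cn_addK; lra.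
split; first by rewrite Cn_norm_zero.
split; first exact: DU.
split; first by apply/holo2_FD => z u Hz Hu; apply: (FD_straightening n k R1 R2 R0 r rr eta eps delta) => //; lra.
split; first by move=> z u Hz Hu; apply: (straightening_mod n k R1 R2 R0 r rr eta eps delta) => //; lra.
split.
  move=> u z Hu Hz; split; first by apply: (straightening_neq0 n k R1 R2 R0 r rr eta eps delta) => //; lra.
  have [d [Hd Ed]] : exists d, CD (fun w => straightening n k r eta alpha theta p s0 w u) z d /\
    Cmult (Cplus (Cpow (straightening n k r eta alpha theta p s0 z u) k)
      (Cdiv (alpha (straightening n k r eta alpha theta p s0 z u) u) (straightening n k r eta alpha theta p s0 z u))) d
    = Cplus (Cpow z k) (Cdiv (alpha (RtoC 0) u) z).
    by apply: (straightening_pullback n k R1 R2 R0 r rr eta eps delta) => //; lra.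
  by exists d; split=> //; apply: CD_is_derive.
split.
  by move=> z Hz; apply: (straightening_zero n k R1 R2 R0 r rr eta eps delta) => //; lra.
move=> u Hu.
rewrite (straightening_base n k R1 R2 R0 r rr eta eps delta alpha theta p s0) //; try lra.
by rewrite /s0; field; split.
Qed.
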